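(* Let $\Omega\subset\mathbb R^2$ be a bounded polygonal domain with conforming triangulation $\Omega_h$. Let $\lambda_h\in\mathbb C$, $(u_h,\hat\sigma_h)\in U_h$ and $\varepsilon_h\in V_h$ be a solution of the lowest order discrete primal DPG eigenvalue problem $$\begin{aligned}&(\varepsilon_h,v_h)_V+(\nabla u_h,\nabla v_h)_{\Omega_h}-\langle\hat\sigma_h,v_h\rangle_{\partial\Omega_h}=\lambda_h(u_h,v_h)_{\Omega_h}&&\forall v_h\in V_h,\\&(\nabla z_h,\nabla\varepsilon_h)_{\Omega_h}-\langle\hat t_h,\varepsilon_h\rangle_{\partial\Omega_h}=0&&\forall(z_h,\hat t_h)\in U_h.\end{aligned}$$ Then the error estimators $$\eta=\|\varepsilon_h\|_V\qquad\text{and}\qquad\bar\eta=\Big(\sum_{T\in\Omega_h}|T|^{1/2}\sum_{E\in\mathcal E(T)}\|[\nabla_h\varepsilon_h]_E\|_{L^2(E)}^2\Big)^{1/2}$$ are equivalent, i.e. there are constants $c,C>0$ independent of the mesh size such that $c\,\bar\eta\le\eta\le C\,\bar\eta$.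
   Context: $\Omega_h$ belongs to a shape-regular family of conforming triangulations; constants may depend on the domain and on shape regularity only. $\partial\Omega_h$ is the skeleton (the collection of element boundaries). $U_h=U_{h,0}\times U_{h,1}$ with $U_{h,0}=S^1_0(\Omega_h)$, the continuous piecewise affine functions vanishing on $\partial\Omega$, and $U_{h,1}=P_0(\partial\Omega_h)\cap H^{-1/2}(\partial\Omega_h)$, the edgewise constant elements of $H^{-1/2}(\partial\Omega_h)$; here $H^{-1/2}(\partial\Omega_h)$ is the set of $\tau\in\prod_K H^{-1/2}(\partial K)$ for which there is $\boldsymbol\tau\in\mathbf H(\mathrm{div};\Omega)$ with $\tau|_{\partial K}=\boldsymbol\tau\cdot\mathbf n|_{\partial K}$ for all $K\in\Omega_h$. $V_h=P_1(\Omega_h)$ is the space of discontinuous piecewise affine functions, $V=H^1(\Omega_h)$ the broken $H^1$ space with $\|v\|_V^2=\|v\|_{L^2(\Omega)}^2+\|\nabla_hv\|_{L^2(\Omega)}^2$ and $(\cdot,\cdot)_V$ the associated inner product; $\nabla_h$ is the elementwise gradient, $(\cdot,\cdot)_{\Omega_h}$ the broken $L^2$ inner product, and $\langle\cdot,\cdot\rangle_{\partial\Omega_h}$ the sum over $K$ of the duality pairings on $\partial K$. $|T|$ is the area of the triangle $T$, $\mathcal E(T)$ the set of its edges, and $[\cdot]_E$ the jump across $E$ (on a boundary edge, the trace from the adjacent element). *)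

(* Defs.v *)
From HB Require Import structures.
From mathcomp Require Import all_boot all_order all_algebra.
From mathcomp Require Import all_classical all_reals all_analysis.
From mathcomp Require Export complex.
Set Implicit Arguments.
Unset Strict Implicit.
Unset Printing Implicit Defensive.
Import Order.TTheory GRing.Theory Num.Theory.
Import numFieldNormedType.Exports.
Local Open Scope classical_set_scope.
Local Open Scope ring_scope.
Local Open Scope complex_scope.

(** The library norm on [R * R] is the maximum norm, hence
    the explicit Euclidean distance. *)

Definition edist (R : realType) (x y : R * R) : R :=
  Num.sqrt ((x.1 - y.1) ^+ 2 + (x.2 - y.2) ^+ 2).

Definition segment (R : realType) (a b : R * R) : set (R * R) :=
  [set (1 - t) *: a + t *: b | t in `[0, 1]%classic].

Definition leb2 (R : realType) :
    {measure set (measurableTypeR R * measurableTypeR R) -> \bar R} :=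
  (@lebesgue_measure R \x @lebesgue_measure R)%E.

Definition bdry (R : realType) (Omega : set (R * R)) : set (R * R) :=
  closure Omega `\` interior Omega.

(** Regularity of the open set ([Omega] is the interior of its closure) excludes
    slits and punctures; every Lipschitz domain satisfies it. *)
Definition bounded_polygonal_domain (R : realType) (Omega : set (R * R)) : Prop :=
  [/\ open Omega, connected Omega, Omega !=set0, bounded_set Omega &
      interior (closure Omega) = Omega /\
      exists s : seq ((R * R) * (R * R)),
        bdry Omega = [set x | exists2 p, p \in s & segment p.1 p.2 x]].

(** A triangle is given by its three vertices; its edge [i]
    is the one opposite to vertex [i] (indices modulo 3). *)

Definition tri (R : realType) := 'I_3 -> R * R.

Definition tri_set (R : realType) (T : tri R) : set (R * R) :=
  [set x | exists l : 'I_3 -> R,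
    [/\ forall i, 0 <= l i, \sum_i l i = 1 & x = \sum_i l i *: T i]].

Definition edge (R : realType) (T : tri R) (i : 'I_3) : set (R * R) :=
  segment (T (i + 1)) (T (i + 2%:R)).

Definition edge_length (R : realType) (T : tri R) (i : 'I_3) : R :=
  edist (T (i + 1)) (T (i + 2%:R)).

Definition edge_point (R : realType) (T : tri R) (i : 'I_3) (t : R) : R * R :=
  (1 - t) *: T (i + 1) + t *: T (i + 2%:R).

Definition area (R : realType) (T : tri R) : R := fine (leb2 R (tri_set T)).

Definition nondegenerate (R : realType) (T : tri R) : Prop :=
  let a := T 1 - T 0 in let b := T 2%:R - T 0 in
  a.1 * b.2 - a.2 * b.1 != 0.

Definition mesh (R : realType) (n : nat) := 'I_n -> tri R.

Definition conforming_triangulation (R : realType) (Omega : set (R * R))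
    (n : nat) (Th : mesh R n) : Prop :=
  [/\ forall K, nondegenerate (Th K),
      \bigcup_(K in [set: 'I_n]) tri_set (Th K) = closure Omega &
      forall K L, K != L ->
        [\/ tri_set (Th K) `&` tri_set (Th L) = set0,
            exists i j, Th K i = Th L j /\
              tri_set (Th K) `&` tri_set (Th L) = [set Th K i] |
            exists i j, edge (Th K) i = edge (Th L) j /\
              tri_set (Th K) `&` tri_set (Th L) = edge (Th K) i]].

(** Diameter of each element at most [gamma] times the diameter [2 r] of an
    inscribed disc. *)
Definition shape_regular (R : realType) (gamma : R) (n : nat) (Th : mesh R n) : Prop :=
  forall K, exists z : R * R, exists2 r : R, 0 < r &
    (forall x, edist x z <= r -> tri_set (Th K) x) /\
    (forall x y, tri_set (Th K) x -> tri_set (Th K) y ->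
       edist x y <= gamma * (2 * r)).

Definition cintegral (R : realType) d (X : measurableType d)
    (mu : {measure set X -> \bar R}) (D : set X) (f : X -> R[i]) : R[i] :=
  Rintegral mu D (fun x => complex.Re (f x)) +i*
  Rintegral mu D (fun x => complex.Im (f x)).

Definition area_int (R : realType) (D : set (R * R)) (f : R * R -> R[i]) : R[i] :=
  cintegral (leb2 R) D f.

Definition edge_int (R : realType) (T : tri R) (i : 'I_3) (f : R * R -> R[i]) : R[i] :=
  (edge_length T i)%:C *
  cintegral (@lebesgue_measure R) `[0, 1]%classic (fun t => f (edge_point T i t)).

Definition sqmod (R : realType) (z : R[i]) : R :=
  complex.Re z ^+ 2 + complex.Im z ^+ 2.

Definition sqmod2 (R : realType) (p : R[i] * R[i]) : R := sqmod p.1 + sqmod p.2.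

Definition cdot (R : realType) (p q : R[i] * R[i]) : R[i] :=
  p.1 * conjc q.1 + p.2 * conjc q.2.

Definition pd (R : realType) (v : R * R) (f : R * R -> R) : R * R -> R :=
  fun x => 'D_v f x.

Definition cpd (R : realType) (v : R * R) (f : R * R -> R[i]) (x : R * R) : R[i] :=
  pd v (fun y => complex.Re (f y)) x +i* pd v (fun y => complex.Im (f y)) x.

Definition cgrad (R : realType) (f : R * R -> R[i]) (x : R * R) : R[i] * R[i] :=
  (cpd (1, 0) f x, cpd (0, 1) f x).

(** Class C^infinity on the plane: all iterated directional derivatives are
    differentiable everywhere. *)
Definition smooth (R : realType) (phi : R * R -> R) : Prop :=
  forall (s : seq (R * R)) (x : R * R), differentiable (foldr (@pd R) phi s) x.

Definition test_function (R : realType) (Omega : set (R * R)) (phi : R * R -> R) : Prop :=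
  let supp := closure [set x | phi x != 0] in
  [/\ smooth phi, compact supp & supp `<=` Omega].

(** Elements of L^2(Omega) are represented by functions measurable on the whole
    plane (e.g. extended by zero). *)
Definition in_L2 (R : realType) (Omega : set (R * R)) (f : R * R -> R[i]) : Prop :=
  [/\ measurable_fun [set: measurableTypeR R * measurableTypeR R] (fun x => complex.Re (f x)),
      measurable_fun [set: measurableTypeR R * measurableTypeR R] (fun x => complex.Im (f x)) &
      (\int[leb2 R]_(x in Omega) (sqmod (f x))%:E < +oo)%E].

Definition weak_div (R : realType) (Omega : set (R * R))
    (q : R * R -> R[i] * R[i]) (d : R * R -> R[i]) : Prop :=
  forall phi, test_function Omega phi ->
    area_int Omega (fun x => (q x).1 * (pd (1, 0) phi x)%:C
                           + (q x).2 * (pd (0, 1) phi x)%:C)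
    = - area_int Omega (fun x => d x * (phi x)%:C).

Definition in_Hdiv (R : realType) (Omega : set (R * R))
    (q : R * R -> R[i] * R[i]) (d : R * R -> R[i]) : Prop :=
  [/\ in_L2 Omega (fun x => (q x).1), in_L2 Omega (fun x => (q x).2),
      in_L2 Omega d & weak_div Omega q d].

(** The functional on the boundary of [T] with the constant value [tau i] on
    edge [i] is the normal trace of [q] (with divergence [d]), in the sense of
    Green's formula on [T]; the smooth functions are dense in H^1(T). *)
Definition normal_trace (R : realType) (T : tri R)
    (q : R * R -> R[i] * R[i]) (d : R * R -> R[i]) (tau : 'I_3 -> R[i]) : Prop :=
  forall phi : R * R -> R, smooth phi ->
    \sum_i edge_int T i (fun x => tau i * (phi x)%:C) =
    area_int (tri_set T) (fun x => (q x).1 * (pd (1, 0) phi x)%:C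
                                 + (q x).2 * (pd (0, 1) phi x)%:C
                                 + d x * (phi x)%:C).

(** An element of a broken space is a family of functions
    indexed by the triangles; only the values of [v K] on the triangle [K] are
    meaningful. *)

Definition broken (R : realType) (n : nat) := 'I_n -> R * R -> R[i].

Definition affine (R : realType) (f : R * R -> R[i]) : Prop :=
  exists a b c : R[i], forall x, f x = a + b * x.1%:C + c * x.2%:C.

Definition in_P1 (R : realType) (n : nat) (v : broken R n) : Prop :=
  forall K, affine (v K).

(** S^1_0(Omega_h), as the elementwise restrictions of continuous functions [w]
    on the closure of [Omega] that vanish on the boundary. *)
Definition in_S10 (R : realType) (Omega : set (R * R)) (n : nat) (Th : mesh R n)
    (u : broken R n) : Prop :=
  in_P1 u /\
  exists w : R * R -> R[i],
    [/\ {within closure Omega, continuous (fun x => complex.Re (w x))},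
        {within closure Omega, continuous (fun x => complex.Im (w x))},
        forall K x, tri_set (Th K) x -> w x = u K x &
        forall x, bdry Omega x -> w x = 0].

(** Edgewise constant functions on the skeleton: [tau K i] is the value on the
    edge [i] of the boundary of [K], so that a function carries two values on an
    interior edge. *)
Definition skel (R : realType) (n : nat) := 'I_n -> 'I_3 -> R[i].

Definition in_P0_skel (R : realType) (Omega : set (R * R)) (n : nat) (Th : mesh R n)
    (tau : skel R n) : Prop :=
  exists q d, in_Hdiv Omega q d /\ forall K, normal_trace (Th K) q d (tau K).

(** The forms are antilinear in the second argument. *)

Definition ip (R : realType) (n : nat) (Th : mesh R n) (u v : broken R n) : R[i] :=
  \sum_K area_int (tri_set (Th K)) (fun x => u K x * conjc (v K x)).

Definition ip_grad (R : realType) (n : nat) (Th : mesh R n) (u v : broken R n) : R[i] :=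
  \sum_K area_int (tri_set (Th K)) (fun x => cdot (cgrad (u K) x) (cgrad (v K) x)).

Definition ipV (R : realType) (n : nat) (Th : mesh R n) (u v : broken R n) : R[i] :=
  ip Th u v + ip_grad Th u v.

Definition dual_skel (R : realType) (n : nat) (Th : mesh R n) (tau : skel R n)
    (v : broken R n) : R[i] :=
  \sum_K \sum_i edge_int (Th K) i (fun x => tau K i * conjc (v K x)).

Definition normV (R : realType) (n : nat) (Th : mesh R n) (v : broken R n) : R :=
  Num.sqrt (
    \sum_K Rintegral (leb2 R) (tri_set (Th K)) (fun x => sqmod (v K x)) +
    \sum_K Rintegral (leb2 R) (tri_set (Th K)) (fun x => sqmod2 (cgrad (v K) x))).

Definition dpg_solution (R : realType) (Omega : set (R * R)) (n : nat) (Th : mesh R n)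
    (lambda : R[i]) (u : broken R n) (sigma : skel R n) (eps : broken R n) : Prop :=
  [/\ in_S10 Omega Th u, in_P0_skel Omega Th sigma, in_P1 eps,
      forall v, in_P1 v ->
        ipV Th eps v + ip_grad Th u v - dual_skel Th sigma v = lambda * ip Th u v &
      forall z t, in_S10 Omega Th z -> in_P0_skel Omega Th t ->
        ip_grad Th z eps - dual_skel Th t eps = 0].

(** The element sharing the edge [i] of [K], or [None] on the boundary. *)
Definition neighbour (R : realType) (n : nat) (Th : mesh R n) (K : 'I_n) (i : 'I_3) :
    option 'I_n :=
  [pick L : 'I_n | (L != K) && `[< exists j, edge (Th L) j = edge (Th K) i >]].

(** The jump of the broken gradient across the edge [i] of [K], up to sign. *)
Definition jump_grad (R : realType) (n : nat) (Th : mesh R n) (v : broken R n)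
    (K : 'I_n) (i : 'I_3) (x : R * R) : R[i] * R[i] :=
  if neighbour Th K i is Some L then cgrad (v K) x - cgrad (v L) x
  else cgrad (v K) x.

Definition sqnorm_jump (R : realType) (n : nat) (Th : mesh R n) (v : broken R n)
    (K : 'I_n) (i : 'I_3) : R :=
  edge_length (Th K) i *
  Rintegral (@lebesgue_measure R) `[0, 1]%classic
    (fun t => sqmod2 (jump_grad Th v K i (edge_point (Th K) i t))).

Definition eta (R : realType) (n : nat) (Th : mesh R n) (eps : broken R n) : R :=
  normV Th eps.

Definition eta_bar (R : realType) (n : nat) (Th : mesh R n) (eps : broken R n) : R :=
  Num.sqrt (\sum_K Num.sqrt (area (Th K)) * \sum_i sqnorm_jump Th eps K i).

(* Main.v *)
Require Import Defs.
From mathcomp Require Import all_boot all_order all_algebra.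
From mathcomp Require Import all_classical all_reals all_analysis.
From mathcomp Require Import measurable_realfun ring lra.
Import Order.TTheory GRing.Theory Num.Theory.
Import numFieldNormedType.Exports.
Set Implicit Arguments.
Unset Strict Implicit.
Unset Printing Implicit Defensive.
Local Open Scope classical_set_scope.
Local Open Scope ring_scope.
Local Open Scope complex_scope.

(** Tested with the lowest order Raviart-Thomas fields of single edges, the
    second equation says that [eps] has continuous
    edge means (zero on the boundary), i.e. is a Crouzeix-Raviart function;
    tested with [z_h], it says that the broken gradient of [eps] is orthogonal
    to the gradients of [S^1_0]. Subtracting from [eps] the conforming function
    with nodal values picked from one adjacent triangle (zero on the boundary),
    one bounds the broken gradient by the nodal differences, which are sums of
    jumps along chains of triangles around a vertex; a jump with zero edge mean
    is controlled by the jump of the gradient. The L^2 part of the norm is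
    controlled by a discrete Poincare inequality: the flux of the field [x]
    through the edges, weighted with the squares of the edge means, sums to zero
    over the mesh, whereas it sums to twice the area of each triangle without
    weights. The converse bound is local. *)

(** * Linear changes of variables in the plane *)

(** The constants must be uniform over all meshes, so scaling to a reference element is replaced by
    explicit bounds in the radius of an inscribed disc of each triangle, the regularity parameter,
    and a box around the domain. Membership in the skeleton space asks for a field on the whole
    domain with a weak divergence and prescribed normal traces. This requires Green's formula with
    smooth test functions on every triangle; it suffices to have it for the fields [x - a] with [a]
    a vertex, which span the Raviart-Thomas fields. The domain need not be Lipschitz: the triangles
    at a boundary vertex may form several fans, and each fan must be shown to reach a boundary edge.
    The argument is topological: a fan without boundary edge, prolonged to infinite sectors, is
    closed, and open away from the vertex, hence the whole plane; the vertex is then interior. The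
    length of a chain is bounded by the number of triangles at a vertex, and this number by a
    packing argument for the inscribed discs. Real test functions suffice, so the real and imaginary
    parts of [eps] are treated as two independent real functions. *)

Section PlaneMeasure.
Variable R : realType.
Notation leb := (@lebesgue_measure R).
Notation plane := (measurableTypeR R * measurableTypeR R)%type.

Lemma measurable_affine (c d : R) :
  measurable_fun [set: measurableTypeR R]
    ((fun t => c * t + d) : measurableTypeR R -> measurableTypeR R).
Proof.
apply: continuous_measurable_fun => t; apply: continuousD; last exact: cvg_cst.
by apply: continuousM; [exact: cvg_cst | exact: cvg_id].
Qed.

(** [|c|] times the pushforward gives every half-open interval its length, and this property
    determines Lebesgue measure. For [c < 0] the preimage of []a, b]] is closed on the left instead,
    with the same length. *)
Lemma lebesgue_measure_affine (c d : R) : c != 0 ->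
  forall A : set (measurableTypeR R), measurable A ->
  pushforward leb ((fun t => c * t + d) : measurableTypeR R -> measurableTypeR R) A
    = (`|c|^-1%:E * leb A)%E.
Proof.
move=> c0 A mA; have c1 : 0 <= `|c|^-1 by rewrite invr_ge0.
have mf := measurable_affine c d.
pose P : {measure set (measurableTypeR R) -> \bar R} :=
  measure_function_pushforward__canonical__measure_function_Measure leb mf.
have lebE : leb A = mscale (NngNum (normr_ge0 c)) P A.
  apply: lebesgue_measure_unique => //= _ [[a b] _ <-]; rewrite /mscale/= /pushforward/=.
  case: (ltgtP c 0) => [cn|cp|/eqP]; last by rewrite (negbTE c0).
  - rewrite [X in _ = (_ * leb X)%E](_ : _ = `[(b - d) / c, (a - d) / c[%classic); last first.
      apply/seteqP; split=> t /=; rewrite !in_itv/= ler_ndivrMr // ltr_ndivlMr //;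
      rewrite lerBrDr ltrBlDr (mulrC t) andbC //.
    rewrite !lebesgue_measure_itv/= !lte_fin ltr_nM2r ?invr_lt0 // ltrD2r.
    case: ifP => _; last by rewrite mule0.
    rewrite -!EFinD -EFinM ltr0_norm //.
    by congr EFin; field.
  - rewrite [X in _ = (_ * leb X)%E](_ : _ = `](a - d) / c, (b - d) / c]%classic); last first.
      apply/seteqP; split=> t /=; rewrite !in_itv/= ler_pdivlMr // ltr_pdivrMr //;
      rewrite lerBrDr ltrBlDr (mulrC t) //.
    rewrite !lebesgue_measure_itv/= !lte_fin ltr_pM2r ?invr_gt0 // ltrD2r.
    case: ifP => _; last by rewrite mule0.
    rewrite -!EFinD -EFinM gtr0_norm //.
    by congr EFin; field.
rewrite lebE /mscale/= muleA -EFinM mulVf ?mul1e // normr_eq0 //.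
Qed.

Local Open Scope ereal_scope.

Lemma ge0_integral_affine (c d : R) (f : R -> \bar R) : (c != 0)%R ->
  measurable_fun [set: measurableTypeR R] f -> (forall x, 0 <= f x) ->
  \int[leb]_x f x = `|c|%:E * \int[leb]_t f (c * t + d)%R.
Proof.
move=> c0 mf f0; have mg := measurable_affine c d.
have := ge0_integral_pushforward mg leb measurableT mf (fun y _ => f0 y).
rewrite preimage_setT => /= <-.
have c1 : (0 <= `|c|^-1)%R by rewrite invr_ge0.
transitivity (`|c|%:E * \int[mscale (NngNum c1) leb]_y f y).
  rewrite ge0_integral_mscale //= muleA -EFinM mulfV ?mul1e // normr_eq0 //.
congr (_ * _); apply: eq_measure_integral => A mA _.
exact/esym/lebesgue_measure_affine.
Qed.

Lemma measurable_affine_plane (a1 a2 b1 b2 p1 p2 : R) :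
  measurable_fun [set: plane] ((fun z => (a1 * z.1 + b1 * z.2 + p1,
    a2 * z.1 + b2 * z.2 + p2)%R) : plane -> plane).
Proof.
by apply: measurable_fun_pair; (apply: measurable_funD => //;
  apply: measurable_funD; apply: measurable_funM => //).
Qed.

(** If [a1] is nonzero, the map factors into a substitution in the first variable and one in the
    second, and Tonelli's theorem lets each be done on a line. If [a1] vanishes, [b1] does not, and
    the two columns are exchanged. *)
Lemma ge0_integral_linear_plane (a1 a2 b1 b2 p1 p2 : R) (f : plane -> \bar R) :
  (a1 * b2 - a2 * b1 != 0)%R ->
  measurable_fun [set: plane] f -> (forall z, 0 <= f z) ->
  \int[leb2 R]_z f z = `|a1 * b2 - a2 * b1|%:E *
    \int[leb2 R]_z f (a1 * z.1 + b1 * z.2 + p1, a2 * z.1 + b2 * z.2 + p2)%R.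
Proof.
move=> + mf f0.
have key (a1' a2' b1' b2' : R) : (a1' * b2' - a2' * b1' != 0)%R -> (a1' != 0)%R ->
  \int[leb2 R]_z f z = `|a1' * b2' - a2' * b1'|%:E *
    \int[leb2 R]_z f (a1' * z.1 + b1' * z.2 + p1, a2' * z.1 + b2' * z.2 + p2)%R.
  move: a1' a2' b1' b2' => {}a1 {}a2 {}b1 {}b2 d0 a0.
  have mA u1 u2 v1 v2 w1 w2 := measurable_affine_plane u1 u2 v1 v2 w1 w2.
  have mc := measurableT_comp mf (mA a1 a2 b1 b2 p1 p2).
  rewrite [in RHS]/leb2 (fubini_tonelli2 _ mc (fun z => f0 _))/=.
  (* In terms of the new first coordinate [x], the second coordinate of the image is
     [q1 * x + q2 * t + q3]; [q2] is the determinant divided by [a1]. *)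
  pose q1 := (a2 / a1)%R.
  pose q2 := (b2 - a2 * b1 / a1)%R.
  pose q3 := (p2 - a2 / a1 * p1)%R.
  have m1 : measurable_fun [set: plane] (fun z => f (z.1, q1 * z.1 + q2 * z.2 + q3)%R).
    have := measurableT_comp mf (mA 1 q1 0 q2 0 q3)%R.
    by congr measurable_fun; apply/funext => z /=; rewrite mul1r mul0r !addr0.
  transitivity (`|a1 * b2 - a2 * b1|%:E * \int[leb]_t (`|a1|^-1%:E *
      \int[leb]_x f (x, q1 * x + q2 * t + q3)%R)); last first.
    congr (_ * _); apply: eq_integral => t _; rewrite /fubini_G/=.
    rewrite (ge0_integral_affine (b1 * t + p1) a0) //; last first.
      exact: (measurableT_comp m1 (pair2_measurable t)).
    rewrite muleA -EFinM mulVf ?normr_eq0 // mul1e.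
    apply: eq_integral => x _; congr f; congr pair; first by rewrite addrA.
    by rewrite /q1 /q2 /q3; field.
  rewrite ge0_integralZl //; last 2 first.
    exact: (measurable_fun_fubini_tonelli_G _ m1).
  + by move=> t _; apply: integral_ge0.
  rewrite muleA -EFinM -(fubini_tonelli _ m1 (fun z => f0 _))/= /fubini_F/=.
  have q20 : (q2 != 0)%R.
    have -> : q2 = ((a1 * b2 - a2 * b1) / a1)%R by rewrite /q2; field.
    by rewrite mulf_neq0 ?invr_eq0.
  rewrite /leb2 (fubini_tonelli1 _ mf f0).
  transitivity (`|q2|%:E * \int[leb]_x (`|q2|^-1%:E * \int[leb]_y f (x, y)%R)).
    rewrite ge0_integralZl //; last 2 first.
    exact: (measurable_fun_fubini_tonelli_F _ mf).
  + by move=> t _; apply: integral_ge0.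
    by rewrite muleA -EFinM mulfV ?normr_eq0 // mul1e.
  congr (_%:E * _).
    by rewrite -normfV -normrM; congr `|_|%R; rewrite /q2; field.
  apply: eq_integral => x _.
  rewrite (ge0_integral_affine (q1 * x + q3) q20) //; last first.
    exact: (measurableT_comp mf (pair1_measurable x)).
  rewrite muleA -EFinM mulVf ?normr_eq0 // mul1e.
  by apply: eq_integral => t _; congr (f (_, _)); ring.
move=> d0; have [a10|a10] := eqVneq a1 0%R; last exact: key.
have b10 : (b1 != 0)%R by apply: contraNneq d0 => ->; rewrite a10 mul0r mulr0 subrr.
have dE : (b1 * a2 - b2 * a1 = - (a1 * b2 - a2 * b1))%R by ring.
rewrite (key b1 b2 a1 a2) // dE ?oppr_eq0 // normrN; congr (_ * _).
have m2 := measurableT_comp mf (measurable_affine_plane b1 b2 a1 a2 p1 p2).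
have m3 := measurableT_comp mf (measurable_affine_plane a1 a2 b1 b2 p1 p2).
rewrite /leb2 (fubini_tonelli1 _ m2 (fun z => f0 _)) (fubini_tonelli2 _ m3 (fun z => f0 _)).
apply: eq_integral => x _; apply: eq_integral => y _ /=.
by rewrite (addrC (b1 * x)%R) (addrC (b2 * x)%R).
Qed.

End PlaneMeasure.

(** * Borel sets for the product measurable structure of the plane *)

Section PlaneContinuous.
Variable R : realType.
Notation leb := (@lebesgue_measure R).
Notation plane := (measurableTypeR R * measurableTypeR R)%type.

(** An open set is the countable union of the boxes with rational centre and radius [1 / (n + 1)]
    that it contains. *)
Lemma open_measurable_plane (U : set (R * R)) : open U -> measurable (U : set plane).
Proof.
move=> oU; pose box (a b : rat) (n : nat) : set plane :=
  ball (ratr a : R) n.+1%:R^-1 `*` ball (ratr b : R) n.+1%:R^-1.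
have -> : U = \bigcup_(a in [set: rat]) \bigcup_(b in [set: rat])
    \bigcup_(n in [set: nat]) (if `[< box a b n `<=` U >] then box a b n else set0).
  apply/seteqP; split=> [x Ux|x [a _ [b _ [n _]]]]; last by case: asboolP => // + ?; apply.
  have /nbhs_ballP[e /= e0 xe] : nbhs x U by exact: open_nbhs_nbhs.
  have e20 : 0 < e / 2 by rewrite divr_gt0.
  have [n _ /(_ _ (leqnn n)) ne] := near_infty_natSinv_lt (PosNum e20).
  move: ne => /=; set r := n.+1%:R^-1 => ne.
  have r0 : 0 < r by rewrite invr_gt0.
  have box_rat (t : R) : exists a : rat, ball (ratr a : R) r t.
    have [a] := @rat_in_itvoo R t (t + r) (ltac:(by rewrite ltrDl)).
    rewrite in_itv/= => /andP[ta tb]; exists a.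
    by rewrite /ball/= ltr_norml; apply/andP; split; lra.
  have [a xa] := box_rat x.1; have [b xb] := box_rat x.2.
  exists a => //; exists b => //; exists n => //; case: asboolP => // -[] y [ya yb].
  apply: xe; split.
    apply: le_ball (ball_triangle (ball_sym xa) ya). rewrite -/r; lra.
  apply: le_ball (ball_triangle (ball_sym xb) yb). rewrite -/r; lra.
apply: bigcupT_measurable_rat => a; apply: bigcupT_measurable_rat => b.
apply: bigcupT_measurable => n; case: ifP => _ //.
by apply: measurableX; exact: measurable_ball.
Qed.

Lemma continuous_measurable_plane (f : R * R -> R) :
  continuous f -> measurable_fun [set: plane] (f : plane -> measurableTypeR R).
Proof.
move=> /continuousP cf; apply: (measurability _ (RGenOpens.measurableE R)).
move=> _ [_ [a [b ->] <-]]; rewrite setTI; apply: open_measurable_plane.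
exact/cf/interval_open.
Qed.

End PlaneContinuous.

(** * Barycentric coordinates *)

Lemma ord3_ind (P : 'I_3 -> Prop) : P 0 -> P 1 -> P 2%:R -> forall i, P i.
Proof.
move=> P0 P1 P2 [[|[|[|m]]] mlt] //.
- by have -> : Ordinal mlt = 0 by exact: val_inj.
- by have -> : Ordinal mlt = 1 by exact: val_inj.
- by have -> : Ordinal mlt = 2%:R by exact: val_inj.
Qed.

Lemma ord3E :
  (((0 + 1)%R = 1%R :> 'I_3) * ((0 + 2%:R)%R = 2%:R%R :> 'I_3) *
   ((1 + 1)%R = 2%:R%R :> 'I_3) * ((1 + 2%:R)%R = 0%R :> 'I_3) *
   ((2%:R + 1)%R = 0%R :> 'I_3) * ((2%:R + 2%:R)%R = 1%R :> 'I_3))%type.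
Proof. by do !split; exact: val_inj. Qed.

Lemma sum_ord3 (V : nmodType) (F : 'I_3 -> V) : \sum_i F i = F 0 + F 1 + F 2%:R.
Proof.
rewrite !big_ord_recl big_ord0 addr0 addrA.
by congr (F _ + F _ + F _); apply: val_inj.
Qed.

Lemma sum_ord3_rot (V : nmodType) (F : 'I_3 -> V) (i : 'I_3) :
  \sum_j F j = F i + F (i + 1) + F (i + 2%:R).
Proof.
rewrite sum_ord3; elim/ord3_ind: i; rewrite !ord3E //.
  by rewrite -addrA addrC.
by rewrite addrC addrA.
Qed.

Lemma ord3_rot_ind (P : 'I_3 -> Prop) i :
  P i -> P (i + 1) -> P (i + 2%:R) -> forall j, P j.
Proof.
elim/ord3_ind: i; rewrite !ord3E => P0 P1 P2; exact: ord3_ind.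
Qed.

Lemma ord3_neq (i : 'I_3) : [/\ i + 1 != i, i + 2%:R != i & i + 2%:R != i + 1].
Proof. by elim/ord3_ind: i. Qed.

Section Barycentric.
Variable R : realType.
Implicit Types (T : tri R) (x y a b : R * R) (i j : 'I_3).

Definition cross (a b : R * R) : R := a.1 * b.2 - a.2 * b.1.

Definition tri_det (T : tri R) : R := cross (T 1 - T 0) (T 2%:R - T 0).

Lemma plane_ext (x y : R * R) : x.1 = y.1 -> x.2 = y.2 -> x = y.
Proof. by case: x => ? ?; case: y => ? ? /= -> ->. Qed.

Lemma planeE :
  ((forall (a : R) x, (a *: x)%R.1 = (a * x.1)%R) * (forall (a : R) x, (a *: x)%R.2 = (a * x.2)%R) *
   (forall x y, (x + y)%R.1 = (x.1 + y.1)%R) * (forall x y, (x + y)%R.2 = (x.2 + y.2)%R) *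
   (forall x, (- x)%R.1 = (- x.1)%R) * (forall x, (- x)%R.2 = (- x.2)%R))%type.
Proof. by []. Qed.

Lemma tri_det_rot T i : cross (T (i + 1) - T i) (T (i + 2%:R) - T i) = tri_det T.
Proof. by elim/ord3_ind: i; rewrite !ord3E /tri_det /cross //=; ring. Qed.

(** Ratio of signed areas: vertex [i] is replaced by [x] in the numerator. *)
Definition bary (T : tri R) (i : 'I_3) (x : R * R) : R :=
  cross (T (i + 1) - x) (T (i + 2%:R) - x) / tri_det T.

Definition bary_grad (T : tri R) (i : 'I_3) : R * R :=
  (((T (i + 1)).2 - (T (i + 2%:R)).2) / tri_det T,
   ((T (i + 2%:R)).1 - (T (i + 1)).1) / tri_det T).

Definition dot (a b : R * R) : R := a.1 * b.1 + a.2 * b.2.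

Lemma bary_affine T i x y :
  bary T i x = bary T i y + dot (bary_grad T i) (x - y).
Proof. by rewrite /bary /dot /bary_grad /cross /=; ring. Qed.

Lemma tri_combE (T : tri R) (l : 'I_3 -> R) :
  \sum_i l i *: T i = (l 0 * (T 0).1 + l 1 * (T 1).1 + l 2%:R * (T 2%:R).1,
                       l 0 * (T 0).2 + l 1 * (T 1).2 + l 2%:R * (T 2%:R).2).
Proof. by rewrite sum_ord3; exact: plane_ext. Qed.

Section Nondegenerate.
Variable T : tri R.
Hypothesis nT : Defs.nondegenerate T.

Lemma tri_det_neq0 : tri_det T != 0. Proof. exact: nT. Qed.

Lemma bary_sum x : \sum_i bary T i x = 1.
Proof.
have := tri_det_neq0; rewrite sum_ord3 /bary !ord3E -!mulrDl => d0.
by apply: (canLR (mulfK d0)); rewrite mul1r /tri_det /cross/=; ring.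
Qed.

Lemma bary_comb x : \sum_i bary T i x *: T i = x.
Proof.
have := tri_det_neq0; rewrite tri_combE /bary !ord3E => d0.
by apply: plane_ext => /=; apply: (mulIf d0); move: d0;
  rewrite /tri_det /cross/= => d0; field.
Qed.

Lemma bary_of_comb (l : 'I_3 -> R) i : \sum_i l i = 1 ->
  bary T i (\sum_i l i *: T i) = l i.
Proof.
move=> l1; apply: (mulIf tri_det_neq0); rewrite /bary divfK ?tri_det_neq0 // tri_combE.
have l0 : l 0 = 1 - l 1 - l 2%:R by rewrite -l1 sum_ord3; ring.
by elim/ord3_ind: i; rewrite !ord3E /tri_det /cross/= l0; ring.
Qed.

Lemma bary_vertex i j : bary T i (T j) = (i == j)%:R.
Proof.
rewrite -[T j](_ : \sum_k (k == j)%:R *: T k = T j) ?bary_of_comb //.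
  by rewrite (bigD1 j) //= eqxx big1 ?addr0 // => k /negbTE->.
rewrite (bigD1 j) //= eqxx scale1r big1 ?addr0 // => k /negbTE->.
by rewrite scale0r.
Qed.

Lemma tri_setP x : tri_set T x <-> forall i, 0 <= bary T i x.
Proof.
split=> [[l [l0 l1 ->]] i|b0]; first by rewrite bary_of_comb.
by exists (bary T ^~ x); split; [|exact: bary_sum|rewrite bary_comb].
Qed.

Lemma edgeP i x : edge T i x <-> tri_set T x /\ bary T i x = 0.
Proof.
split=> [[t /= + <-]|[/tri_setP b0 bi]].
  rewrite in_itv/= => /andP[t0 t1].
  pose l : 'I_3 -> R := fun j => if j == i then 0 else if j == i + 1 then 1 - t else t.
  have [e1 e2 e3] := ord3_neq i.
  have li : l i = 0 by rewrite /l eqxx.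
  have li1 : l (i + 1) = 1 - t by rewrite /l (negbTE e1) eqxx.
  have li2 : l (i + 2%:R) = t by rewrite /l (negbTE e2) (negbTE e3).
  have l1 : \sum_i l i = 1 by rewrite (sum_ord3_rot _ i) li li1 li2; ring.
  have <- : \sum_i l i *: T i = (1 - t) *: T (i + 1) + t *: T (i + 2%:R).
    by rewrite (sum_ord3_rot _ i) li li1 li2 scale0r add0r.
  split; last by rewrite bary_of_comb.
  by exists l; split=> //; apply: (@ord3_rot_ind _ i); rewrite ?li ?li1 ?li2 ?subr_ge0.
exists (bary T (i + 2%:R) x) => /=.
  rewrite in_itv/= b0 /= -(bary_sum x) (sum_ord3_rot _ i) bi add0r lerDr; exact: b0.
rewrite -[RHS](bary_comb x) (sum_ord3_rot _ i) bi scale0r add0r.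
by congr (_ *: _ + _); rewrite -(bary_sum x) (sum_ord3_rot _ i) bi add0r addrK.
Qed.

Lemma tri_set_vertex i : tri_set T (T i).
Proof. by apply/tri_setP => j; rewrite bary_vertex ler0n. Qed.

Lemma edge_vertex i j : j != i -> edge T i (T j).
Proof.
move=> ji; apply/edgeP; rewrite bary_vertex eq_sym (negbTE ji).
by split; first exact: tri_set_vertex.
Qed.

End Nondegenerate.
End Barycentric.

(** * Integration over a triangle and Green's formula *)

Section TriangleIntegral.
Variable R : realType.
Notation leb := (@lebesgue_measure R).
Notation plane := (measurableTypeR R * measurableTypeR R)%type.

Lemma bounded_plane_box (A : set (R * R)) : bounded_set A ->
  exists2 M : R, 0 < M & forall x, A x -> `|x.1| <= M /\ `|x.2| <= M.
Proof.
move=> [N [_ hN]]; exists (`|N| + 1); first by rewrite ltr_wpDl.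
move=> x Ax; have xN : `|x| <= `|N| + 1.
  by apply: hN Ax; rewrite (le_lt_trans (ler_norm _)) // ltrDl.
by move: xN; rewrite prod_normE /= ge_max => /andP[].
Qed.

Lemma continuous_bounded_box (g : R * R -> R) (M : R) : continuous g ->
  exists2 B : R, 0 <= B & forall x : R * R, `|x.1| <= M -> `|x.2| <= M -> `|g x| <= B.
Proof.
move=> cg; pose I := `[- M, M]%classic : set R.
have cI : compact (I `*` I) by apply: compact_setX; exact: segment_compact.
have [N [_ hN]] : bounded_set (g @` (I `*` I)).
  apply: compact_bounded; apply: continuous_compact => //.
  exact: continuous_subspaceT.
exists (`|N| + 1) => // x x1 x2; apply: (hN (`|N| + 1)).
  by rewrite (le_lt_trans (ler_norm _)) // ltrDl.
by exists x => //; split; rewrite /I/= in_itv/= -ler_norml.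
Qed.

Lemma leb2_box (a b c d : R) : a <= b -> c <= d ->
  leb2 R (`[a, b]%classic `*` `[c, d]%classic) = ((b - a) * (d - c))%:E.
Proof.
move=> ab cd; transitivity (leb `[a, b]%classic * leb `[c, d]%classic)%E.
  exact: product_measure1E.
rewrite !lebesgue_measure_itv/= !lte_fin.
case: ltP => ab'; case: ltP => cd'; rewrite ?mul0e ?mule0 //.
- have -> : d = c by apply/eqP; rewrite eq_le cd cd'.
  by rewrite subrr mulr0.
- have -> : b = a by apply/eqP; rewrite eq_le ab ab'.
  by rewrite subrr mul0r.
- have -> : b = a by apply/eqP; rewrite eq_le ab ab'.
  by rewrite subrr mul0r.
Qed.

Lemma leb2_bounded_lty (D : set (R * R)) : measurable (D : set plane) ->
  bounded_set D -> (leb2 R D < +oo)%E.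
Proof.
move=> mD /bounded_plane_box[M M0 DM].
have M1 : - M <= M by rewrite ge0_cp // ltW.
apply: (@le_lt_trans _ _ (leb2 R (`[- M, M]%classic `*` `[- M, M]%classic))).
  apply: le_measure; rewrite ?inE //; first exact: measurableX.
  by move=> x /DM[x1 x2]; split => /=; rewrite in_itv/= -ler_norml.
by rewrite leb2_box // ltry.
Qed.

Lemma continuous_integrable_plane (D : set (R * R)) (g : R * R -> R) :
  measurable (D : set plane) -> bounded_set D -> continuous g ->
  (leb2 R).-integrable D (EFin \o g).
Proof.
move=> mD bD cg; have [M M0 DM] := bounded_plane_box bD.
have [B B0 gB] := continuous_bounded_box M cg.
apply: measurable_bounded_integrable => //.
- exact: leb2_bounded_lty.
- by apply: measurable_funTS; exact: continuous_measurable_plane.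
- exists B; split=> [|b Bb x Dx]; first exact: num_real.
  have [x1 x2] := DM _ Dx; exact: le_trans (gB _ x1 x2) (ltW Bb).
Qed.

Definition ref_tri : set (R * R) := [set z | [/\ 0 <= z.1, 0 <= z.2 & z.1 + z.2 <= 1]].

(** The index rotates the triangle so that vertex [i] comes from the origin and edge [i] from the
    hypotenuse, as Green's formula below needs. *)
Definition ref_map (T : tri R) (i : 'I_3) (z : R * R) : R * R :=
  let a := T (i + 1) - T i in let b := T (i + 2%:R) - T i in
  (a.1 * z.1 + b.1 * z.2 + (T i).1, a.2 * z.1 + b.2 * z.2 + (T i).2).


Lemma continuous_affine_plane (a b c : R) :
  continuous (fun x : R * R => a + b * x.1 + c * x.2).
Proof.
move=> x; apply: cvgD; [apply: cvgD; [exact: cvg_cst|]|];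
  by apply: cvgM; [exact: cvg_cst | exact: cvg_fst || exact: cvg_snd].
Qed.

Lemma bary_affineE (T : tri R) i x : bary T i x =
  bary T i (0, 0) + (bary_grad T i).1 * x.1 + (bary_grad T i).2 * x.2.
Proof. by rewrite (bary_affine T i x (0, 0)) /dot /= !subr0 addrA. Qed.

Lemma continuous_bary (T : tri R) i : continuous (bary T i).
Proof.
have -> : bary T i = fun x => bary T i (0, 0) +
    (bary_grad T i).1 * x.1 + (bary_grad T i).2 * x.2.
  by apply/funext => x; exact: bary_affineE.
exact: continuous_affine_plane.
Qed.

Lemma closed_tri_set (T : tri R) : Defs.nondegenerate T -> closed (tri_set T).
Proof.
move=> nT; have -> : tri_set T =
    \bigcap_(i in [set: 'I_3]) (bary T i @^-1` [set t | 0 <= t]).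
  by apply/seteqP; split=> [x /(tri_setP nT) xT i _ | x xT];
    [exact: xT | apply/(tri_setP nT) => i; exact: xT].
apply: closed_bigI => i _; apply: closed_comp; last exact: closed_ge.
by move=> x _; exact: continuous_bary.
Qed.

Lemma measurable_tri_set (T : tri R) : Defs.nondegenerate T ->
  measurable (tri_set T : set plane).
Proof.
move=> nT; rewrite -(setCK (tri_set T)); apply: measurableC.
by apply: open_measurable_plane; exact/closed_openC/closed_tri_set.
Qed.

Lemma bounded_tri_set (T : tri R) : bounded_set (tri_set T).
Proof.
exists (\sum_i `|T i|); split=> [|M TM x [l [l0 l1 ->]]]; first exact: num_real.
apply: le_trans (ltW TM); apply: le_trans (ler_norm_sum _ _ _) _.
apply: ler_sum => i _; rewrite normrZ ger0_norm // ler_piMl //.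
by rewrite -l1 (bigD1 i) //= lerDl sumr_ge0.
Qed.

Lemma ref_mapE (T : tri R) i z : ref_map T i z =
  (1 - z.1 - z.2) *: T i + z.1 *: T (i + 1) + z.2 *: T (i + 2%:R).
Proof. by apply: plane_ext; rewrite !planeE /ref_map /=; ring. Qed.

Lemma ref_map_tri (T : tri R) i z : Defs.nondegenerate T ->
  tri_set T (ref_map T i z) <-> ref_tri z.
Proof.
move=> nT; pose l : 'I_3 -> R := fun j => if j == i then 1 - z.1 - z.2
  else if j == i + 1 then z.1 else z.2.
have [e1 e2 e3] := ord3_neq i.
have li : l i = 1 - z.1 - z.2 by rewrite /l eqxx.
have li1 : l (i + 1) = z.1 by rewrite /l (negbTE e1) eqxx.
have li2 : l (i + 2%:R) = z.2 by rewrite /l (negbTE e2) (negbTE e3).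
have l1 : \sum_i l i = 1 by rewrite (sum_ord3_rot _ i) li li1 li2; ring.
have -> : ref_map T i z = \sum_i l i *: T i.
  by rewrite (sum_ord3_rot _ i) li li1 li2 ref_mapE.
split=> [/(tri_setP nT) h|[z1 z2 z12]].
  move: (h i) (h (i + 1)) (h (i + 2%:R)); rewrite !bary_of_comb // li li1 li2.
  by move=> ? ? ?; split => //; lra.
apply/(tri_setP nT) => j; rewrite bary_of_comb //; move: j.
by apply: (@ord3_rot_ind _ i); rewrite ?li ?li1 ?li2 //; lra.
Qed.

Lemma continuous_ref_map (T : tri R) i : continuous (ref_map T i).
Proof.
have -> : ref_map T i = fun z =>
    ((T i).1 + (T (i + 1) - T i).1 * z.1 + (T (i + 2%:R) - T i).1 * z.2,
     (T i).2 + (T (i + 1) - T i).2 * z.1 + (T (i + 2%:R) - T i).2 * z.2).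
  by apply/funext => z; apply: plane_ext; rewrite /ref_map/=; ring.
move=> z; exact: (cvg_pair (@continuous_affine_plane _ _ _ z) (@continuous_affine_plane _ _ _ z)).
Qed.

Lemma measurable_affine_ge (a b c : R) :
  measurable ([set x | 0 <= a + b * x.1 + c * x.2] : set plane).
Proof.
rewrite -[X in measurable X](setCK _); apply: measurableC.
apply: open_measurable_plane; apply: closed_openC.
apply: (@closed_comp _ _ (fun x : R * R => a + b * x.1 + c * x.2) [set t | 0 <= t]).
  by move=> x _; exact: continuous_affine_plane.
exact: closed_ge.
Qed.

Lemma measurable_ref_tri : measurable (ref_tri : set plane).
Proof.
have -> : ref_tri = ([set x | 0 <= 0 + 1 * x.1 + 0 * x.2] `&`
   [set x | 0 <= 0 + 0 * x.1 + 1 * x.2]) `&` [set x | 0 <= 1 + -1 * x.1 + -1 * x.2].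
  apply/seteqP; split=> x /=; first by move=> [? ? ?]; split; first split; lra.
  by move=> [[? ?] ?]; split; lra.
by apply: measurableI; first apply: measurableI; exact: measurable_affine_ge.
Qed.

Lemma bounded_ref_tri : bounded_set ref_tri.
Proof.
exists 1; split=> [|M M1 x [x1 x2 x12]]; first exact: num_real.
rewrite /= prod_normE /= ge_max !ger0_norm //.
by apply/andP; split; lra.
Qed.

Lemma Rintegral_tri (T : tri R) i (g : R * R -> R) :
  Defs.nondegenerate T -> continuous g ->
  Rintegral (leb2 R) (tri_set T) g =
  `|tri_det T| * Rintegral (leb2 R) ref_tri (fun z => g (ref_map T i z)).
Proof.
move=> nT cg; have d0 : `|tri_det T| != 0 by rewrite normr_eq0; exact: nT.
have cgr : continuous (fun z => g (ref_map T i z)).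
  by move=> z; apply: continuous_comp; [exact: continuous_ref_map | exact: cg].
have ig := continuous_integrable_plane (measurable_tri_set nT) (@bounded_tri_set T) cg.
have igr := continuous_integrable_plane measurable_ref_tri bounded_ref_tri cgr.
have key (h : R * R -> R) : continuous h -> (forall x, 0 <= h x) ->
    (\int[leb2 R]_(x in tri_set T) (h x)%:E = `|tri_det T|%:E *
     \int[leb2 R]_(z in ref_tri) (h (ref_map T i z))%:E)%E.
  move=> ch h0; rewrite integral_mkcond [in RHS]integral_mkcond.
  have dE : tri_det T = (T (i + 1) - T i).1 * (T (i + 2%:R) - T i).2 -
     (T (i + 1) - T i).2 * (T (i + 2%:R) - T i).1 by rewrite -(tri_det_rot T i).
  rewrite (ge0_integral_linear_plane (T i).1 (T i).2
    (a1 := (T (i + 1) - T i).1) (a2 := (T (i + 1) - T i).2)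
    (b1 := (T (i + 2%:R) - T i).1) (b2 := (T (i + 2%:R) - T i).2)) -?dE //.
  - congr (_ * _)%E; apply: eq_integral => z _; rewrite !patchE -/(ref_map T i z).
    have [] := boolP (z \in ref_tri); rewrite (inE, notin_setE) => zr.
      by rewrite mem_set //; apply/ref_map_tri.
    by rewrite memNset // => /ref_map_tri => /(_ nT).
  - apply/(measurable_restrictT _ (measurable_tri_set nT)); apply/measurable_EFinP.
    by apply: measurable_funTS; exact: continuous_measurable_plane.
  - by move=> z; rewrite patchE; case: ifP; rewrite ?lee_fin.
have keyR (h : R * R -> R) : continuous h -> (forall x, 0 <= h x) ->
    Rintegral (leb2 R) (tri_set T) h =
    `|tri_det T| * Rintegral (leb2 R) ref_tri (fun z => h (ref_map T i z)).
  move=> ch h0; rewrite /Rintegral key // fineM //.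
  apply: integrable_fin_num => //; first exact: measurable_ref_tri.
  apply: (@continuous_integrable_plane _ (h \o ref_map T i) measurable_ref_tri bounded_ref_tri).
  by move=> z; apply: continuous_comp; [exact: continuous_ref_map | exact: ch].
(* The change of variables is known for nonnegative functions only; [g] is the difference of two
   nonnegative continuous ones. *)
pose g1 x := `|g x| + g x; pose g2 x := `|g x|.
have cg2 : continuous g2 by move=> x; apply: cvg_norm; exact: cg.
have cg1 : continuous g1 by move=> x; apply: cvgD; [exact: cg2 | exact: cg].
have comp_int (h : R * R -> R) : continuous h ->
    (leb2 R).-integrable ref_tri (EFin \o (h \o ref_map T i)).
  move=> ch; apply: continuous_integrable_plane measurable_ref_tri bounded_ref_tri _.
  by move=> z; apply: continuous_comp; [exact: continuous_ref_map | exact: ch].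
have tri_int (h : R * R -> R) : continuous h ->
    (leb2 R).-integrable (tri_set T) (EFin \o h).
  by move=> ch; apply: continuous_integrable_plane (measurable_tri_set nT) (@bounded_tri_set T) ch.
have gE x : g x = g1 x - g2 x by rewrite /g1 addrAC subrr add0r.
have g1_ge0 x : 0 <= g1 x by rewrite -lerBlDl sub0r lerNl -normrN ler_norm.
rewrite (_ : (fun z => g (ref_map T i z)) =
    fun z => (g1 \o ref_map T i) z - (g2 \o ref_map T i) z); last first.
  by apply/funext => z; rewrite gE.
rewrite [X in Rintegral _ _ X = _](_ : _ = fun z => g1 z - g2 z); last first.
  by apply/funext => z; rewrite gE.
rewrite (RintegralB (measurable_tri_set nT) (tri_int _ cg1) (tri_int _ cg2)).
rewrite (RintegralB measurable_ref_tri (comp_int _ cg1) (comp_int _ cg2)).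
by rewrite (keyR _ cg1 g1_ge0) (keyR _ cg2 (fun x => normr_ge0 _)) -mulrBr.
Qed.

End TriangleIntegral.

Section Green.
Variable R : realType.
Notation leb := (@lebesgue_measure R).
Notation plane := (measurableTypeR R * measurableTypeR R)%type.

Lemma Rintegral_ref_tri2 (G : R * R -> R) (H : R -> R) : continuous G ->
  (forall t, 0 <= t <= 1 ->
     (\int[leb]_(s in `[0%R, (1 - t)%R]) (G (s, t))%:E = (H t)%:E)%E) ->
  Rintegral (leb2 R) (@ref_tri R) G = Rintegral leb `[0, 1]%classic H.
Proof.
move=> cG GH; rewrite /Rintegral integral_mkcond [in RHS]integral_mkcond.
have iG : (leb2 R).-integrable setT ((EFin \o G) \_ (@ref_tri R)).
  apply/(integrable_mkcond _ (@measurable_ref_tri R)).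
  exact: continuous_integrable_plane (@measurable_ref_tri R) (@bounded_ref_tri R) cG.
have := integral21_prod_meas1 iG; rewrite /leb2 => <-; congr fine.
apply: eq_integral => t _; rewrite patchE.
have [] := boolP (t \in `[0, 1]%classic).
  rewrite inE/= in_itv/= => t01; rewrite -GH // integral_mkcond; apply: eq_integral => s _.
  rewrite !patchE/=; case: ifPn; case: ifPn => //.
    rewrite notin_setE inE /ref_tri/= in_itv/= => + [s0 t0 st]; case.
    by rewrite s0 lerBrDr.
  rewrite notin_setE inE /ref_tri/= in_itv/= => /andP[s0 st]; case.
  by split => //; [case/andP: t01 | rewrite -lerBrDr].
rewrite notin_setE/= in_itv/= => /negP t01; apply: integral0_eq => s _.
rewrite patchE; case: ifPn => //; rewrite inE => -[/= s0 t0 st].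
by case/negP: t01; rewrite t0/=; lra.
Qed.

Lemma Rintegral_ref_tri1 (G : R * R -> R) (H : R -> R) : continuous G ->
  (forall s, 0 <= s <= 1 ->
     (\int[leb]_(t in `[0%R, (1 - s)%R]) (G (s, t))%:E = (H s)%:E)%E) ->
  Rintegral (leb2 R) (@ref_tri R) G = Rintegral leb `[0, 1]%classic H.
Proof.
move=> cG GH; rewrite /Rintegral integral_mkcond [in RHS]integral_mkcond.
have iG : (leb2 R).-integrable setT ((EFin \o G) \_ (@ref_tri R)).
  apply/(integrable_mkcond _ (@measurable_ref_tri R)).
  exact: continuous_integrable_plane (@measurable_ref_tri R) (@bounded_ref_tri R) cG.
have := integral12_prod_meas1 iG; rewrite /leb2 => <-; congr fine.
apply: eq_integral => s _; rewrite patchE.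
have [] := boolP (s \in `[0, 1]%classic).
  rewrite inE/= in_itv/= => s01; rewrite -GH // integral_mkcond; apply: eq_integral => t _.
  rewrite !patchE/=; case: ifPn; case: ifPn => //.
    rewrite notin_setE inE /ref_tri/= in_itv/= => + [s0 t0 st]; case.
    by rewrite t0 lerBrDl.
  rewrite notin_setE inE /ref_tri/= in_itv/= => /andP[t0 st]; case.
  by split => //; [case/andP: s01 | rewrite -lerBrDl].
rewrite notin_setE/= in_itv/= => /negP s01; apply: integral0_eq => t _.
rewrite patchE; case: ifPn => //; rewrite inE => -[/= s0 t0 st].
by case/negP: s01; rewrite s0/=; lra.
Qed.

Lemma is_derive_line (phi : R * R -> R) (c a : R * R) (s : R) :
  (forall x, differentiable phi x) ->
  is_derive s 1 (fun s => phi (c + s *: a)) ('D_a phi (c + s *: a)).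
Proof.
move=> dphi; have da := @diff_derivable _ _ _ phi (c + s *: a) a (dphi _).
have E : (fun h => h^-1 *: (((fun s => phi (c + s *: a)) \o shift s) (h *: 1) - phi (c + s *: a))) =
         (fun h => h^-1 *: ((phi \o shift (c + s *: a)) (h *: a) - phi (c + s *: a))).
  apply/funext => h /=; congr (_ *: (phi _ - _)).
  by rewrite [h *: 1]mulr1 scalerDl addrCA.
by split; rewrite /derivable /derive E.
Qed.

Lemma pd_linear (phi : R * R -> R) (a x : R * R) : differentiable phi x ->
  'D_a phi x = a.1 * pd (1, 0) phi x + a.2 * pd (0, 1) phi x.
Proof.
move=> dx; rewrite /pd !deriveE // -[X in 'd _ _ X = _](_ : a.1 *: (1, 0) + a.2 *: (0, 1) = a).
  by rewrite linearD !linearZ.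
by apply: plane_ext; rewrite !planeE/=; ring.
Qed.

(** The integrand is the derivative of [s * psi s], which vanishes at 0. *)
Lemma integral_mul_id_derive (psi dpsi : R -> R) (c : R) : 0 <= c ->
  (forall s : R, is_derive s 1 psi (dpsi s)) -> continuous dpsi ->
  (\int[leb]_(s in `[0%R, c]) (psi s + s * dpsi s)%:E = (c * psi c)%:E)%E.
Proof.
move=> c0 dp cd; have cp : continuous psi.
  by move=> s; apply: differentiable_continuous; apply/derivable1_diffP; case: (dp s).
rewrite le_eqVlt in c0; case/predU1P: c0 => [<-|c0].
  by rewrite set_itv1 integral_set1 mul0r.
have dF (s : R) : is_derive s 1 (fun s => s * psi s) (psi s + s * dpsi s).
  by apply: is_derive_eq; rewrite addrC /GRing.scale/= mulr1.
have cF : continuous (fun s : R => s * psi s).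
  by move=> s; apply: cvgM; [exact: cvg_id | exact: cp].
rewrite (@continuous_FTC2 _ _ (fun s => s * psi s)) //.
- by rewrite mul0r sube0.
- apply: continuous_subspaceT => s; apply: cvgD; first exact: cp.
  by apply: cvgM; [exact: cvg_id | exact: cd].
- split=> [s _||]; first by case: (dF s).
    by apply: cvg_at_right_filter; exact: cF.
  by apply: cvg_at_left_filter; exact: cF.
- by move=> s _; rewrite derive1E; case: (dF s).
Qed.

(** The field [x - T i] has divergence 2, is tangential to the two edges at vertex [i], and has
    constant normal component on edge [i], with total flux [|tri_det T|]. In reference coordinates
    the integrand is the sum of the derivatives of [s * phi] in [s] and of [t * phi] in [t], so only
    values on the hypotenuse remain. *)
Lemma green_vertex (T : tri R) i (phi : R * R -> R) : Defs.nondegenerate T ->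
  (forall x, differentiable phi x) ->
  continuous (pd (1, 0) phi) -> continuous (pd (0, 1) phi) ->
  Rintegral (leb2 R) (tri_set T) (fun x => (x.1 - (T i).1) * pd (1, 0) phi x +
     (x.2 - (T i).2) * pd (0, 1) phi x + 2 * phi x) =
  `|tri_det T| * Rintegral leb `[0, 1]%classic (fun t => phi (edge_point T i t)).
Proof.
move=> nT dphi c1 c2; have cphi : continuous phi.
  by move=> x; exact: differentiable_continuous.
have cr := @continuous_ref_map R T i.
have ccomp (h : R * R -> R) : continuous h -> continuous (fun z => h (ref_map T i z)).
  by move=> ch z; apply: continuous_comp; [exact: cr | exact: ch].
rewrite (Rintegral_tri i nT); last first.
  move=> x; apply: cvgD; last by apply: cvgM; [exact: cvg_cst | exact: cphi].
  apply: cvgD.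
    by apply: cvgM; [apply: cvgB; [exact: cvg_fst | exact: cvg_cst] | exact: c1].
  by apply: cvgM; [apply: cvgB; [exact: cvg_snd | exact: cvg_cst] | exact: c2].
congr (_ * _); pose a := T (i + 1) - T i; pose b := T (i + 2%:R) - T i.
pose da z := a.1 * pd (1, 0) phi (ref_map T i z) + a.2 * pd (0, 1) phi (ref_map T i z).
pose db z := b.1 * pd (1, 0) phi (ref_map T i z) + b.2 * pd (0, 1) phi (ref_map T i z).
have cda : continuous da.
  by move=> z; apply: cvgD; (apply: cvgM; first exact: cvg_cst);
    [exact: (ccomp _ c1) | exact: (ccomp _ c2)].
have cdb : continuous db.
  by move=> z; apply: cvgD; (apply: cvgM; first exact: cvg_cst);
    [exact: (ccomp _ c1) | exact: (ccomp _ c2)].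
pose G1 z := phi (ref_map T i z) + z.1 * da z.
pose G2 z := phi (ref_map T i z) + z.2 * db z.
have cG1 : continuous G1.
  by move=> z; apply: cvgD; [exact: ccomp | apply: cvgM; [exact: cvg_fst | exact: cda]].
have cG2 : continuous G2.
  by move=> z; apply: cvgD; [exact: ccomp | apply: cvgM; [exact: cvg_snd | exact: cdb]].
have mr := @measurable_ref_tri R; have br := @bounded_ref_tri R.
rewrite (_ : (fun z => _) = fun z => G1 z + G2 z); last first.
  by apply/funext => z; rewrite /G1 /G2 /da /db /a /b /ref_map /=; ring.
rewrite (RintegralD mr (continuous_integrable_plane mr br cG1)
  (continuous_integrable_plane mr br cG2)).
pose e (t : R) := phi (ref_map T i (1 - t, t)).
have ce : continuous e.
  move=> t; apply: continuous_comp; last exact: cphi.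
  apply: (@continuous_comp _ _ _ (fun t : R => (1 - t, t))); last exact: cr.
  by apply: (cvg_pair (cvgB (cvg_cst _) cvg_id) cvg_id).
rewrite (@Rintegral_ref_tri2 G1 (fun t => (1 - t) * e t)) //; last first.
  move=> t /andP[t0 t1]; pose psi s := phi (ref_map T i (0, t) + s *: a).
  have rE s : ref_map T i (s, t) = ref_map T i (0, t) + s *: a.
    by apply: plane_ext; rewrite !planeE /ref_map /a/=; ring.
  have dpsi (s : R) : is_derive s 1 psi (da (s, t)).
    by rewrite /da -pd_linear // rE; exact: is_derive_line.
  have cdpsi : continuous (fun s : R => da (s, t)).
    move=> s; apply: (@continuous_comp _ _ _ (fun s : R => (s, t)) da); last exact: cda.
    exact: (cvg_pair cvg_id (cvg_cst _)).
  have t1' : 0 <= 1 - t by rewrite subr_ge0.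
  rewrite /e rE -/(psi _) -(integral_mul_id_derive t1' dpsi cdpsi).
  by apply: eq_integral => s _; rewrite /G1 /psi -rE.
rewrite (@Rintegral_ref_tri1 G2 (fun s => (1 - s) * phi (ref_map T i (s, 1 - s)))) //; last first.
  move=> s /andP[s0 s1]; pose psi t := phi (ref_map T i (s, 0) + t *: b).
  have rE t : ref_map T i (s, t) = ref_map T i (s, 0) + t *: b.
    by apply: plane_ext; rewrite !planeE /ref_map /b/=; ring.
  have dpsi (t : R) : is_derive t 1 psi (db (s, t)).
    by rewrite /db -pd_linear // rE; exact: is_derive_line.
  have cdpsi : continuous (fun t : R => db (s, t)).
    move=> t; apply: (@continuous_comp _ _ _ (fun t : R => (s, t)) db); last exact: cdb.
    exact: (cvg_pair (cvg_cst _) cvg_id).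
  have s1' : 0 <= 1 - s by rewrite subr_ge0.
  rewrite rE -/(psi _) -(integral_mul_id_derive s1' dpsi cdpsi).
  by apply: eq_integral => t _; rewrite /G2 /psi -rE.
(* The second integral runs along the hypotenuse in the opposite direction; once reversed, the two
   weights [1 - t] and [t] add up to 1. *)
rewrite [X in _ + X = _]Rintegration_by_substitution_onem ?lexx ?ler01 //; last first.
  apply: continuous_subspaceT => s; apply: cvgM.
    by apply: cvgB; [exact: cvg_cst | exact: cvg_id].
  apply: continuous_comp; last exact: cphi.
  apply: (@continuous_comp _ _ _ (fun t : R => (t, 1 - t))); last exact: cr.
  by apply: (cvg_pair cvg_id (cvgB (cvg_cst _) cvg_id)).
have mI : measurable (`[0, 1]%classic : set (measurableTypeR R)) by exact: measurable_itv.
have cI (h : R -> R) : continuous h -> leb.-integrable `[0, 1]%classic (EFin \o h).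
  move=> ch; apply: continuous_compact_integrable; first exact: segment_compact.
  exact: continuous_subspaceT.
rewrite /unstable.onem subrr.
have cm1 : continuous (fun t : R => (1 - t) * e t).
  by move=> t; apply: cvgM; [apply: cvgB; [exact: cvg_cst | exact: cvg_id] | exact: ce].
have cm2 : continuous (fun t : R => t * e t).
  by move=> t; apply: cvgM; [exact: cvg_id | exact: ce].
rewrite [X in _ + X = _](_ : _ = Rintegral leb `[0, 1]%classic (fun t => t * e t)); last first.
  by congr Rintegral; apply/funext => t; rewrite /e subKr.
rewrite -(RintegralD mI (cI _ cm1) (cI _ cm2)); congr Rintegral.
apply/funext => t; rewrite -mulrDl subrK mul1r /e; congr phi.
by rewrite ref_mapE /edge_point/= opprB addrCA subrr addr0 subrr scale0r add0r.
Qed.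

End Green.

(** * Neighbouring triangles and boundary edges *)

Section Interpolation.
Variable R : realType.
Implicit Types (T : tri R) (f : R * (R * R)).

(** An affine function is kept as its value at the origin and its gradient, so that gradients are
    data rather than derivatives. *)
Definition aff (f : R * (R * R)) (x : R * R) : R := f.1 + dot f.2 x.

Lemma aff_comb f T (l : 'I_3 -> R) : \sum_i l i = 1 ->
  aff f (\sum_i l i *: T i) = \sum_i l i * aff f (T i).
Proof.
move=> l1; rewrite tri_combE /aff /dot sum_ord3 /=.
have -> : l 0 = 1 - l 1 - l 2%:R by rewrite -l1 sum_ord3; ring.
ring.
Qed.

Lemma aff_bary f T x : Defs.nondegenerate T ->
  aff f x = \sum_i bary T i x * aff f (T i).
Proof. by move=> nT; rewrite -{1}(bary_comb nT x) aff_comb ?bary_sum. Qed.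

Definition bary_form T i : R * (R * R) := (bary T i (0, 0), bary_grad T i).

Lemma bary_aff T i x : bary T i x = aff (bary_form T i) x.
Proof. by rewrite [LHS]bary_affineE /aff /dot/= -addrA. Qed.

Lemma aff_sub f x y : aff f x - aff f y = dot f.2 (x - y).
Proof. by rewrite /aff /dot /=; ring. Qed.

Lemma aff_convex f a b t : aff f ((1 - t) *: a + t *: b) = (1 - t) * aff f a + t * aff f b.
Proof. by rewrite /aff /dot !planeE; ring. Qed.

Lemma aff_edge f T i x : Defs.nondegenerate T ->
  aff f (T (i + 1)) = 0 -> aff f (T (i + 2%:R)) = 0 -> aff f x = bary T i x * aff f (T i).
Proof.
by move=> nT f1 f2; rewrite (aff_bary f x nT) (sum_ord3_rot _ i) f1 f2 !mulr0 !addr0.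
Qed.

(** Let [s] and [t] be the parameters of [a] and [b] on the segment from [c] to [d]. Both 0 and 1
    are convex combinations of [s] and [t], which lie between 0 and 1, so these are 0 and 1 in some
    order. *)
Lemma segment_endpoints (a b c d : R * R) : Defs.segment a b = Defs.segment c d ->
  (a = c /\ b = d) \/ (a = d /\ b = c).
Proof.
move=> E.
have end1 (u v : R * R) : Defs.segment u v u.
  by exists 0; [rewrite /= in_itv/= lexx ler01 | rewrite subr0 scale1r scale0r addr0].
have end2 (u v : R * R) : Defs.segment u v v.
  by exists 1; [rewrite /= in_itv/= lexx ler01 | rewrite subrr scale1r scale0r add0r].
have [s /= + sE] : Defs.segment c d a by rewrite -E.
have [t /= + tE] : Defs.segment c d b by rewrite -E.
have [u /= + uE] : Defs.segment a b c by rewrite E.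
have [v /= + vE] : Defs.segment a b d by rewrite E.
rewrite !in_itv/= => /andP[v0 v1] /andP[u0 u1] /andP[t0 t1] /andP[s0 s1].
have [cd|cd] := eqVneq c d.
  by left; rewrite -sE -tE -cd -!scalerDl !subrK !scale1r.
have dcn : d - c != 0 by rewrite subr_eq0 eq_sym.
have conv (k x y : R) : (1 - k) *: ((1 - x) *: c + x *: d) + k *: ((1 - y) *: c + y *: d) =
    c + ((1 - k) * x + k * y) *: (d - c).
  by apply: plane_ext; rewrite !planeE; ring.
have eu : (1 - u) * s + u * t = 0.
  move: uE; rewrite -{1}sE -{1}tE conv => /eqP; rewrite addrC -subr_eq0 addrK scaler_eq0.
  by rewrite (negbTE dcn) orbF => /eqP.
have ev : (1 - v) * s + v * t = 1.
  move: vE; rewrite -{1}sE -{1}tE conv => /eqP.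
  rewrite -[X in _ == X](subrKC c) (inj_eq (addrI c)) -subr_eq0 -{2}[d - c]scale1r -scalerBl.
  by rewrite scaler_eq0 (negbTE dcn) orbF subr_eq0 => /eqP.
have [s00|s00] := eqVneq s 0.
  have t1' : t = 1 by nra.
  by left; rewrite -sE -tE s00 t1' subr0 subrr !scale1r !scale0r addr0 add0r.
have u1' : u = 1.
  have : (1 - u) * s <= 0 by nra.
  rewrite pmulr_lle0 ?lt_neqAle 1?eq_sym ?s00 //; lra.
have t00 : t = 0 by move: eu; rewrite u1'; lra.
have s1' : s = 1 by move: ev; rewrite t00; nra.
by right; rewrite -sE -tE s1' t00 subr0 subrr !scale1r !scale0r addr0 add0r.
Qed.

End Interpolation.

Section Mesh.
Variables (R : realType) (Omega : set (R * R)) (n : nat) (Th : mesh R n).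
Hypothesis hOmega : bounded_polygonal_domain Omega.
Hypothesis hTh : conforming_triangulation Omega Th.
Implicit Types (K L M : 'I_n) (i j : 'I_3) (x p : R * R).

Lemma mesh_nondegenerate K : Defs.nondegenerate (Th K).
Proof. by case: hTh. Qed.
Notation nd := mesh_nondegenerate.

Lemma mesh_cover x : closure Omega x <-> exists K, tri_set (Th K) x.
Proof.
case: hTh => _ <- _; split; first by case=> K _ Kx; exists K.
by case=> K Kx; exists K.
Qed.

(** All three cases of conformity put the intersection on the line through one edge of [K]; later
    arguments need only this. *)
Lemma mesh_inter K L : K != L -> exists i, forall x,
  tri_set (Th K) x -> tri_set (Th L) x -> bary (Th K) i x = 0.
Proof.
case: hTh => _ _ /[apply] -[E|[i [j [_ E]]]|[i [j [_ E]]]].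
- by exists 0 => x Kx Lx; have : set0 x by rewrite -E.
- exists (i + 1) => x Kx Lx; have : [set Th K i] x by rewrite -E.
  by move=> /= ->; rewrite bary_vertex ?(negbTE (let: And3 h _ _ := ord3_neq i in h)) //; exact: nd.
- exists i => x Kx Lx; have : edge (Th K) i x by rewrite -E.
  by case/(edgeP (nd K)).
Qed.

Lemma mesh_interior K L x : tri_set (Th L) x -> (forall i, 0 < bary (Th K) i x) -> K = L.
Proof.
move=> Lx Kx; apply/eqP/negPn/negP => /mesh_inter[i Ki].
have /(_ _ Lx) := Ki x; rewrite -falseE; move: (Kx i) => /[swap] ->; rewrite ?ltxx //.
by apply/(tri_setP (nd K)) => j; exact: ltW.
Qed.

Lemma edge_endpoints K i L j : edge (Th L) j = edge (Th K) i ->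
  (Th L (j + 1) = Th K (i + 1) /\ Th L (j + 2%:R) = Th K (i + 2%:R)) \/
  (Th L (j + 1) = Th K (i + 2%:R) /\ Th L (j + 2%:R) = Th K (i + 1)).
Proof. exact: segment_endpoints. Qed.

Lemma bary_neighbour K i L j : edge (Th L) j = edge (Th K) i ->
  bary (Th K) i (Th L (j + 1)) = 0 /\ bary (Th K) i (Th L (j + 2%:R)) = 0.
Proof.
have [e1 e2 _] := ord3_neq i.
by case/edge_endpoints => -[-> ->]; rewrite !bary_vertex ?(eq_sym i) ?(negbTE e1) ?(negbTE e2);
  try exact: nd.
Qed.

Lemma bary_proportional K i L j x : edge (Th L) j = edge (Th K) i ->
  bary (Th K) i x = bary (Th L) j x * bary (Th K) i (Th L j).
Proof.
move=> /bary_neighbour[]; rewrite !(bary_aff (Th K)) => h1 h2.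
exact: aff_edge (nd L) h1 h2.
Qed.

(** Two triangles with a common edge lie on opposite sides of it. Otherwise a point slightly off the
    midpoint of the edge, towards the third vertex of [L], would belong to [L] and to the interior
    of [K]. *)
Lemma bary_opposite K i L j : K != L -> edge (Th L) j = edge (Th K) i ->
  bary (Th K) i (Th L j) < 0.
Proof.
move=> KL E; have [e1 e2 e3] := ord3_neq i; have [f1 f2 f3] := ord3_neq j.
have c0 : bary (Th K) i (Th L j) != 0.
  apply/eqP => c0; have := bary_proportional (Th K i) E.
  by rewrite c0 mulr0 bary_vertex ?eqxx; [move/eqP; rewrite oner_eq0 | exact: nd].
rewrite lt_neqAle c0 /= leNgt; apply/negP => cp.
set c := Th L j in c0 cp *.
pose u := bary (Th K) (i + 1) c; pose v := bary (Th K) (i + 2%:R) c.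
(* At the midpoint the coordinates [i + 1] and [i + 2] equal one half; this step length keeps them
   positive although [u] and [v] may be negative. *)
pose s := (2 + 2 * `|u| + 2 * `|v|)^-1.
have den0 : 0 < 2 + 2 * `|u| + 2 * `|v|.
  by have := normr_ge0 u; have := normr_ge0 v; lra.
have s0 : 0 < s by rewrite invr_gt0.
have sE : s * (2 + 2 * `|u| + 2 * `|v|) = 1 by rewrite mulVf ?gt_eqF.
have su0 : 0 <= s * `|u| by rewrite mulr_ge0 // ltW.
have sv0 : 0 <= s * `|v| by rewrite mulr_ge0 // ltW.
pose m := (1 - 1 / 2) *: Th L (j + 1) + (1 / 2) *: Th L (j + 2%:R).
pose y := (1 - s) *: m + s *: c.
have Ly : tri_set (Th L) y.
  apply/(tri_setP (nd L)); apply: (@ord3_rot_ind _ j);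
    rewrite bary_aff /y !aff_convex -!bary_aff !bary_vertex; try exact: nd;
    rewrite ?eqxx ?(eq_sym j) ?(negbTE f1) ?(negbTE f2) ?(eq_sym (j + 1)) ?(negbTE f3) /=; nra.
have mK k : bary (Th K) k m = 1 / 2 * bary (Th K) k (Th K (i + 1)) +
    1 / 2 * bary (Th K) k (Th K (i + 2%:R)).
  rewrite bary_aff aff_convex -!bary_aff.
  by case: (edge_endpoints E) => -[-> ->]; field.
have [KLE] : K = L; last by move/eqP: KL.
apply: (mesh_interior Ly); apply: (@ord3_rot_ind _ i);
    rewrite bary_aff /y aff_convex -!bary_aff mK !bary_vertex; try exact: nd;
    rewrite ?eqxx ?(eq_sym i) ?(negbTE e1) ?(negbTE e2) ?(eq_sym (i + 1)) ?(negbTE e3) /=.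
- nra.
- have := ler_norm (- u); rewrite normrN -/u; nra.
- have := ler_norm (- v); rewrite normrN -/v; nra.
Qed.

(** Three triangles on one edge would lie pairwise on opposite sides of it, which is impossible by
    the rule of signs. *)
Lemma neighbour_unique K i L j L' j' : K != L -> K != L' ->
  edge (Th L) j = edge (Th K) i -> edge (Th L') j' = edge (Th K) i -> L = L'.
Proof.
move=> KL KL' E E'; apply/eqP/negPn/negP => LL'.
have h1 := bary_opposite KL E; have h2 := bary_opposite KL' E'.
have h3 : bary (Th L) j (Th L' j') < 0 by apply: bary_opposite => //; rewrite E.
by have := bary_proportional (Th L' j') E; nra.
Qed.

End Mesh.

(** * Neighbourhoods of points of the mesh *)

Section Patch.
Variables (R : realType) (Omega : set (R * R)) (n : nat) (Th : mesh R n).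
Hypothesis hOmega : bounded_polygonal_domain Omega.
Hypothesis hTh : conforming_triangulation Omega Th.
Implicit Types (K L M : 'I_n) (i j : 'I_3) (x p : R * R).
Local Notation nd := (mesh_nondegenerate hTh).

Lemma neighbour_some K i L : neighbour Th K i = Some L ->
  K != L /\ exists j, edge (Th L) j = edge (Th K) i.
Proof.
rewrite /neighbour; case: pickP => // M /andP[MK /asboolP hM] [<-].
by rewrite eq_sym.
Qed.

Lemma neighbour_none K i : neighbour Th K i = None ->
  forall L j, K != L -> edge (Th L) j <> edge (Th K) i.
Proof.
rewrite /neighbour; case: pickP => // h _ L j KL E.
by have := h L; rewrite eq_sym KL /= => /negP; apply; apply/asboolP; exists j.
Qed.

Lemma neighbourE K i L j : K != L -> edge (Th L) j = edge (Th K) i ->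
  neighbour Th K i = Some L.
Proof.
move=> KL E; case EN : (neighbour Th K i) => [M|]; last first.
  by have := neighbour_none EN KL E.
have [KM [j' E']] := neighbour_some EN.
by rewrite (neighbour_unique hTh KL KM E E').
Qed.

(** This is where the exclusion of slits and punctures enters. *)
Lemma omega_near x : (\forall y \near x, closure Omega y) -> Omega x.
Proof.
move=> h; have : interior (closure Omega) x by exact: h.
by case: hOmega => _ _ _ _ [-> _].
Qed.

Lemma bdry_not_omega x : bdry Omega x -> ~ Omega x.
Proof. by move=> [_ nx] Ox; apply: nx; apply: open_nbhs_nbhs; case: hOmega. Qed.

Lemma closure_omega_or_bdry x : closure Omega x -> Omega x \/ bdry Omega x.
Proof.
move=> cx; have [Ox|nOx] := pselect (Omega x); first by left.
by right; split => // ix; apply: nOx; exact: interior_subset ix.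
Qed.

Lemma near_bary_gt0 K i x : 0 < bary (Th K) i x ->
  \forall y \near x, 0 < bary (Th K) i y.
Proof.
by move=> h; exact: (cvgr_gt _ (@continuous_bary R (Th K) i x) _ h).
Qed.

Lemma near_forall (I : finType) (Q : I -> R * R -> Prop) x :
  (forall k, \forall y \near x, Q k y) -> \forall y \near x, forall k, Q k y.
Proof. by move=> h; exact: (filter_forall (nbhs_filter x) h). Qed.

Lemma near_always (Q : R * R -> Prop) x : (forall y, Q y) -> \forall y \near x, Q y.
Proof. by move=> h; exact: (@filterE _ _ (nbhs_filter x)). Qed.

(** [P] selects which of the three half planes are intersected: all of them give the triangle, and
    those opposite to the vertices other than [p] give the infinite sector of [M] at [p]. Both cases
    share the lemmas below. *)
Definition cone (P : R * R -> Prop) M (x : R * R) : Prop :=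
  forall j, P (Th M j) -> 0 <= bary (Th M) j x.

Lemma near_cone (P : R * R -> Prop) M x :
  (forall j, P (Th M j) -> 0 < bary (Th M) j x) -> \forall y \near x, cone P M y.
Proof.
move=> h; apply: near_forall => j; have [Pj|nPj] := pselect (P (Th M j)).
  by apply: filterS (near_bary_gt0 (h _ Pj)) => y y0 _; exact: ltW.
by apply: near_always => y Pj.
Qed.

(** On the line of a common edge the coordinates of both triangles at the end points agree, so
    positivity passes from one triangle to the other. *)
Lemma bary_on_edge M k L j j' : edge (Th L) j = edge (Th M) k -> j' != j ->
  exists k', [/\ k' != k, Th L j' = Th M k' &
    forall x, bary (Th M) k x = 0 -> bary (Th L) j' x = bary (Th M) k' x].
Proof.
move=> E; have [e1 e2 e3] := ord3_neq k; have [f1 f2 f3] := ord3_neq j.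
have aux (a b : 'I_3) (c d : 'I_3) : b != a -> d != c ->
    (forall x, bary (Th M) k x = 0 -> x = bary (Th M) c x *: Th M c + bary (Th M) d x *: Th M d) ->
    (forall x, bary (Th M) k x = 0 -> bary (Th M) c x + bary (Th M) d x = 1) ->
    Th L a = Th M c -> Th L b = Th M d ->
    forall x, bary (Th M) k x = 0 -> bary (Th L) a x = bary (Th M) c x.
  move=> ba dc hx h1 hac hbd x kx; have tE : 1 - bary (Th M) d x = bary (Th M) c x.
    by rewrite -(h1 x kx) addrK.
  have xE : x = (1 - bary (Th M) d x) *: Th M c + bary (Th M) d x *: Th M d.
    by rewrite tE; exact: hx.
  rewrite [in LHS]xE bary_aff aff_convex tE -!bary_aff -hac -hbd !bary_vertex; try exact: nd.
  by rewrite eqxx (eq_sym a) (negbTE ba) mulr1 mulr0 addr0.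
have h12 x : bary (Th M) k x = 0 ->
    x = bary (Th M) (k + 1) x *: Th M (k + 1) + bary (Th M) (k + 2%:R) x *: Th M (k + 2%:R).
  by move=> kx; rewrite -{1}(bary_comb (nd M) x) (sum_ord3_rot _ k) kx scale0r add0r.
have s12 x : bary (Th M) k x = 0 -> bary (Th M) (k + 1) x + bary (Th M) (k + 2%:R) x = 1.
  by move=> kx; rewrite -(bary_sum (nd M) x) (sum_ord3_rot _ k) kx add0r.
have h21 x : bary (Th M) k x = 0 ->
    x = bary (Th M) (k + 2%:R) x *: Th M (k + 2%:R) + bary (Th M) (k + 1) x *: Th M (k + 1).
  by rewrite addrC; exact: h12.
have s21 x : bary (Th M) k x = 0 -> bary (Th M) (k + 2%:R) x + bary (Th M) (k + 1) x = 1.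
  by rewrite addrC; exact: s12.
have e3' : k + 1 != k + 2%:R by rewrite eq_sym.
have f3' : j + 1 != j + 2%:R by rewrite eq_sym.
move: j'; apply: (@ord3_rot_ind _ j); rewrite ?eqxx // => _;
  case: (edge_endpoints E) => -[E1 E2].
- by exists (k + 1); split=> //; exact: aux f3 e3 h12 s12 E1 E2.
- by exists (k + 2%:R); split=> //; exact: aux f3 e3' h21 s21 E1 E2.
- by exists (k + 2%:R); split=> //; exact: aux f3' e3' h21 s21 E2 E1.
- by exists (k + 1); split=> //; exact: aux f3' e3 h12 s12 E2 E1.
Qed.

(** Near [x] only the constraint of the common edge can fail, and the sign of [bary (Th M) k]
    decides between [M] and [L]. *)
Lemma near_cone_neighbour (P : R * R -> Prop) M k L j x : M != L ->
  edge (Th L) j = edge (Th M) k -> bary (Th M) k x = 0 ->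
  (forall k', k' != k -> P (Th M k') -> 0 < bary (Th M) k' x) ->
  \forall y \near x, cone P M y \/ cone P L y.
Proof.
move=> ML E kx h.
have nM : \forall y \near x, forall k', k' != k -> P (Th M k') -> 0 < bary (Th M) k' y.
  apply: near_forall => k'; have [[k'k Pk]|nPk] := pselect (k' != k /\ P (Th M k')).
    by apply: filterS (near_bary_gt0 (h _ k'k Pk)) => y y0 _ _.
  by apply: near_always => y k'k Pk; case: nPk.
have nL : \forall y \near x, forall j', j' != j -> P (Th L j') -> 0 < bary (Th L) j' y.
  apply: near_forall => j'; have [[j'j Pj]|nPj] := pselect (j' != j /\ P (Th L j')).
    have [k' [k'k Ek bE]] := bary_on_edge E j'j.
    have j'x : 0 < bary (Th L) j' x by rewrite bE //; apply: h => //; rewrite -Ek.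
    by apply: filterS (near_bary_gt0 j'x) => y y0 _ _.
  by apply: near_always => y j'j Pj; case: nPj.
near=> y; have [yk|yk] := leP 0 (bary (Th M) k y).
  left=> k' Pk; have [->//|k'k] := eqVneq k' k.
  by apply/ltW; have /(_ k' k'k Pk) : forall k', k' != k -> P (Th M k') -> 0 < bary (Th M) k' y by near: y.
right=> j' Pj; have [->|j'j] := eqVneq j' j.
  have h1 := bary_opposite hTh ML E; have := bary_proportional hTh y E; nra.
by apply/ltW; have /(_ j' j'j Pj) : forall j', j' != j -> P (Th L j') -> 0 < bary (Th L) j' y by near: y.
Unshelve. all: by end_near. Qed.

Lemma cone_tri M x : cone (fun=> True) M x <-> tri_set (Th M) x.
Proof.
split=> [h|/(tri_setP (nd M)) h j _]; last exact: h.
by apply/(tri_setP (nd M)) => j; exact: h.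
Qed.

Lemma tri_interior_omega M x : (forall i, 0 < bary (Th M) i x) -> Omega x.
Proof.
move=> h; apply: omega_near; have := @near_cone (fun=> True) M x (fun j _ => h j).
by apply: filterS => y /cone_tri My; apply/(mesh_cover hTh); exists M.
Qed.

Lemma edge_interior_omega M k L j x : M != L ->
  edge (Th L) j = edge (Th M) k -> bary (Th M) k x = 0 ->
  (forall k', k' != k -> 0 < bary (Th M) k' x) -> Omega x.
Proof.
move=> ML E kx h; apply: omega_near.
have := near_cone_neighbour (P := fun=> True) ML E kx (fun k' kk _ => h k' kk).
apply: filterS => y [] /cone_tri My; apply/(mesh_cover hTh); [by exists M | by exists L].
Qed.

Lemma near_line (P : set (R * R)) x v : (\forall y \near x, P y) ->
  exists2 s : R, 0 < s & forall t, `|t| <= s -> P (x + t *: v).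
Proof.
move=> Px; have ct : (fun t : R => x + t *: v) @ (0 : R) --> x + 0 *: v.
  by apply: cvgD; [exact: cvg_cst | apply: cvgZr_tmp; exact: cvg_id].
rewrite scale0r addr0 in ct; have /nbhs_ballP[e /= e0 He] := ct _ Px.
exists (e / 2); first by rewrite divr_gt0.
move=> t te; apply: He; rewrite /ball/= sub0r normrN.
by apply: le_lt_trans te _; rewrite ltr_pdivrMr // ltr_pMr // ltr1n.
Qed.

(** Near a point strictly inside such an edge the closed domain coincides with [K], and crossing the
    edge leaves [K]. The end points follow by approximation. *)
Lemma edge_boundary K i : neighbour Th K i = None -> edge (Th K) i `<=` bdry Omega.
Proof.
move=> nK; have [e1 e2 e3] := ord3_neq i.
have inner x : bary (Th K) i x = 0 -> 0 < bary (Th K) (i + 1) x ->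
    0 < bary (Th K) (i + 2%:R) x -> bdry Omega x.
  move=> x0 x1 x2; have Kx : tri_set (Th K) x.
    by apply/(tri_setP (nd K)); apply: (@ord3_rot_ind _ i); rewrite ?x0 // ltW.
  split; first by apply/(mesh_cover hTh); exists K.
  (* A common vertex is excluded by the two positive coordinates, and a common edge through [x]
     would have to be edge [i]. *)
  have other M : M != K -> ~ tri_set (Th M) x.
    move=> MK Mx; have KM : K != M by rewrite eq_sym.
    case: hTh => _ _ /(_ _ _ KM)[E|[a [b [_ E]]]|[a [b [Eab E]]]].
    - by have : set0 x by rewrite -E.
    - have xE : x = Th K a by have : [set Th K a] x by rewrite -E.
      move: x1 x2; rewrite xE !bary_vertex ?ltr0n; try exact: nd.
      by rewrite !lt0b => /eqP <- /eqP h; rewrite h eqxx in e3.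
    have ax : bary (Th K) a x = 0.
      have : edge (Th K) a x by rewrite -E.
      by case/(edgeP (nd K)).
    suff ai : a = i by apply: (neighbour_none nK KM (j := b)); rewrite -Eab ai.
    apply/eqP/negPn/negP => ai; move: ai ax; move: a {Eab E}.
    apply: (@ord3_rot_ind _ i); first by rewrite eqxx.
      by move=> _ h; rewrite h ltxx in x1.
    by move=> _ h; rewrite h ltxx in x2.
  have onlyK : \forall y \near x, closure Omega y -> tri_set (Th K) y.
    have : \forall y \near x, forall M, M != K -> ~ tri_set (Th M) y.
      apply: near_forall => M; have [->|MK] := eqVneq M K; first by apply: near_always.
      have : nbhs x (~` tri_set (Th M)).
        by apply: open_nbhs_nbhs; split; [exact/closed_openC/closed_tri_set/nd | exact: other].
      by apply: filterS => y My _.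
    apply: filterS => y hy /(mesh_cover hTh)[M My].
    by have [<-//|MK] := eqVneq M K; case: (hy M MK).
  move=> ix; have : \forall y \near x, tri_set (Th K) y.
    near=> y; have : closure Omega y -> tri_set (Th K) y by near: y.
    by apply; apply: subset_closure; near: y; exact: ix.
  (* Moving away from vertex [i] makes coordinate [i] negative. *)
  move=> /(near_line (Th K i - x))[s s0] /(_ (- s)).
  rewrite normrN gtr0_norm // lexx => /(_ isT) /(tri_setP (nd K)) /(_ i).
  rewrite (_ : x + - s *: (Th K i - x) = (1 - - s) *: x + (- s) *: Th K i); last first.
    by apply: plane_ext; rewrite !planeE; ring.
  rewrite bary_aff aff_convex -!bary_aff x0 mulr0 add0r bary_vertex ?eqxx ?mulr1; last exact: nd.
  by rewrite oppr_ge0 leNgt s0.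
move=> y /(edgeP (nd K))[/(tri_setP (nd K)) Ky yi].
split; first by apply/(mesh_cover hTh); exists K; apply/(tri_setP (nd K)).
(* If [y] were interior to the domain, so would be the points slightly closer to the midpoint [m],
   which lie strictly inside the edge. *)
pose m := (1 - 1 / 2) *: Th K (i + 1) + (1 / 2) *: Th K (i + 2%:R).
move=> /(near_line (m - y))[s s0 hs]; pose t := Num.min s 1.
have t0 : 0 < t by rewrite lt_min s0 ltr01.
have t1 : t <= 1 by rewrite ge_min lexx orbT.
have /hs : `|t| <= s by rewrite gtr0_norm // ge_min lexx.
rewrite (_ : y + t *: (m - y) = (1 - t) *: y + t *: m); last first.
  by apply: plane_ext; rewrite !planeE; ring.
apply: bdry_not_omega; have Ky1 := Ky (i + 1); have Ky2 := Ky (i + 2%:R).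
by apply: inner; rewrite bary_aff aff_convex -bary_aff /m aff_convex -!bary_aff
   !bary_vertex; try exact: nd; rewrite ?yi ?eqxx ?(eq_sym i) ?(negbTE e1) ?(negbTE e2)
   ?(negbTE e3) ?(eq_sym (i + 1)) ?(negbTE e3) /=; nra.
Unshelve. all: by end_near. Qed.

End Patch.

(** * The triangles around a vertex *)

Section Star.
Variables (R : realType) (Omega : set (R * R)) (n : nat) (Th : mesh R n).
Hypothesis hOmega : bounded_polygonal_domain Omega.
Hypothesis hTh : conforming_triangulation Omega Th.
Implicit Types (K L M : 'I_n) (i j : 'I_3) (x : R * R).
Local Notation nd := (mesh_nondegenerate hTh).

Variable p : R * R.

Definition has_vertex M : bool := [exists i, Th M i == p].

(** For a triangle with vertex [p], edge [i] contains [p] exactly when vertex [i] is not [p];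
    adjacency is thus across the edges through [p]. *)
Definition adj_at M L : bool :=
  has_vertex M && [exists i, (Th M i != p) && (neighbour Th M i == Some L)].

Lemma bary_vertex_neq M j : has_vertex M -> Th M j != p -> bary (Th M) j p = 0.
Proof.
move=> /existsP[i /eqP <-] ji; rewrite bary_vertex; last exact: nd.
by case: (eqVneq j i) ji => [->|//]; rewrite eqxx.
Qed.

Lemma edge_has_vertex M i L j : edge (Th L) j = edge (Th M) i -> has_vertex M ->
  Th M i != p -> has_vertex L /\ Th L j != p.
Proof.
move=> E vM ip; have pM : edge (Th M) i p.
  apply/(edgeP (nd M)); split; last exact: bary_vertex_neq.
  by case/existsP: vM => k /eqP <-; exact/tri_set_vertex/nd.
have pL : bary (Th L) j p = 0 by move: pM; rewrite -E => /(edgeP (nd L))[].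
case/existsP: vM => k /eqP kp; have ki : k != i by apply: contraNneq ip => <-; exact/eqP.
have [j' [_ ej _]] := bary_on_edge hTh (esym E) ki.
split; first by apply/existsP; exists j'; rewrite -ej; exact/eqP.
apply/eqP => jp; move: pL; rewrite -jp bary_vertex ?eqxx; last exact: nd.
by move/eqP; rewrite oner_eq0.
Qed.

Lemma adj_at_vertex M L : adj_at M L -> has_vertex L.
Proof.
case/andP => vM /existsP[i /andP[ip /eqP /(neighbour_some)[_ [j E]]]].
by have [] := edge_has_vertex E vM ip.
Qed.

Lemma connect_has_vertex K M : has_vertex K -> connect adj_at K M -> has_vertex M.
Proof.
move=> vK /connectP[s + ->]; elim: s K vK => //= L s IH K vK /andP[KL].
by apply: IH; exact: adj_at_vertex KL.
Qed.

Definition vcone := cone Th (fun q => q != p).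

Lemma closed_cone M : closed (vcone M).
Proof.
have -> : vcone M = \bigcap_(j in [set j | Th M j != p]) (bary (Th M) j @^-1` [set t | 0 <= t]).
  by apply/seteqP; split=> x h j; exact: h.
apply: closed_bigI => i _; apply: closed_comp; last exact: closed_ge.
by move=> x _; exact: continuous_bary.
Qed.

Lemma only_vertex M x : has_vertex M -> (forall j, Th M j != p -> bary (Th M) j x = 0) -> x = p.
Proof.
move=> /existsP[i /eqP ip] h; rewrite -(bary_comb (nd M) x) (bigD1 i) //= big1 => [|j ji].
  rewrite addr0 -(_ : 1 = bary (Th M) i x) ?scale1r //.
  rewrite -(bary_sum (nd M) x) (bigD1 i) //= big1 ?addr0 // => j ji.
  apply: h; apply: contraNneq ji => jp; move: (bary_vertex (nd M) j i).
  by rewrite ip -jp bary_vertex ?eqxx; [case: eqP => // _ /eqP; rewrite oner_eq0 | exact: nd].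
rewrite h ?scale0r //; apply: contraNneq ji => jp; move: (bary_vertex (nd M) j i).
by rewrite ip -jp bary_vertex ?eqxx; [case: eqP => // _ /eqP; rewrite oner_eq0 | exact: nd].
Qed.

Section Component.
Variable K : 'I_n.
Hypothesis vK : has_vertex K.
Hypothesis full : forall M i, connect adj_at K M -> Th M i != p -> neighbour Th M i <> None.

(** Infinite sectors replace the triangles, so that no outer boundary interferes with the
    connectedness argument. *)
Let fan : set (R * R) := [set x | exists2 M, connect adj_at K M & vcone M x].

Lemma closed_fan : closed fan.
Proof.
have -> : fan = \bigcup_(M in [set M | connect adj_at K M]) vcone M by [].
by apply: closed_bigcup => [|M _]; [exact: finite_finset | exact: closed_cone].
Qed.

(** Away from [p], a point of a sector lies on at most one of its two bounding lines; across that
    line the sector of the neighbour, which [full] provides, takes over. *)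
Lemma fan_nbhs x : fan x -> x != p -> nbhs x fan.
Proof.
move=> [M cM Mx] xp; have vM := connect_has_vertex vK cM.
have [[k [kp kx]]|nk] := pselect (exists k, Th M k != p /\ bary (Th M) k x = 0); last first.
  have : \forall y \near x, vcone M y.
    apply: near_cone => j jp; rewrite lt_neqAle eq_sym (Mx j jp) andbT.
    by apply/eqP => j0; apply: nk; exists j.
  by apply: filterS => y My; exists M.
case EN : (neighbour Th M k) => [L|]; last by have := full cM kp.
have [ML [j E]] := neighbour_some EN.
have cL : connect adj_at K L.
  apply: connect_trans cM _; apply: connect1; rewrite /adj_at vM.
  by apply/existsP; exists k; rewrite kp EN eqxx.
have := near_cone_neighbour hTh (P := fun q => q != p) ML E kx.
case=> [k' k'k k'p|e he hsub]; last first.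
  exists e => // y /hsub[My|Ly]; [by exists M|by exists L].
rewrite lt_neqAle eq_sym (Mx k' k'p) andbT; apply: contraNneq xp => k'0.
apply/eqP; apply: (only_vertex vM) => j' j'p.
have [->//|j'k] := eqVneq j' k; have [->//|j'k'] := eqVneq j' k'.
case/existsP: vM => i /eqP ip.
have ik : i != k by apply: contraNneq kp => <-; exact/eqP.
have ik' : i != k' by apply: contraNneq k'p => <-; exact/eqP.
have j'i : j' != i by apply: contraNneq j'p => ->; exact/eqP.
(* [i], [k], [k'] and [j'] would be four different indices of a triangle. *)
suff : false by [].
move: ik ik' j'i j'k j'k' k'k; clear; move: i k k' j'.
by do 4!(apply: ord3_ind).
Qed.

(** Along a segment that starts in the fan and avoids [p], the set of parameters of points of the
    fan is nonempty, closed and relatively open, hence everything. *)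
Lemma fanT x : fan x.
Proof.
have [->|xp] := eqVneq x p.
  by exists K => // j jp; rewrite bary_vertex_neq.
(* The start is one of the two other vertices of [K]. If both segments to [x] met [p], both
   coordinates of [x] at these vertices would vanish, and [x] would be [p]. *)
have [y0 Ky0 hy0] : exists2 y0, vcone K y0 &
    forall t, 0 <= t <= 1 -> y0 + t *: (x - y0) != p.
  case/existsP: (vK) => i /eqP ip; have [e1 e2 e3] := ord3_neq i.
  have vc j : vcone K (Th K j).
    by move=> k _; rewrite bary_vertex ?ler0n //; exact: nd.
  have [h|/existsNP[t /not_implyP[/andP[t0 t1] /negP]]] := pselect (forall t, 0 <= t <= 1 ->
     Th K (i + 1) + t *: (x - Th K (i + 1)) != p); first by exists (Th K (i + 1)).
  rewrite negbK => /eqP tp; exists (Th K (i + 2%:R)) => // s /andP[s0 s1].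
  apply/eqP => sp.
  have xE a u : a + u *: (x - a) = (1 - u) *: a + u *: x.
    by apply: plane_ext; rewrite !planeE; ring.
  have b1 k : bary (Th K) k p = (1 - t) * (i + 1 == k)%:R + t * bary (Th K) k x.
    by rewrite -[in LHS]tp xE bary_aff aff_convex -!bary_aff bary_vertex ?(eq_sym k) //; exact: nd.
  have b2 k : bary (Th K) k p = (1 - s) * (i + 2%:R == k)%:R + s * bary (Th K) k x.
    by rewrite -[in LHS]sp xE bary_aff aff_convex -!bary_aff bary_vertex ?(eq_sym k) //; exact: nd.
  move: (b1 (i + 1)) (b1 (i + 2%:R)) (b2 (i + 1)) (b2 (i + 2%:R)).
  rewrite !eqxx (negbTE e3) eq_sym (negbTE e3) -ip !bary_vertex; try exact: nd.
  rewrite (negbTE e1) (negbTE e2) !mulr0 !mulr1 !add0r.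
  move=> /= h1 h2 h3 h4.
  have t00 : t != 0 by apply/eqP => t00; move: h1; rewrite t00 mul0r subr0 addr0; lra.
  have x2 : bary (Th K) (i + 2%:R) x = 0.
    by move/esym/eqP: h2; rewrite mulf_eq0 (negbTE t00) => /eqP.
  have s1' : s = 1 by move: h4; rewrite x2; lra.
  have x1 : bary (Th K) (i + 1) x = 0 by move: h3; rewrite s1'; lra.
  case/eqP: xp; apply: (only_vertex vK); apply: (@ord3_rot_ind _ i) => //.
  by rewrite ip eqxx.
pose y (t : R) := y0 + t *: (x - y0).
have cy : continuous y.
  by move=> t; apply: cvgD; [exact: cvg_cst | apply: cvgZr_tmp; exact: cvg_id].
have : `[0, 1]%classic `&` (y @^-1` fan) = `[0, 1]%classic.
  apply: (@segment_connected R 0 1).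
  - by exists 0; split; rewrite /= ?in_itv/= ?lexx ?ler01 // /y scale0r addr0; exists K.
  - exists (y @^-1` (interior fan)).
      by apply: open_comp; [move=> t _; exact: cy | exact: open_interior].
    apply/seteqP; split=> t [t01 ft]; split=> //; last exact: interior_subset ft.
    by apply: fan_nbhs => //; apply: hy0; move: t01; rewrite /= in_itv.
  - exists (y @^-1` fan) => //; apply: closed_comp; last exact: closed_fan.
    by move=> t _; exact: cy.
move=> /seteqP[_ /(_ 1)]; rewrite /= in_itv/= lexx ler01 => /(_ isT)[_].
by rewrite /y scale1r addrC subrK.
Qed.

(** Near [p] a sector and its triangle coincide, since the coordinate at [p] is close to 1. *)
Lemma near_fan_tri : \forall y \near p, exists2 M, connect adj_at K M & tri_set (Th M) y.
Proof.
have h : \forall y \near p, forall M, has_vertex M -> forall i, Th M i == p -> 0 < bary (Th M) i y.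
  apply: near_forall => M; have [vM|nvM] := boolP (has_vertex M); last exact: near_always.
  have : \forall y \near p, forall i, Th M i == p -> 0 < bary (Th M) i y.
    apply: near_forall => i; have [ip|ip] := eqVneq (Th M i) p; last exact: near_always.
    have : 0 < bary (Th M) i p by rewrite -ip bary_vertex ?eqxx //; exact: nd.
    by move=> /near_bary_gt0; apply: filterS => y ? _.
  by apply: filterS => y hy _.
apply: filterS h => y h; have [M cM My] := fanT y; exists M => //.
have vM := connect_has_vertex vK cM.
apply/(tri_setP (nd M)) => i; have [ip|ip] := eqVneq (Th M i) p; last exact: My.
by apply/ltW/h => //; exact/eqP.
Qed.

Lemma full_omega : Omega p.
Proof.
apply: (omega_near hOmega); apply: filterS near_fan_tri => y [M _ My].
by apply/(mesh_cover hTh); exists M.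
Qed.

(** A point near [p] in the direction of the barycentre of [M] is interior to [M] and covered by
    some triangle of the fan, which must then be [M]. *)
Lemma full_connect M : has_vertex M -> connect adj_at K M.
Proof.
move=> vM; pose c := \sum_i (1 / 3 : R) *: Th M i.
have bc i : bary (Th M) i c = 1 / 3.
  by rewrite bary_of_comb //; [exact: nd | rewrite sum_ord3; field].
have [s s0 hs] := near_line (c - p) near_fan_tri.
pose t := Num.min s 1.
have t0 : 0 < t by rewrite lt_min s0 ltr01.
have t1 : t <= 1 by rewrite ge_min lexx orbT.
have [|L cL Ly] := hs t; first by rewrite gtr0_norm // ge_min lexx.
suff -> : M = L by [].
apply: (mesh_interior hTh Ly) => i.
rewrite (_ : p + t *: (c - p) = (1 - t) *: p + t *: c); last first.
  by apply: plane_ext; rewrite !planeE; ring.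
rewrite bary_aff aff_convex -!bary_aff bc.
have : 0 <= bary (Th M) i p.
  by case/existsP: vM => k /eqP <-; rewrite bary_vertex ?ler0n //; exact: nd.
nra.
Qed.

End Component.

(** A component without boundary edge would cover a neighbourhood of [p]. The statement concerns the
    component of [K], since the triangles at a boundary vertex need not form a single chain. *)
Lemma star_boundary K : bdry Omega p -> has_vertex K ->
  exists M i, [/\ connect adj_at K M, Th M i != p & neighbour Th M i = None].
Proof.
move=> bp vK; apply: contrapT => h; apply: (bdry_not_omega hOmega bp).
apply: (@full_omega K vK) => M i cM ip EN; apply: h; exists M, i; split=> //.
Qed.

(** An edge through [p] without neighbour would put [p] on the boundary, so the component of [K] is
    full. *)
Lemma star_interior K M : Omega p -> has_vertex K -> has_vertex M -> connect adj_at K M.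
Proof.
move=> Op vK vM; apply: full_connect => // L i cL ip EN.
have vL := connect_has_vertex vK cL.
have : bdry Omega p.
  apply: (edge_boundary hOmega hTh EN); apply/(edgeP (nd L)); split; last exact: bary_vertex_neq.
  by case/existsP: vL => k /eqP <-; exact/tri_set_vertex/nd.
by move/(bdry_not_omega hOmega).
Qed.

End Star.

(** * Shape regularity *)

Section Quantitative.
Variable R : realType.
Notation plane := (measurableTypeR R * measurableTypeR R)%type.
Implicit Types (T : tri R) (x y z : R * R) (G r : R) (f : R * (R * R)).

(** Green's formula for the constant function 1, the divergence being 2. *)
Lemma area_det T : Defs.nondegenerate T -> area T = `|tri_det T| / 2.
Proof.
move=> nT; have pd0 v : pd v (fun=> 1) = (fun=> 0) :> (R * R -> R).
  by apply/funext => x; rewrite /pd derive_cst.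
have := @green_vertex R T 0 (fun=> 1) nT (fun x => differentiable_cst _ _).
rewrite !pd0 => /(_ (fun x => cvg_cst _)) /(_ (fun x => cvg_cst _)).
rewrite (_ : (fun x => _) = fun=> 2); last by apply/funext => x; rewrite !mulr0 !add0r mulr1.
rewrite (Rintegral_cst _ (measurable_tri_set nT)).
rewrite Rintegral_cst //.
rewrite mul1r (_ : fine (lebesgue_measure _) = 1); last first.
  by rewrite (@lebesgue_measure_itv R `[0, 1]) /= lte_fin ltr01 /= ?sube0 ?oppr0 ?adde0 ?addr0 ?subr0.
by rewrite mulr1 => <-; rewrite /area; field.
Qed.

Lemma area_gt0 T : Defs.nondegenerate T -> 0 < area T.
Proof. by move=> nT; rewrite area_det // divr_gt0 // normr_gt0; exact: nT. Qed.

Lemma leb2_tri_lty T : Defs.nondegenerate T -> (leb2 R (tri_set T) < +oo)%E.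
Proof.
move=> nT; exact: leb2_bounded_lty (measurable_tri_set nT) (@bounded_tri_set _ T).
Qed.

Definition sqn x : R := dot x x.

Lemma sqn_ge0 x : 0 <= sqn x.
Proof. by rewrite /sqn /dot -!expr2 addr_ge0 ?sqr_ge0. Qed.

(** Shape regularity of one triangle with squared distances, so that the later estimates are
    polynomial. *)
Definition regular_disc T G z r :=
  [/\ 0 < r, 0 <= G, forall x, sqn (x - z) <= r ^+ 2 -> tri_set T x &
      forall x y, tri_set T x -> tri_set T y -> sqn (x - y) <= (2 * G * r) ^+ 2].

Lemma edist_le x y r : 0 <= r -> (Defs.edist x y <= r) = (sqn (x - y) <= r ^+ 2).
Proof.
move=> r0; rewrite /Defs.edist /sqn /dot /= -!expr2 -[in LHS](ger0_norm r0) -sqrtr_sqr.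
by rewrite ler_psqrt // nnegrE ?sqr_ge0 // addr_ge0 ?sqr_ge0.
Qed.

Lemma regular_disc_center T G z r : regular_disc T G z r -> tri_set T z.
Proof.
by case=> r0 _ h _; apply: h; rewrite subrr /sqn /dot/= mulr0 addr0 sqr_ge0.
Qed.

Lemma shape_regular_disc G n (Th : mesh R n) K : shape_regular G Th ->
  exists z r, regular_disc (Th K) G z r.
Proof.
move=> /(_ K)[z [r r0 [h1 h2]]]; exists z, r.
have Kz : tri_set (Th K) z.
  by apply: h1; rewrite edist_le ?(ltW r0) // subrr /sqn /dot/= mulr0 addr0 sqr_ge0.
have G0 : 0 <= G.
  have := h2 z z Kz Kz; rewrite /Defs.edist !subrr expr0n /= addr0 sqrtr0.
  by rewrite pmulr_lge0 // mulr_gt0.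
split=> //; first by move=> x xr; apply: h1; rewrite edist_le ?(ltW r0).
move=> x y Tx Ty; have := h2 x y Tx Ty; rewrite edist_le; last first.
  by rewrite mulr_ge0 // mulr_ge0 // ltW.
by rewrite (_ : G * (2 * r) = 2 * G * r) //; ring.
Qed.

Lemma convex_tri T x y t : Defs.nondegenerate T -> tri_set T x -> tri_set T y ->
  0 <= t <= 1 -> tri_set T ((1 - t) *: x + t *: y).
Proof.
move=> nT /(tri_setP nT) Tx /(tri_setP nT) Ty /andP[t0 t1]; apply/(tri_setP nT) => i.
rewrite bary_aff aff_convex -!bary_aff; have := Tx i; have := Ty i; nra.
Qed.

(* Evaluate [f] at the two points [z +- (r / |f.2|) f.2] of the disc. *)
Lemma sqn_grad_disc T G z r f b : regular_disc T G z r ->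
  (forall x, tri_set T x -> `|aff f x| <= b) -> r ^+ 2 * sqn f.2 <= b ^+ 2.
Proof.
move=> [r0 _ h _] fb; set q := sqn f.2; have q0 : 0 <= q by exact: sqn_ge0.
have [q00|qn0] := eqVneq q 0; first by rewrite q00 mulr0 sqr_ge0.
have qp : 0 < q by rewrite lt_neqAle eq_sym qn0.
pose s := Num.sqrt q; have s0 : 0 < s by rewrite sqrtr_gt0.
have sq : s ^+ 2 = q by rewrite sqr_sqrtr.
have disc (d : R) : d ^+ 2 = (r / s) ^+ 2 -> tri_set T (z + d *: f.2).
  move=> dE; apply: h; rewrite addrC addKr /sqn /dot !planeE.
  have -> : d * f.2.1 * (d * f.2.1) + d * f.2.2 * (d * f.2.2) = d ^+ 2 * q.
    by rewrite /q /sqn /dot; ring.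
  by rewrite dE expr_div_n sq divfK.
have val (d : R) : aff f (z + d *: f.2) = aff f z + d * q.
  by rewrite /aff /q /sqn /dot !planeE; ring.
have := fb _ (disc (r / s) erefl); have := fb _ (disc (- (r / s)) (sqrrN _)).
rewrite !val !ler_norml => /andP[h1 h2] /andP[h3 h4].
have : r / s * q <= b by lra.
rewrite -sq expr2 mulrA divfK ?gt_eqF // => rsb.
by rewrite -exprMn ler_sqr ?nnegrE // ?(le_trans _ rsb) // mulr_ge0 // ltW.
Qed.

(** If the coordinate vanished at the centre, moving against its gradient inside the disc would make
    it negative unless the gradient is zero; but the coordinate is not constant. *)
Lemma tri_disc_bary T G z r i : Defs.nondegenerate T -> regular_disc T G z r ->
  0 < bary T i z.
Proof.
move=> nT dT; have Tz := regular_disc_center dT; case: dT => r0 _ h _.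
rewrite lt_neqAle (proj1 (tri_setP nT _) Tz) andbT eq_sym; apply/eqP => b0.
set g := (bary_form T i).2; pose q := sqn g; have q0 : 0 <= q by exact: sqn_ge0.
have val (d : R) : bary T i (z + d *: g) = d * q.
  rewrite -[RHS]add0r -b0 !bary_aff /aff -/g /q /sqn /dot !planeE; ring.
(* With [r = d * (1 + q)] the displacement [d *: g] satisfies [d ^+ 2 * q <= r ^+ 2] without any
   square root. *)
pose d := r / (1 + q).
have d0 : 0 < d by rewrite divr_gt0 //; lra.
have dq : d * (1 + q) = r by rewrite divfK //; apply/eqP; lra.
have Td : tri_set T (z + (- d) *: g).
  apply: h; rewrite addrC addKr /sqn /dot !planeE.
  rewrite (_ : _ + _ = d ^+ 2 * q); last by rewrite /q /sqn /dot; ring.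
  by rewrite -dq; nra.
have := proj1 (tri_setP nT _) Td i; rewrite val => dq0.
have q00 : q = 0 by nra.
have g0 : g = 0.
  move: q00; rewrite /q /sqn /dot => /eqP; rewrite paddr_eq0 -?expr2 ?sqr_ge0 //.
  by rewrite !sqrf_eq0 => /andP[/eqP g1 /eqP g2]; apply: plane_ext.
have cst x y : bary T i x = bary T i y.
  by apply/eqP; rewrite -subr_eq0 !bary_aff aff_sub -/g g0 /dot/= !mul0r addr0.
have := cst (T i) (T (i + 1)); rewrite !bary_vertex // eqxx.
by have [e1 _ _] := ord3_neq i; rewrite eq_sym (negbTE e1) => /eqP; rewrite oner_eq0.
Qed.

(** The disc contains the concentric square of side [r]. *)
Lemma area_lower T G z r : Defs.nondegenerate T -> regular_disc T G z r -> r ^+ 2 <= area T.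
Proof.
move=> nT dT; case: (dT) => r0 _ h _; pose s := r / 2.
have s0 : 0 < s by rewrite divr_gt0.
have s1 : z.1 - s <= z.1 + s by lra.
have s2 : z.2 - s <= z.2 + s by lra.
pose B : set plane := `[(z.1 - s), (z.1 + s)]%classic `*` `[(z.2 - s), (z.2 + s)]%classic.
have mB : measurable B by apply: measurableX; exact: measurable_itv.
have : (leb2 R B <= leb2 R (tri_set T))%E.
  apply: le_measure; rewrite ?inE //; first exact: measurable_tri_set.
  move=> x [/=]; rewrite !in_itv/= => /andP[x1 x1'] /andP[x2 x2']; apply: h.
  rewrite /sqn /dot /=; have : r = 2 * s by rewrite /s; field.
  by move=> ->; nra.
rewrite /B leb2_box // /area => h2; have fin := leb2_tri_lty nT.
have : (z.1 + s - (z.1 - s)) * (z.2 + s - (z.2 - s)) <= fine (leb2 R (tri_set T)).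
  by rewrite -lee_fin fineK ?ge0_fin_numE ?measure_ge0.
by apply: le_trans; rewrite /s; rewrite (_ : _ * _ = r ^+ 2) //; field.
Qed.

Lemma tri_diam_coord T G z r x y : regular_disc T G z r -> tri_set T x -> tri_set T y ->
  `|x.1 - y.1| <= 2 * G * r /\ `|x.2 - y.2| <= 2 * G * r.
Proof.
move=> [r0 G0 _ h] Tx Ty; have := h _ _ Tx Ty; rewrite /sqn /dot /= => hxy.
have Gr : 0 <= 2 * G * r by rewrite !mulr_ge0 // ltW.
by split; rewrite -(ger0_norm Gr) -ler_sqr ?nnegrE ?normr_ge0 // !real_normK ?num_real //;
  have := sqr_ge0 (x.1 - y.1); have := sqr_ge0 (x.2 - y.2); lra.
Qed.

Lemma area_upper T G z r : Defs.nondegenerate T -> regular_disc T G z r ->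
  area T <= (4 * G * r) ^+ 2.
Proof.
move=> nT dT; have Tz := regular_disc_center dT; case: (dT) => r0 G0 _ _; pose s := 2 * G * r.
have s0 : 0 <= s by rewrite !mulr_ge0 // ltW.
have s1 : z.1 - s <= z.1 + s by lra.
have s2 : z.2 - s <= z.2 + s by lra.
pose B : set plane := `[(z.1 - s), (z.1 + s)]%classic `*` `[(z.2 - s), (z.2 + s)]%classic.
have mB : measurable B by apply: measurableX; exact: measurable_itv.
have : (leb2 R (tri_set T) <= leb2 R B)%E.
  apply: le_measure; rewrite ?inE //; first exact: measurable_tri_set.
  move=> x Tx; have [] := tri_diam_coord dT Tx Tz; rewrite -/s !ler_norml => /andP[? ?] /andP[? ?].
  by split; rewrite /= in_itv/=; apply/andP; split; lra.
rewrite /B leb2_box // /area => h2; have fin := leb2_tri_lty nT.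
have : fine (leb2 R (tri_set T)) <= (z.1 + s - (z.1 - s)) * (z.2 + s - (z.2 - s)).
  by rewrite -lee_fin fineK ?ge0_fin_numE ?measure_ge0.
by move/le_trans; apply; rewrite (_ : _ * _ = (4 * G * r) ^+ 2) // /s; ring.
Qed.

End Quantitative.

(** * The number of triangles at a vertex *)

Section Valence.
Variables (R : realType) (Omega : set (R * R)) (n : nat) (Th : mesh R n).
Hypothesis hTh : conforming_triangulation Omega Th.
Variables (G : R) (zc : 'I_n -> R * R) (rc : 'I_n -> R).
Hypothesis disc : forall K, regular_disc (Th K) G (zc K) (rc K).
Implicit Types (K L M : 'I_n) (i j : 'I_3) (x p : R * R).
Local Notation nd := (mesh_nondegenerate hTh).

Lemma rc_gt0 K : 0 < rc K. Proof. by case: (disc K). Qed.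

(** Dilate each triangle about [p] until its inscribed disc has radius 1. If the scaled centres were
    at distance at most 1, the scaled centre of [L] would lie in the scaled disc of [K]; shrinking
    back by the smaller radius gives a point of [K] that is interior to [L]. *)
Lemma scaled_centers_apart p K L : has_vertex Th p K -> has_vertex Th p L -> K != L ->
  1 < sqn ((rc K)^-1 *: (zc K - p) - (rc L)^-1 *: (zc L - p)).
Proof.
move=> vK vL KL; set wK := _ *: (zc K - p); set wL := _ *: (zc L - p).
rewrite ltNge; apply/negP => w1.
have rK := rc_gt0 K; have rL := rc_gt0 L.
pose s := Num.min (rc K) (rc L).
have s0 : 0 < s by rewrite lt_min rK rL.
have sK : s / rc K <= 1 by rewrite ler_pdivrMr // mul1r ge_min lexx.
have sL : s / rc L <= 1 by rewrite ler_pdivrMr // mul1r ge_min lexx orbT.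
have sK0 : 0 < s / rc K by rewrite divr_gt0.
have sL0 : 0 < s / rc L by rewrite divr_gt0.
have tp M : has_vertex Th p M -> tri_set (Th M) p.
  by case/existsP=> i /eqP <-; exact/tri_set_vertex/nd.
pose y := p + s *: wL.
have yL : y = (1 - s / rc L) *: p + (s / rc L) *: zc L.
  by rewrite /y /wL; apply: plane_ext; rewrite !planeE; field; rewrite gt_eqF.
have yK : y = (1 - s / rc K) *: p + (s / rc K) *: (zc K + rc K *: (wL - wK)).
  by rewrite /y /wK /wL; apply: plane_ext; rewrite !planeE; field; rewrite !gt_eqF.
have Ky : tri_set (Th K) y.
  rewrite yK; apply: convex_tri; [exact: nd | exact: tp | | by rewrite (ltW sK0)].
  case: (disc K) => _ _ h _; apply: h; rewrite addrC addKr.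
  have -> : sqn (rc K *: (wL - wK)) = rc K ^+ 2 * sqn (wK - wL).
    by rewrite /sqn /dot !planeE; ring.
  by rewrite ler_piMr // sqr_ge0.
have LK : L = K.
  apply: (mesh_interior hTh Ky) => i; rewrite yL bary_aff aff_convex -!bary_aff.
  have := tri_disc_bary i (nd L) (disc L).
  by have := proj1 (tri_setP (nd L) p) (tp L vL) i; nra.
by rewrite LK eqxx in KL.
Qed.

Lemma valence_bound p :
  (#|[pred M | has_vertex Th p M]| <= ((Num.truncn (8 * G)).+1 ^ 2))%N.
Proof.
pose N := Num.truncn (8 * G).
pose w M := (rc M)^-1 *: (zc M - p).
(* The scaled centres lie in a square of side [4 * G], cut into cells of side one half: two points
   of one cell have squared distance at most one half. As [2 * (t + 2 * G)] ranges over
   [[0, 8 * G]], each coordinate takes at most [N.+1] values. *)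
pose cell (t : R) : 'I_N.+1 := inord (Num.truncn (2 * (t + 2 * G))).
have wb M : has_vertex Th p M -> `|(w M).1| <= 2 * G /\ `|(w M).2| <= 2 * G.
  move=> vM; have rM := rc_gt0 M.
  have Mp : tri_set (Th M) p by case/existsP: vM => i /eqP <-; exact/tri_set_vertex/nd.
  have [] := tri_diam_coord (disc M) (regular_disc_center (disc M)) Mp.
  rewrite /w !planeE !normrM gtr0_norm ?invr_gt0 // => h1 h2.
  by rewrite !ler_pdivrMl // ![rc M * _]mulrC.
have cellP (t : R) : `|t| <= 2 * G -> exists k : nat,
    [/\ cell t = k :> nat, k%:R <= 2 * (t + 2 * G) & 2 * (t + 2 * G) < k%:R + 1].
  rewrite ler_norml => /andP[t1 t2]; exists (Num.truncn (2 * (t + 2 * G))).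
  have t0 : 0 <= 2 * (t + 2 * G) by lra.
  have /andP[h1 h2] := truncn_itv t0; split=> //; last by rewrite natr1.
  rewrite inordK // ltnS; apply: le_truncn; lra.
have cell_near (t u : R) : `|t| <= 2 * G -> `|u| <= 2 * G -> cell t = cell u ->
    (t - u) ^+ 2 <= 1 / 4.
  move=> /cellP[k [<- k1 k2]] /cellP[l [<- l1 l2]] E; rewrite E in k1 k2.
  by move: k1 k2 l1 l2; set c := _%:R => ? ? ? ?; nra.
pose F M := (cell (w M).1, cell (w M).2).
have injF : {in [pred M | has_vertex Th p M] &, injective F}.
  move=> K L; rewrite !inE => vK vL [E1 E2]; apply/eqP/negPn/negP => KL.
  have := scaled_centers_apart vK vL KL; rewrite -/(w K) -/(w L).
  have [K1 K2] := wb K vK; have [L1 L2] := wb L vL.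
  have := cell_near _ _ K1 L1 E1; have := cell_near _ _ K2 L2 E2.
  by clear E1 E2; rewrite /sqn /dot /= -!expr2 => ? ? ?; lra.
rewrite -(card_in_imset injF); apply: leq_trans (max_card _) _.
by rewrite card_prod card_ord.
Qed.

End Valence.

(** * Pairing the two sides of an edge *)

Section Partner.
Variables (R : realType) (Omega : set (R * R)) (n : nat) (Th : mesh R n).
Hypothesis hTh : conforming_triangulation Omega Th.
Implicit Types (K L M : 'I_n) (i j : 'I_3) (x p : R * R).
Local Notation nd := (mesh_nondegenerate hTh).

(** Boundary pairs are fixed points, so this is an involution of all pairs and sums can be reindexed
    along it. *)
Definition partner (Ki : 'I_n * 'I_3) : 'I_n * 'I_3 :=
  if neighbour Th Ki.1 Ki.2 is Some L then
    (L, odflt 0 [pick j | `[< edge (Th L) j = edge (Th Ki.1) Ki.2 >]])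
  else Ki.

Lemma edge_inj L j j' : edge (Th L) j = edge (Th L) j' -> j = j'.
Proof.
move=> E; apply/eqP/negPn/negP => jj'.
have : edge (Th L) j' (Th L j) by apply: edge_vertex => //; exact: nd.
by rewrite -E => /(edgeP (nd L))[_]; rewrite bary_vertex ?eqxx; [move/eqP; rewrite oner_eq0 | exact: nd].
Qed.

Lemma partnerE K i L j : K != L -> edge (Th L) j = edge (Th K) i ->
  partner (K, i) = (L, j).
Proof.
move=> KL E; rewrite /partner /= (neighbourE hTh KL E); congr pair.
case: pickP => [j' /asboolP E'|/(_ j)/asboolP //]; apply: (@edge_inj L).
by rewrite E' E.
Qed.

Lemma partnerP K i : (exists L j, [/\ K != L, edge (Th L) j = edge (Th K) i,
    neighbour Th K i = Some L & partner (K, i) = (L, j)]) \/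
  (neighbour Th K i = None /\ partner (K, i) = (K, i)).
Proof.
case EN : (neighbour Th K i) => [L|]; last by right; rewrite /partner /= EN.
have [KL [j E]] := neighbour_some EN; left; exists L, j; split=> //.
exact: partnerE.
Qed.

Lemma partnerK : involutive partner.
Proof.
move=> [K i]; case: (partnerP K i) => [[L [j [KL E _ ->]]]|[_ E]]; last by rewrite !E.
by apply: partnerE => //; rewrite eq_sym.
Qed.

Lemma sum_partner (V : nmodType) (F : 'I_n * 'I_3 -> V) :
  \sum_u F (partner u) = \sum_u F u.
Proof. by rewrite [RHS](reindex_inj (inv_inj partnerK)). Qed.

Lemma sum_partner_odd (F : 'I_n * 'I_3 -> R) :
  (forall u, F (partner u) = - F u) -> \sum_u F u = 0.
Proof.
move=> Fp; have := sum_partner F; under eq_bigr do rewrite Fp.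
by rewrite sumrN => h; lra.
Qed.

Lemma det_bary T i x : Defs.nondegenerate T ->
  tri_det T * bary T i x = cross (T (i + 1) - x) (T (i + 2%:R) - x) :> R.
Proof. by move=> nT; rewrite mulrC /bary divfK //; exact: nT. Qed.

(** [|tri_det (Th K)| * bary (Th K) i x] is the outward flux through edge [i] of the field [y - x]
    in the variable [y]; the outward normals on the two sides are opposite. *)
Lemma flux_opposite K i L j x : K != L -> edge (Th L) j = edge (Th K) i ->
  `|tri_det (Th L)| * bary (Th L) j x = - (`|tri_det (Th K)| * bary (Th K) i x).
Proof.
move=> KL E; have opp := bary_opposite hTh KL E.
rewrite (bary_proportional hTh x E).
have dK : `|tri_det (Th K)| * bary (Th K) i (Th L j) = - `|tri_det (Th L)|.
  have -> : `|tri_det (Th L)| = `|tri_det (Th K) * bary (Th K) i (Th L j)|.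
    rewrite det_bary; last exact: nd.
    rewrite -(tri_det_rot (Th L) j); case: (edge_endpoints E) => -[-> ->] //.
    by rewrite -normrN; congr `|_|; rewrite /cross; ring.
  by rewrite normrM (ltr0_norm opp) mulrN opprK.
by rewrite [X in - X]mulrCA dK mulrN opprK mulrC.
Qed.

End Partner.

(** * Discrete Poincare inequality *)

Section Estimates.
Variables (R : realType) (Omega : set (R * R)) (n : nat) (Th : mesh R n).
Hypothesis hOmega : bounded_polygonal_domain Omega.
Hypothesis hTh : conforming_triangulation Omega Th.
Variables (G : R) (zc : 'I_n -> R * R) (rc : 'I_n -> R).
Hypothesis disc : forall K, regular_disc (Th K) G (zc K) (rc K).
Implicit Types (K L M : 'I_n) (i j : 'I_3) (x y p : R * R).
Local Notation nd := (mesh_nondegenerate hTh).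
Local Notation rpos := (rc_gt0 disc).

Lemma G_ge0 K : 0 <= G. Proof. by case: (disc K). Qed.

Lemma dot_sqr_le x y : dot x y ^+ 2 <= sqn x * sqn y.
Proof.
have := sqr_ge0 (x.1 * y.2 - x.2 * y.1).
by rewrite /sqn /dot !expr2; lra.
Qed.

Lemma sqn_sub_le x y : sqn (x - y) <= 2 * sqn x + 2 * sqn y.
Proof.
have := sqn_ge0 (x + y); rewrite /sqn /dot !planeE; lra.
Qed.

Definition edge_mid (T : tri R) i : R * R :=
  (1 - 1 / 2) *: T (i + 1) + (1 / 2) *: T (i + 2%:R).

Lemma tri_edge_mid K i : tri_set (Th K) (edge_mid (Th K) i).
Proof.
apply: convex_tri; [exact: nd | exact/tri_set_vertex/nd | exact/tri_set_vertex/nd|].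
by apply/andP; split; lra.
Qed.

Lemma edge_mid_eq K i L j : edge (Th L) j = edge (Th K) i ->
  edge_mid (Th L) j = edge_mid (Th K) i.
Proof.
rewrite /edge_mid; case/edge_endpoints=> -[-> ->] //.
by apply: plane_ext; rewrite !planeE; field.
Qed.

Lemma aff_diff_le K f x y : tri_set (Th K) x -> tri_set (Th K) y ->
  (aff f x - aff f y) ^+ 2 <= (2 * G * rc K) ^+ 2 * sqn f.2.
Proof.
move=> Kx Ky; rewrite aff_sub; apply: le_trans (dot_sqr_le _ _) _.
by rewrite mulrC ler_wpM2r ?sqn_ge0 //; case: (disc K) => _ _ _; apply.
Qed.

Variable e : 'I_n -> R * (R * R).

Definition midvalue K i : R := aff (e K) (edge_mid (Th K) i).

Definition grad_jump K i : R * R :=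
  if neighbour Th K i is Some L then (e K).2 - (e L).2 else (e K).2.

Hypothesis mid_cont : forall K i L j, K != L -> edge (Th L) j = edge (Th K) i ->
  midvalue L j = midvalue K i.
Hypothesis mid_bdry : forall K i, neighbour Th K i = None -> midvalue K i = 0.

Section Poincare.
Variable M : R.
Hypothesis hM : forall K x, tri_set (Th K) x -> `|x.1| <= M /\ `|x.2| <= M.

(** Outward flux of the identity field through edge [i]. *)
Definition flux K i : R := `|tri_det (Th K)| * bary (Th K) i (0, 0).

Lemma M_ge_radius K : rc K <= M.
Proof.
have r0 := rpos K; case: (disc K) => _ _ h _.
have Kz (t : R) : t ^+ 2 <= rc K ^+ 2 -> tri_set (Th K) (zc K + (t, 0)).
  by move=> t1; apply: h; rewrite addrC addKr /sqn /dot /= mulr0 addr0 -expr2.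
have [] := hM (Kz (rc K) (lexx _)); have [] := hM (Kz (- rc K) _); first by rewrite sqrrN.
by rewrite /= !ler_norml => /andP[? ?] _ /andP[? ?] _; lra.
Qed.

Lemma flux_le K i : `|flux K i| <= 2 * M * (2 * G * rc K).
Proof.
have M0 : 0 <= M by apply: le_trans (M_ge_radius K); exact/ltW/rpos.
rewrite /flux normrM normr_id -normrM det_bary ?subr0; last exact: nd.
have [a1 a2] := hM (tri_set_vertex (nd K) (i + 1)).
have [b1 b2] := tri_diam_coord (disc K) (tri_set_vertex (nd K) (i + 2%:R)) (tri_set_vertex (nd K) (i + 1)).
set a := Th K (i + 1) in a1 a2 b1 b2 *; set b := Th K (i + 2%:R) in b1 b2 *.
have -> : cross a b = a.1 * (b.2 - a.2) - a.2 * (b.1 - a.1).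
  by rewrite /cross; ring.
apply: le_trans (ler_normB _ _) _; rewrite !normrM.
have h0 := normr_ge0 a.1; have h0' := normr_ge0 a.2.
have k0 := normr_ge0 (b.1 - a.1); have k0' := normr_ge0 (b.2 - a.2).
have := ler_pM h0 k0' a1 b2; have := ler_pM h0' k0 a2 b1; lra.
Qed.

(** Three times, once per edge, the constants [192 * H ^+ 2 * M ^+ 2] and [16 * G * H * M ^+ 2]
    found in the next proof, where [H = 1 + G ^+ 2]. *)
Definition poincare_cst : R :=
  576 * M ^+ 2 * (1 + G ^+ 2) ^+ 2 + 48 * G * (1 + G ^+ 2) * M ^+ 2.

(** The fluxes sum to twice the area. Replacing all three edge means by the first one produces cross
    terms of the size of the gradient, and half of [2 * A * m0 ^+ 2] is spent on absorbing them. *)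
Lemma poincare_local K :
  area (Th K) * midvalue K 0 ^+ 2 <= \sum_i flux K i * midvalue K i ^+ 2 +
    poincare_cst * (area (Th K) * sqn (e K).2).
Proof.
set A := area _; set q := sqn _; set m0 := midvalue K 0.
have M0 : 0 <= M by apply: le_trans (M_ge_radius K); exact/ltW/rpos.
have A0 : 0 < A by apply/area_gt0/nd.
have q0 : 0 <= q by exact: sqn_ge0.
have G0 := G_ge0 K; have r0 := rpos K.
pose H := 1 + G ^+ 2; have H1 : 1 <= H by rewrite lerDl sqr_ge0.
pose h := 2 * G * rc K; have h0 : 0 <= h by rewrite !mulr_ge0 // ltW.
have hA : h ^+ 2 <= 4 * H * A.
  have rA : rc K ^+ 2 <= A by apply: area_lower (disc K); exact: nd.
  have -> : h ^+ 2 = 4 * (G ^+ 2 * rc K ^+ 2) by rewrite /h; ring.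
  have := ler_wpM2l (sqr_ge0 G) rA; rewrite /H; nra.
have c2 : 0 <= 2 * M * h by exact: mulr_ge0 (mulr_ge0 (ler0n _ 2) M0) h0.
have hGM : h <= 2 * G * M by rewrite /h ler_wpM2l ?M_ge_radius // mulr_ge0.
(* Each edge may use one third of [A * m0 ^+ 2], which fixes the weight in the inequality between
   the means below. *)
have term i : flux K i * (m0 ^+ 2 - midvalue K i ^+ 2) <=
    3^-1 * (A * m0 ^+ 2) + 3^-1 * (poincare_cst * (A * q)).
  pose d := midvalue K i - m0.
  have dq : d ^+ 2 <= h ^+ 2 * q by apply: aff_diff_le; exact: tri_edge_mid.
  have F := flux_le K i; rewrite -/h in F.
  have -> : m0 ^+ 2 - midvalue K i ^+ 2 = - (d * (2 * m0 + d)) by rewrite /d; ring.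
  have step1 : flux K i * - (d * (2 * m0 + d)) <=
      2 * M * h * (2 * (`|m0| * `|d|) + `|d| ^+ 2).
    apply: le_trans (ler_norm _) _; rewrite (normrM (flux K i)) normrN (normrM d).
    apply: le_trans (ler_wpM2r (mulr_ge0 (normr_ge0 d) (normr_ge0 (2 * m0 + d))) F) _.
    apply: (ler_wpM2l c2).
    have := ler_normD (2 * m0) d; rewrite normrM (ger0_norm (ler0n _ 2)) => h1.
    have := ler_wpM2l (normr_ge0 d) h1; lra.
  apply: le_trans step1 _; set a := `|m0|; set b := `|d|.
  have a0 : 0 <= a by exact: normr_ge0. have b0 : 0 <= b by exact: normr_ge0.
  have -> : m0 ^+ 2 = a ^+ 2 by rewrite real_normK ?num_real.
  have bq : b ^+ 2 <= h ^+ 2 * q by rewrite real_normK ?num_real.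
  (* AM-GM: 48 H M h a b <= h^2 a^2 + (24 H M b)^2. *)
  have amgm : 12 * H * (2 * M * h * (2 * (a * b))) <= h ^+ 2 * a ^+ 2 + 576 * H ^+ 2 * M ^+ 2 * b ^+ 2.
    have := sqr_ge0 (h * a - 24 * H * M * b); lra.
  have H0 : 0 < 12 * H by lra.
  have p1 : h ^+ 2 * a ^+ 2 <= 4 * H * A * a ^+ 2 by rewrite ler_wpM2r ?sqr_ge0.
  have hq : h ^+ 2 * q <= 4 * H * A * q by rewrite ler_wpM2r.
  have c1 : 0 <= 576 * H ^+ 2 * M ^+ 2.
    by rewrite (_ : 576 * H ^+ 2 * M ^+ 2 = (24 * H * M) ^+ 2) ?sqr_ge0 //; ring.
  have p2 : 576 * H ^+ 2 * M ^+ 2 * b ^+ 2 <= 576 * H ^+ 2 * M ^+ 2 * (4 * H * A * q).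
    by apply: ler_wpM2l => //; exact: le_trans bq hq.
  have part1 : 2 * M * h * (2 * (a * b)) <= 3^-1 * (A * a ^+ 2) + 192 * H ^+ 2 * M ^+ 2 * (A * q).
    rewrite -(ler_pM2l H0); apply: le_trans amgm _; apply: le_trans (lerD p1 p2) _.
    by rewrite le_eqVlt; apply/orP; left; apply/eqP; field.
  have part2 : 2 * M * h * b ^+ 2 <= 16 * G * H * M ^+ 2 * (A * q).
    apply: le_trans (ler_wpM2l c2 (le_trans bq hq)) _.
    have c3 : 2 * M * h <= 2 * M * (2 * G * M).
      by apply: ler_wpM2l hGM; exact: mulr_ge0 (ler0n _ 2) M0.
    have c4 : 0 <= 4 * H * A * q.
      exact: mulr_ge0 (mulr_ge0 (mulr_ge0 (ler0n _ 4) (le_trans ler01 H1)) (ltW A0)) q0.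
    apply: le_trans (ler_wpM2r c4 c3) _.
    by rewrite le_eqVlt; apply/orP; left; apply/eqP; ring.
  rewrite mulrDr; apply: le_trans (lerD part1 part2) _.
  by rewrite /poincare_cst -/H le_eqVlt; apply/orP; left; apply/eqP; field.
have detA : \sum_i flux K i = 2 * A.
  rewrite /flux -mulr_sumr bary_sum; last exact: nd.
  by rewrite /A area_det; [field | exact: nd].
have : \sum_i flux K i * (m0 ^+ 2 - midvalue K i ^+ 2) <=
    A * m0 ^+ 2 + poincare_cst * (A * q).
  have -> : A * m0 ^+ 2 + poincare_cst * (A * q) =
     \sum_(i < 3) (3^-1 * (A * m0 ^+ 2) + 3^-1 * (poincare_cst * (A * q))).
    by rewrite sumr_const card_ord -mulr_natr; field.
  by apply: ler_sum => i _; exact: term.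
under eq_bigr do rewrite mulrBr.
rewrite sumrB -mulr_suml detA; lra.
Qed.

Lemma flux_sum0 : \sum_K \sum_i flux K i * midvalue K i ^+ 2 = 0.
Proof.
rewrite pair_big /=; apply: (sum_partner_odd hTh) => -[K i].
case: (partnerP hTh K i) => [[L [j [KL E _ ->]]]|[E ->]] /=.
  by rewrite (mid_cont KL E) /flux (flux_opposite hTh _ KL E) mulNr.
by rewrite mid_bdry // expr0n /= mulr0 oppr0.
Qed.

Lemma poincare_midpoints :
  \sum_K area (Th K) * midvalue K 0 ^+ 2 <=
  poincare_cst * \sum_K area (Th K) * sqn (e K).2.
Proof.
rewrite mulr_sumr; apply: le_trans (ler_sum _ (fun K _ => poincare_local K)) _.
by rewrite big_split /= flux_sum0 add0r.
Qed.

Lemma sup_aff_le K x : tri_set (Th K) x ->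
  aff (e K) x ^+ 2 <= 2 * midvalue K 0 ^+ 2 + 8 * G ^+ 2 * M ^+ 2 * sqn (e K).2.
Proof.
move=> Kx; have := aff_diff_le (e K) Kx (tri_edge_mid K 0); rewrite -/(midvalue K 0).
set m := midvalue K 0; set a := aff _ x; set q := sqn _ => h.
have r0 := rpos K; have q0 : 0 <= q by exact: sqn_ge0.
have hr : (2 * G * rc K) ^+ 2 * q <= 4 * G ^+ 2 * M ^+ 2 * q.
  apply: ler_wpM2r => //; rewrite !exprMn -[2 ^+ 2]natrX ler_wpM2l //.
    by rewrite mulr_ge0 ?sqr_ge0.
  by rewrite ler_sqr ?nnegrE ?M_ge_radius // ?(le_trans _ (M_ge_radius K)) // ltW.
have := sqr_ge0 (a - 2 * m); lra.
Qed.

End Poincare.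

End Estimates.

(** * Gradients and jumps *)

Section Jumps.
Variables (R : realType) (Omega : set (R * R)) (n : nat) (Th : mesh R n).
Hypothesis hOmega : bounded_polygonal_domain Omega.
Hypothesis hTh : conforming_triangulation Omega Th.
Variables (G : R) (zc : 'I_n -> R * R) (rc : 'I_n -> R).
Hypothesis disc : forall K, regular_disc (Th K) G (zc K) (rc K).
Implicit Types (K L M : 'I_n) (i j : 'I_3) (x y p : R * R).
Local Notation nd := (mesh_nondegenerate hTh).
Local Notation rpos := (rc_gt0 disc).
Local Notation len K i := (edge_length (Th K) i).

Lemma len_ge0 K i : 0 <= len K i. Proof. exact: sqrtr_ge0. Qed.

Lemma len_sqr K i : len K i ^+ 2 = sqn (Th K (i + 1) - Th K (i + 2%:R)).
Proof. by rewrite sqr_sqrtr ?addr_ge0 ?sqr_ge0 // /sqn /dot -!expr2. Qed.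

Lemma len_le K i : len K i <= 2 * G * rc K.
Proof.
case: (disc K) => r0 G0 _ h.
by rewrite edist_le ?mulr_ge0 ?(ltW r0) //; apply: h; exact/tri_set_vertex/nd.
Qed.

Lemma len_neighbour K i L j : edge (Th L) j = edge (Th K) i -> len L j = len K i.
Proof.
move=> E; apply/eqP; rewrite -(eqrXn2 (n := 2)) ?len_ge0 // !len_sqr.
case/edge_endpoints: E => -[-> ->] //.
by apply/eqP; rewrite /sqn /dot !planeE; ring.
Qed.

(** Twice the area is at least [2 * r ^+ 2], and at most the length of the edge times the diameter
    [2 * G * r]. *)
Lemma radius_le_len K i : rc K <= G * len K i.
Proof.
have r0 := rpos K; have G0 : 0 <= G by case: (disc K).
have A := area_lower (nd K) (disc K).
have detE : tri_det (Th K) = cross (Th K (i + 2%:R) - Th K (i + 1)) (Th K i - Th K (i + 1)).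
  by elim/ord3_ind: i; rewrite !ord3E /tri_det /cross !planeE; ring.
have hdet : `|tri_det (Th K)| ^+ 2 <= len K i ^+ 2 * (2 * G * rc K) ^+ 2.
  rewrite real_normK ?num_real // detE len_sqr.
  have h : sqn (Th K i - Th K (i + 1)) <= (2 * G * rc K) ^+ 2.
    by case: (disc K) => _ _ _; apply; exact/tri_set_vertex/nd.
  apply: le_trans (ler_wpM2l (sqn_ge0 _) h).
  set a := Th K (i + 2%:R) - _; set b := Th K i - _.
  have -> : sqn (Th K (i + 1) - Th K (i + 2%:R)) = sqn a.
    by rewrite /a /sqn /dot !planeE; ring.
  have := sqr_ge0 (a.1 * b.1 + a.2 * b.2); rewrite /cross /sqn /dot !expr2; lra.
have hr : (2 * rc K ^+ 2) ^+ 2 <= `|tri_det (Th K)| ^+ 2.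
  rewrite area_det in A; last exact: nd.
  rewrite ler_sqr ?nnegrE ?mulr_ge0 ?sqr_ge0 //; lra.
have := le_trans hr hdet.
rewrite -[_ ^+ 2 * _]exprMn ler_sqr ?nnegrE ?mulr_ge0 ?sqr_ge0 ?len_ge0 // ?(ltW r0) //.
rewrite (_ : len K i * (2 * G * rc K) = 2 * rc K * (G * len K i)); last by ring.
by rewrite (_ : 2 * rc K ^+ 2 = 2 * rc K * rc K) ?ler_pM2l ?mulr_gt0 //; ring.
Qed.

Lemma sqrt_area_le K : Num.sqrt (area (Th K)) <= 4 * G * rc K.
Proof.
have r0 := rpos K; have G0 : 0 <= G by case: (disc K).
rewrite -[leRHS]ger0_norm ?mulr_ge0 ?(ltW r0) // -sqrtr_sqr ler_psqrt ?nnegrE ?sqr_ge0 //.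
  exact: area_upper (nd K) (disc K).
exact/ltW/area_gt0/nd.
Qed.

Lemma radius_le_sqrt_area K : rc K <= Num.sqrt (area (Th K)).
Proof.
have r0 := rpos K.
rewrite -[leLHS]ger0_norm ?(ltW r0) // -sqrtr_sqr ler_psqrt ?nnegrE ?sqr_ge0 //.
  exact: area_lower (nd K) (disc K).
exact/ltW/area_gt0/nd.
Qed.

(** Unlike the area, the edge length is common to both adjacent triangles, so this form of the
    weight can be compared with the area of either. *)
Lemma weight_le_len K i : Num.sqrt (area (Th K)) * len K i <= 4 * G ^+ 2 * len K i ^+ 2.
Proof.
have G0 : 0 <= G by case: (disc K).
have h1 := sqrt_area_le K; have h2 := radius_le_len K i; have l0 := len_ge0 K i.
apply: le_trans (ler_wpM2r l0 h1) _.
have := ler_wpM2l (mulr_ge0 (ler0n _ 4) G0) h2 => h3.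
have := ler_wpM2r l0 h3; rewrite !expr2 => h4; apply: le_trans h4 _.
by rewrite le_eqVlt; apply/orP; left; apply/eqP; ring.
Qed.

Lemma len_sqr_le_area K i : len K i ^+ 2 <= 4 * G ^+ 2 * area (Th K).
Proof.
have r0 := rpos K; have G0 : 0 <= G by case: (disc K).
have h : len K i ^+ 2 <= (2 * G * rc K) ^+ 2.
  by rewrite ler_sqr ?nnegrE ?len_ge0 ?len_le // !mulr_ge0 // ltW.
apply: le_trans h _; have A := area_lower (nd K) (disc K).
have := ler_wpM2l (sqr_ge0 (2 * G)) A; rewrite -exprMn => h; apply: le_trans h _.
by rewrite le_eqVlt; apply/orP; left; apply/eqP; ring.
Qed.

Variable e : 'I_n -> R * (R * R).
Local Notation gjump K i := (grad_jump Th e K i).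

(** The weight of a jump is at most [16 * G ^+ 4] times the area of either adjacent triangle, and a
    squared difference costs a factor 2. Summing over both sides of the three edges gives another
    factor 6. *)
Lemma jumps_le_grad :
  \sum_K Num.sqrt (area (Th K)) * \sum_i len K i * sqn (gjump K i) <=
  192 * G ^+ 4 * \sum_K area (Th K) * sqn (e K).2.
Proof.
pose F (u : 'I_n * 'I_3) := area (Th u.1) * sqn (e u.1).2.
have F0 u : 0 <= F u by rewrite mulr_ge0 ?sqn_ge0 // ltW //; exact/area_gt0/nd.
have sumF : \sum_u F u = 3 * \sum_K area (Th K) * sqn (e K).2.
  transitivity (\sum_K \sum_(i : 'I_3) F (K, i)).
    by rewrite pair_big; apply: eq_bigr => -[].
  rewrite mulr_sumr; apply: eq_bigr => K _.
  by rewrite sum_ord3 /F /=; ring.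
have term K i : Num.sqrt (area (Th K)) * (len K i * sqn (gjump K i)) <=
    32 * G ^+ 4 * (F (K, i) + F (partner Th (K, i))).
  have w := weight_le_len K i.
  have wA M j : len M j = len K i -> Num.sqrt (area (Th K)) * len K i <= 16 * G ^+ 4 * area (Th M).
    move=> lE; apply: le_trans w _; rewrite -lE.
    have G20 : 0 <= 4 * G ^+ 2 by rewrite mulr_ge0 ?sqr_ge0.
    have := ler_wpM2l G20 (len_sqr_le_area M j) => h; apply: le_trans h _.
    by rewrite le_eqVlt; apply/orP; left; apply/eqP; ring.
  have wq M j : len M j = len K i ->
      Num.sqrt (area (Th K)) * len K i * sqn (e M).2 <= 16 * G ^+ 4 * F (M, j).
    move=> lE; rewrite /F /=; have := ler_wpM2r (sqn_ge0 (e M).2) (wA M j lE); lra.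
  have W0 : 0 <= Num.sqrt (area (Th K)) * len K i by rewrite mulr_ge0 ?sqrtr_ge0 ?len_ge0.
  rewrite mulrA; case: (partnerP hTh K i) => [[L [j [KL E EN EP]]]|[EN EP]].
    rewrite /grad_jump EN EP.
    apply: le_trans (ler_wpM2l W0 (sqn_sub_le _ _)) _.
    have h1 := wq K i erefl; have h2 := wq L j (len_neighbour E); lra.
  rewrite /grad_jump EN EP; have h1 := wq K i erefl.
  have := F0 (K, i); have : 0 <= G ^+ 4 by rewrite (exprM G 2 2) sqr_ge0.
  by move=> g0 f0; have := mulr_ge0 g0 f0; lra.
under eq_bigr do rewrite mulr_sumr.
rewrite pair_big /=; apply: (@le_trans _ _ (\sum_u 32 * G ^+ 4 * (F u + F (partner Th u)))).
  by apply: ler_sum => -[K i] _; exact: term.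
rewrite -mulr_sumr big_split /= (sum_partner hTh) sumF.
by rewrite le_eqVlt; apply/orP; left; apply/eqP; ring.
Qed.

End Jumps.

Section Interpolant.
Variable R : realType.
Implicit Types (T : tri R) (v : 'I_3 -> R).

Definition interp T v : R * (R * R) :=
  (\sum_i v i * (bary_form T i).1, \sum_i v i *: (bary_form T i).2).

Lemma aff_interp T v x : aff (interp T v) x = \sum_i v i * bary T i x.
Proof.
rewrite [RHS]sum_ord3 !bary_aff /aff -!/(interp T v).
have -> : (interp T v).1 = \sum_i v i * (bary_form T i).1 by [].
have -> : (interp T v).2 = \sum_i v i *: (bary_form T i).2 by [].
by rewrite !sum_ord3 /dot !planeE; ring.
Qed.

Lemma aff_interp_vertex T v i : Defs.nondegenerate T -> aff (interp T v) (T i) = v i.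
Proof.
move=> nT; rewrite aff_interp (bigD1 i) //= bary_vertex // eqxx mulr1 big1 ?addr0 // => j ji.
by rewrite bary_vertex // (negbTE ji) mulr0.
Qed.

End Interpolant.

(** * The broken gradient is controlled by its jumps *)

Section GradientBound.
Variables (R : realType) (Omega : set (R * R)) (n : nat) (Th : mesh R n).
Hypothesis hOmega : bounded_polygonal_domain Omega.
Hypothesis hTh : conforming_triangulation Omega Th.
Variables (G : R) (zc : 'I_n -> R * R) (rc : 'I_n -> R).
Hypothesis disc : forall K, regular_disc (Th K) G (zc K) (rc K).
Implicit Types (K L M : 'I_n) (i j : 'I_3) (x y p : R * R).
Local Notation nd := (mesh_nondegenerate hTh).
Local Notation len K i := (edge_length (Th K) i).
Variable e : 'I_n -> R * (R * R).
Hypothesis mid_cont : forall K i L j, K != L -> edge (Th L) j = edge (Th K) i ->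
  midvalue Th e L j = midvalue Th e K i.
Hypothesis mid_bdry : forall K i, neighbour Th K i = None -> midvalue Th e K i = 0.

Definition jump_sum M : R := \sum_j len M j ^+ 2 * sqn (grad_jump Th e M j).

Definition star_jump p : R := \sum_(M | has_vertex Th p M) jump_sum M.

Definition valence : nat := ((Num.truncn (8 * G)).+1 ^ 2)%N.

Lemma jump_sum_ge0 M : 0 <= jump_sum M.
Proof. by apply: sumr_ge0 => j _; rewrite mulr_ge0 ?sqr_ge0 ?sqn_ge0. Qed.

Lemma star_jump_ge0 p : 0 <= star_jump p.
Proof. by apply: sumr_ge0 => M _; exact: jump_sum_ge0. Qed.

Lemma jump_le_star p M j : has_vertex Th p M ->
  len M j ^+ 2 * sqn (grad_jump Th e M j) <= star_jump p.
Proof.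
move=> vM; apply: (@le_trans _ _ (jump_sum M)).
  rewrite /jump_sum (bigD1 j) //= lerDl sumr_ge0 // => k _.
  by rewrite mulr_ge0 ?sqr_ge0 ?sqn_ge0.
by rewrite /star_jump (bigD1 M) //= lerDl sumr_ge0 // => L _; exact: jump_sum_ge0.
Qed.

Lemma vertex_mid_le p M i : has_vertex Th p M -> Th M i != p ->
  sqn (p - edge_mid (Th M) i) <= len M i ^+ 2.
Proof.
move=> /existsP[k /eqP <-] ik; have {}ik : k != i by apply: contraNneq ik => ->.
have l0 := sqr_ge0 (len M i); move: l0; rewrite len_sqr.
suff -> : sqn (Th M k - edge_mid (Th M) i) = 4^-1 * sqn (Th M (i + 1) - Th M (i + 2%:R)) by lra.
move: k ik; apply: (@ord3_rot_ind _ i); first by rewrite eqxx.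
  by move=> _; rewrite /edge_mid /sqn /dot !planeE; field.
by move=> _; rewrite /edge_mid /sqn /dot !planeE; field.
Qed.

Lemma norm_le_star p M i a : has_vertex Th p M -> Th M i != p ->
  a = dot (grad_jump Th e M i) (p - edge_mid (Th M) i) -> `|a| <= Num.sqrt (star_jump p).
Proof.
move=> vM ip ->; rewrite -sqrtr_sqr ler_sqrt ?star_jump_ge0 //.
apply: le_trans (jump_le_star i vM); apply: le_trans (dot_sqr_le _ _) _.
by rewrite mulrC ler_wpM2r ?sqn_ge0 // vertex_mid_le.
Qed.

(** The two affine functions agree at the midpoint of the common edge, so their difference at its
    end point [p] is the gradient jump applied to half of the edge. *)
Lemma jump_step p M L : adj_at Th p M L ->
  `|aff (e M) p - aff (e L) p| <= Num.sqrt (star_jump p).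
Proof.
case/andP => vM /existsP[i /andP[ip /eqP EN]]; apply: (norm_le_star vM ip).
have [ML [j E]] := neighbour_some EN; rewrite /grad_jump EN.
have := mid_cont ML E; rewrite /midvalue (edge_mid_eq E) => Em.
set m := edge_mid _ _ in Em *.
have h : aff (e M) p - aff (e L) p = (aff (e M) p - aff (e M) m) - (aff (e L) p - aff (e L) m).
  by rewrite Em; ring.
by rewrite h !aff_sub /dot !planeE; ring.
Qed.

Lemma boundary_step p M i : has_vertex Th p M -> Th M i != p ->
  neighbour Th M i = None -> `|aff (e M) p| <= Num.sqrt (star_jump p).
Proof.
move=> vM ip EN; apply: (norm_le_star vM ip).
by rewrite /grad_jump EN -aff_sub -/(midvalue Th e M i) mid_bdry // subr0.
Qed.

Lemma path_step p K s : path (adj_at Th p) K s ->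
  `|aff (e K) p - aff (e (last K s)) p| <= (size s)%:R * Num.sqrt (star_jump p).
Proof.
elim: s K => [|L s IH] K /=; first by rewrite subrr normr0 mul0r.
case/andP => KL /IH h; apply: le_trans (ler_distD (aff (e L) p) _ _) _.
by rewrite -natr1 mulrDl mul1r addrC lerD // jump_step.
Qed.

(** A path without repetition visits distinct triangles at [p]; it has one step less than triangles,
    hence the strict bound on [k]. *)
Lemma connect_step p K M : has_vertex Th p K -> connect (adj_at Th p) K M ->
  exists2 k : nat, (k < valence)%N &
    `|aff (e K) p - aff (e M) p| <= k%:R * Num.sqrt (star_jump p).
Proof.
move=> vK /connectP[s0 p0 lE]; move: lE; case/shortenP: p0 => s ps us _ lE.
exists (size s); last by rewrite lE; exact: path_step.
apply: leq_trans (valence_bound hTh disc p).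
have -> : (size s).+1 = size (K :: s) by [].
rewrite -(card_uniqP us); apply: subset_leq_card; apply/fintype.subsetP => L.
rewrite inE => sL; rewrite inE; apply: (connect_has_vertex hTh vK).
move: sL; rewrite -topredE /= => sL; case/splitPl: {lE us} sL ps => s1 s2 <-.
by rewrite cat_path => /andP[h _]; apply/connectP; exists s1.
Qed.

Definition nodal p : R :=
  if `[< Omega p >] then
    if [pick M | has_vertex Th p M] is Some M then aff (e M) p else 0
  else 0.

Lemma nodal_bdry p : bdry Omega p -> nodal p = 0.
Proof. by move=> /(bdry_not_omega hOmega) nO; rewrite /nodal asboolF. Qed.

Lemma nodal_bound p K : has_vertex Th p K ->
  `|aff (e K) p - nodal p| <= valence%:R * Num.sqrt (star_jump p).
Proof.
move=> vK; have S0 : 0 <= Num.sqrt (star_jump p) by exact: sqrtr_ge0.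
have cp : closure Omega p.
  apply/(mesh_cover hTh); exists K; case/existsP: vK => i /eqP <-.
  exact/tri_set_vertex/nd.
have [Op|bp] := closure_omega_or_bdry cp.
  rewrite /nodal asboolT //; case: pickP => [M vM|/(_ K)]; last by rewrite vK.
  have [k kN h] := connect_step vK (star_interior hOmega hTh Op vK vM).
  by apply: le_trans h _; rewrite ler_wpM2r // ler_nat ltnW.
(* At a boundary vertex the chain ends at a boundary edge; the final comparison with zero adds one
   step, so at most [valence] steps are used. *)
have [M [i [cM ip EN]]] := star_boundary hOmega hTh bp vK.
have [k kN h] := connect_step vK cM.
have vM := connect_has_vertex hTh vK cM.
rewrite nodal_bdry // subr0 -[aff (e K) p](subrK (aff (e M) p)).
apply: le_trans (ler_normD _ _) _.
apply: le_trans (lerD h (boundary_step vM ip EN)) _.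
by rewrite -[X in _ + X]mul1r -mulrDl natr1 ler_wpM2r // ler_nat.
Qed.

Definition nodal_interp K := interp (Th K) (fun i => nodal (Th K i)).

(** An inverse estimate: an affine function bounded by [b] at the vertices is bounded by [b] on the
    triangle, so its gradient is at most [b / r]. The factor [r ^+ 2] cancels against the area,
    which is at most [(4 * G * r) ^+ 2]. *)
Lemma grad_error K : area (Th K) * sqn ((e K).2 - (nodal_interp K).2) <=
  16 * G ^+ 2 * valence%:R ^+ 2 * \sum_i star_jump (Th K i).
Proof.
set S := \sum_i _; have S0 : 0 <= S by apply: sumr_ge0 => i _; exact: star_jump_ge0.
pose f : R * (R * R) := ((e K).1 - (nodal_interp K).1, (e K).2 - (nodal_interp K).2).
have fE x : aff f x = aff (e K) x - aff (nodal_interp K) x.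
  by rewrite /f /aff /dot /=; ring.
pose b := valence%:R * Num.sqrt S.
have fb i : `|aff f (Th K i)| <= b.
  rewrite fE aff_interp_vertex; last exact: nd.
  have vK : has_vertex Th (Th K i) K by apply/existsP; exists i.
  apply: le_trans (nodal_bound vK) _; rewrite ler_wpM2l // ler_sqrt //.
  by rewrite /S (bigD1 i) //= lerDl sumr_ge0 // => j _; exact: star_jump_ge0.
have fbT x : tri_set (Th K) x -> `|aff f x| <= b.
  move=> /(tri_setP (nd K)) Kx; rewrite (aff_bary f x (nd K)).
  apply: le_trans (ler_norm_sum _ _ _) _.
  have -> : b = \sum_i bary (Th K) i x * b by rewrite -mulr_suml bary_sum ?mul1r //; exact: nd.
  by apply: ler_sum => i _; rewrite normrM (ger0_norm (Kx i)) ler_wpM2l.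
have h := sqn_grad_disc (disc K) fbT.
have A := area_upper (nd K) (disc K).
apply: le_trans (ler_wpM2r (sqn_ge0 _) A) _.
have -> : (4 * G * rc K) ^+ 2 * sqn ((e K).2 - (nodal_interp K).2) =
   16 * G ^+ 2 * (rc K ^+ 2 * sqn f.2) by rewrite /f /=; ring.
rewrite -[leRHS]mulrA ler_wpM2l //; first by rewrite mulr_ge0 ?sqr_ge0.
by apply: le_trans h _; rewrite /b exprMn sqr_sqrtr.
Qed.

Lemma card_vertex p : \sum_K \sum_i ((Th K i == p)%:R : R) <= valence%:R.
Proof.
apply: (@le_trans _ _ (\sum_K (has_vertex Th p K)%:R)).
  apply: ler_sum => K _; case: (boolP (has_vertex Th p K)) => [/existsP[i /eqP ip]|nv]; last first.
    rewrite big1 // => i _; case: eqP => // ip.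
    by case/existsP: nv; exists i; exact/eqP.
  rewrite (bigD1 i) //= ip eqxx big1 ?addr0 // => j ji; case: eqP => // jp.
  have := bary_vertex (nd K) i j; rewrite jp -ip bary_vertex ?eqxx; last exact: nd.
  by rewrite eq_sym (negbTE ji) => /eqP; rewrite oner_eq0.
rewrite -natr_sum ler_nat; apply: leq_trans (valence_bound hTh disc p).
by rewrite -sum1_card [leqRHS]big_mkcond /=; apply: leq_sum => K _; rewrite inE; case: has_vertex.
Qed.

(** Double counting: [jump_sum M] occurs once for each vertex of a triangle [K] that is also a
    vertex of [M], and each of the three vertices of [M] belongs to at most [valence] triangles. *)
Lemma sum_star_jump : \sum_K \sum_i star_jump (Th K i) <= 3 * valence%:R * \sum_M jump_sum M.
Proof.
apply: (@le_trans _ _ (\sum_M jump_sum M * \sum_k \sum_K \sum_i (Th K i == Th M k)%:R)).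
  have -> : \sum_M jump_sum M * \sum_k \sum_K \sum_i (Th K i == Th M k)%:R =
      \sum_K \sum_i \sum_M jump_sum M * \sum_k (Th K i == Th M k)%:R.
    under [RHS]eq_bigr do rewrite exchange_big /=.
    rewrite [RHS]exchange_big /=; apply: eq_bigr => M _; rewrite mulr_sumr.
    under [RHS]eq_bigr do rewrite -mulr_sumr.
    rewrite -!mulr_sumr; congr (_ * _); rewrite exchange_big /=; apply: eq_bigr => K _.
    by rewrite exchange_big.
  apply: ler_sum => K _; apply: ler_sum => i _; rewrite /star_jump big_mkcond /=.
  apply: ler_sum => M _; case: ifP => [/existsP[k /eqP kE]|_].
    by rewrite ler_peMr ?jump_sum_ge0 // (bigD1 k) //= kE eqxx lerDl sumr_ge0.
  by rewrite mulr_ge0 ?jump_sum_ge0 // sumr_ge0.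
rewrite mulr_sumr; apply: ler_sum => M _; rewrite mulrC ler_wpM2r ?jump_sum_ge0 //.
rewrite sum_ord3; have := card_vertex (Th M 0); have := card_vertex (Th M 1).
have := card_vertex (Th M 2%:R); lra.
Qed.

Hypothesis orth : \sum_K area (Th K) * dot (nodal_interp K).2 (e K).2 = 0.

(** By orthogonality, subtracting the gradient of the interpolant cannot decrease the norm. The
    constant is the product of [16 * G ^+ 2 * valence%:R ^+ 2] from the gradient error,
    [3 * valence%:R] from the counting, and [2 * G] from turning a squared length into the weight of
    the estimator. *)
Lemma grad_le_jumps : \sum_K area (Th K) * sqn (e K).2 <=
  96 * G ^+ 3 * valence%:R ^+ 3 *
  \sum_K Num.sqrt (area (Th K)) * \sum_i len K i * sqn (grad_jump Th e K i).
Proof.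
have A0 K : 0 <= area (Th K) by exact/ltW/area_gt0/nd.
have D1 : \sum_K area (Th K) * sqn (e K).2 <=
    \sum_K area (Th K) * sqn ((e K).2 - (nodal_interp K).2).
  have -> : \sum_K area (Th K) * sqn ((e K).2 - (nodal_interp K).2) =
      \sum_K area (Th K) * sqn (e K).2 + \sum_K area (Th K) * sqn (nodal_interp K).2
      - 2 * \sum_K area (Th K) * dot (nodal_interp K).2 (e K).2.
    rewrite mulr_sumr -sumrN -!big_split /=; apply: eq_bigr => K _.
    by rewrite /sqn /dot !planeE; ring.
  rewrite orth mulr0 subr0 lerDl sumr_ge0 // => K _.
  by rewrite mulr_ge0 ?sqn_ge0.
apply: le_trans D1 _; apply: le_trans (ler_sum _ (fun K _ => grad_error K)) _.
rewrite -mulr_sumr.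
have c0 : 0 <= 16 * G ^+ 2 * valence%:R ^+ 2.
  exact: mulr_ge0 (mulr_ge0 (ler0n _ 16) (sqr_ge0 _)) (sqr_ge0 _).
apply: le_trans (ler_wpM2l c0 sum_star_jump) _.
have J : \sum_M jump_sum M <= 2 * G *
    \sum_K Num.sqrt (area (Th K)) * \sum_i len K i * sqn (grad_jump Th e K i).
  rewrite mulr_sumr; apply: ler_sum => K _; rewrite /jump_sum !mulr_sumr.
  apply: ler_sum => i _; have G0 := G_ge0 disc K.
  have l0 := len_ge0 Th K i.
  have h : len K i <= 2 * G * Num.sqrt (area (Th K)).
    apply: le_trans (len_le hTh disc K i) _; rewrite ler_wpM2l ?mulr_ge0 //.
    exact: (radius_le_sqrt_area hTh disc).
  have := ler_wpM2l (mulr_ge0 l0 (sqn_ge0 (grad_jump Th e K i))) h; lra.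
have c1 : 0 <= 16 * G ^+ 2 * valence%:R ^+ 2 * (3 * valence%:R).
  exact: mulr_ge0 c0 (mulr_ge0 (ler0n _ 3) (ler0n _ _)).
rewrite mulrA; apply: le_trans (ler_wpM2l c1 J) _.
by rewrite le_eqVlt; apply/orP; left; apply/eqP; ring.
Qed.

End GradientBound.

(** * Raviart-Thomas fields as test functions *)

Lemma Rintegral_sum d (T : measurableType d) (R : realType)
    (mu : {measure set T -> \bar R}) (D : set T) (I : finType) (h : I -> T -> R) :
  measurable D -> (forall k, mu.-integrable D (EFin \o h k)) ->
  Rintegral mu D (fun x => \sum_k h k x) = \sum_k Rintegral mu D (h k).
Proof.
move=> mD ih; rewrite /Rintegral.
under eq_integral do rewrite -sumEFin.
rewrite (integral_sum mD (f := fun k x => (h k x)%:E)) //.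
by rewrite sum_fine // => k _; exact: integrable_fin_num (ih k).
Qed.

Section NullLine.
Variable R : realType.
Notation plane := (measurableTypeR R * measurableTypeR R)%type.

Lemma measurable_bary_line (T : tri R) i :
  measurable ([set x | bary T i x = 0] : set plane).
Proof.
rewrite -[X in measurable X](setCK _); apply: measurableC.
apply: open_measurable_plane; apply: closed_openC.
apply: (@closed_comp _ _ (bary T i) [set 0]); last exact: closed_eq.
by move=> x _; exact: continuous_bary.
Qed.

Lemma leb2_bary_line (T : tri R) i : Defs.nondegenerate T ->
  leb2 R [set x | bary T i x = 0] = 0%E.
Proof.
move=> nT; set N := [set x | _].
have mN : measurable (N : set plane) by exact: measurable_bary_line.
rewrite -[N]setIT -integral_indic //.
(* With this choice [i = k + 1], so coordinate [i] becomes the first reference variable and the line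
   becomes the vertical axis. *)
pose k := i + 2%:R.
have ki : k + 1 = i by rewrite /k; elim/ord3_ind: (i); rewrite !ord3E.
have dE : tri_det T = (T (k + 1) - T k).1 * (T (k + 2%:R) - T k).2 -
     (T (k + 1) - T k).2 * (T (k + 2%:R) - T k).1 by rewrite -(tri_det_rot T k).
rewrite (ge0_integral_linear_plane (T k).1 (T k).2
    (a1 := (T (k + 1) - T k).1) (a2 := (T (k + 1) - T k).2)
    (b1 := (T (k + 2%:R) - T k).1) (b2 := (T (k + 2%:R) - T k).2)) -?dE //; last first.
  exact/measurable_EFinP/measurable_indic.
pose Z : set plane := [set 0] `*` setT.
rewrite (eq_integral (fun z => (\1_Z z)%:E)); last first.
  move=> z _; rewrite -/(ref_map T k z) !indicE; congr (_%:R%:E); congr nat_of_bool.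
  have bz : bary T i (ref_map T k z) = z.1.
    have [e1 e2 e3] := ord3_neq k.
    pose l : 'I_3 -> R := fun j => if j == k then 1 - z.1 - z.2 else if j == k + 1 then z.1 else z.2.
    have li : l k = 1 - z.1 - z.2 by rewrite /l eqxx.
    have li1 : l (k + 1) = z.1 by rewrite /l (negbTE e1) eqxx.
    have li2 : l (k + 2%:R) = z.2 by rewrite /l (negbTE e2) (negbTE e3).
    have l1 : \sum_j l j = 1 by rewrite (sum_ord3_rot _ k) li li1 li2; ring.
    have -> : ref_map T k z = \sum_j l j *: T j.
      by rewrite (sum_ord3_rot _ k) li li1 li2 ref_mapE.
    by rewrite bary_of_comb // -ki li1.
  apply/idP/idP; rewrite !inE /N /Z /= bz; last by case.
  by move=> ->.
rewrite integral_indic //; last by apply: measurableX.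
rewrite setIT.
have -> : leb2 R Z = (lebesgue_measure [set 0%R : R] * lebesgue_measure [set: R])%E.
  by apply: product_measure1E.
by rewrite lebesgue_measure_set1 mul0e mule0.
Qed.

Lemma Rintegral_null (N : set (R * R)) (f : R * R -> R) :
  measurable (N : set plane) -> continuous f -> leb2 R N = 0%E ->
  Rintegral (leb2 R) N f = 0.
Proof.
move=> mN cf N0; rewrite /Rintegral null_set_integral //.
apply/measurable_EFinP/measurable_funTS; exact: continuous_measurable_plane.
Qed.

Lemma area_int_real (D : set (R * R)) (f : R * R -> R) :
  area_int D (fun x => (f x)%:C) = (Rintegral (leb2 R) D f)%:C.
Proof. 
rewrite /area_int /cintegral /=; congr Complex.
by rewrite /Rintegral integral0. Qed.

End NullLine.

Lemma realCM (R : realType) (a b : R) : a%:C * b%:C = (a * b)%:C :> R[i].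
Proof. by rewrite rmorphM. Qed.

Lemma realCD (R : realType) (a b : R) : a%:C + b%:C = (a + b)%:C :> R[i].
Proof. by rewrite rmorphD. Qed.

Definition edge_mean (R : realType) (T : tri R) i (phi : R * R -> R) : R :=
  Rintegral (@lebesgue_measure R) `[0, 1]%classic (fun t => phi (edge_point T i t)).

Lemma continuous_edge_point (R : realType) (T : tri R) i : continuous (edge_point T i).
Proof.
move=> t; apply: cvgD; apply: cvgZr_tmp; last exact: cvg_id.
by apply: cvgB; [exact: cvg_cst | exact: cvg_id].
Qed.

Lemma edge_integrable (R : realType) (T : tri R) i (f : R * R -> R) : continuous f ->
  (@lebesgue_measure R).-integrable `[0, 1]%classic (EFin \o (fun t => f (edge_point T i t))).
Proof.
move=> cf; apply: continuous_compact_integrable; first exact: segment_compact.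
apply: continuous_subspaceT => t.
by apply: continuous_comp; [exact: continuous_edge_point | exact: cf].
Qed.

Lemma edge_meanZ (R : realType) (T : tri R) i (k : R) (f : R * R -> R) : continuous f ->
  edge_mean T i (fun x => k * f x) = k * edge_mean T i f.
Proof.
move=> cf; rewrite /edge_mean; apply: (@RintegralZl _ _ R (@lebesgue_measure R) `[0, 1]%classic
  (fun t => f (edge_point T i t)) k) => //; exact: edge_integrable.
Qed.

Lemma edge_int_real (R : realType) (T : tri R) i (f : R * R -> R) :
  edge_int T i (fun x => (f x)%:C) = (edge_length T i * edge_mean T i f)%:C.
Proof.
rewrite /edge_int -realCM; congr (_ * _); rewrite /cintegral /=; congr Complex.
by rewrite /Rintegral integral0.
Qed.

Lemma edge_length_neq0 (R : realType) (T : tri R) i : Defs.nondegenerate T ->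
  edge_length T i != 0.
Proof.
move=> nT; apply: contra_neq (tri_det_neq0 nT) => /eqP.
rewrite sqrtr_eq0 le_eqVlt ltNge addr_ge0 ?sqr_ge0 // orbF paddr_eq0 ?sqr_ge0 //.
rewrite !sqrf_eq0 !subr_eq0 => /andP[/eqP h1 /eqP h2].
by rewrite -(tri_det_rot T i) /cross !planeE h1 h2; ring.
Qed.

Section RaviartThomas.
Variables (R : realType) (Omega : set (R * R)) (n : nat) (Th : mesh R n).
Hypothesis hOmega : bounded_polygonal_domain Omega.
Hypothesis hTh : conforming_triangulation Omega Th.
Implicit Types (K L M : 'I_n) (i j : 'I_3) (x y p : R * R) (phi : R * R -> R).
Local Notation nd := (mesh_nondegenerate hTh).
Local Notation plane := (measurableTypeR R * measurableTypeR R)%type.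
Local Notation leb := (@lebesgue_measure R).

(** Values add up where triangles overlap. This is a null set, and no owner of an edge has to be
    chosen. *)
Definition pw (g : 'I_n -> R * R -> R) x : R := \sum_M (g M \_ (tri_set (Th M))) x.

Let mtri M : measurable (tri_set (Th M) : set plane).
Proof. exact: measurable_tri_set (nd M). Qed.

Lemma measurable_omega : measurable (Omega : set plane).
Proof. by apply: open_measurable_plane; case: hOmega. Qed.

Lemma bounded_omega : bounded_set Omega. Proof. by case: hOmega. Qed.

Lemma pw_integrable g (D : set (R * R)) M : measurable (D : set plane) ->
  continuous (g M) -> (leb2 R).-integrable D (EFin \o (g M \_ (tri_set (Th M)))).
Proof.
move=> mD cg; rewrite -restrict_EFin; apply/integrable_restrict => //.
apply: continuous_integrable_plane => //; first exact: measurableI.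
case: (@bounded_tri_set R (Th M)) => N [Nr h]; exists N; split=> // b bN x [_ Tx].
exact: (h b bN x Tx).
Qed.

Lemma Rintegral_pw g (D : set (R * R)) : measurable (D : set plane) ->
  (forall M, continuous (g M)) ->
  Rintegral (leb2 R) D (pw g) = \sum_M Rintegral (leb2 R) (D `&` tri_set (Th M)) (g M).
Proof.
move=> mD cg; rewrite /pw Rintegral_sum //; last first.
  by move=> M; exact: pw_integrable.
by apply: eq_bigr => M _; rewrite Rintegral_mkcondr.
Qed.

Lemma tri_inter_null K L : K != L -> leb2 R (tri_set (Th K) `&` tri_set (Th L)) = 0%E.
Proof.
move=> /(mesh_inter hTh)[i h]; apply: (subset_measure0 _ _ _ (leb2_bary_line i (nd K))).
- exact: measurableI.
- exact: measurable_bary_line.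
- by move=> x [Kx Lx]; exact: h.
Qed.

Lemma Rintegral_pw_tri g K : (forall M, continuous (g M)) ->
  Rintegral (leb2 R) (tri_set (Th K)) (pw g) = Rintegral (leb2 R) (tri_set (Th K)) (g K).
Proof.
move=> cg; rewrite Rintegral_pw // (bigD1 K) //= setIid big1 ?addr0 // => M MK.
apply: Rintegral_null => //; first exact: measurableI.
by apply: tri_inter_null; rewrite eq_sym.
Qed.

Lemma pw_in_L2 g : (forall M, continuous (g M)) -> in_L2 Omega (fun x => (pw g x)%:C).
Proof.
move=> cg; have mpw : measurable_fun [set: plane] (pw g : plane -> measurableTypeR R).
  apply: measurable_sum => M; apply/(measurable_restrictT _ (mtri M)).
  by apply: measurable_funTS; exact: continuous_measurable_plane.
have /boolp.choice[B hB] : forall M, exists B : R, 0 <= B /\ forall x, `|(g M \_ (tri_set (Th M))) x| <= B.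
  move=> M; have [N N0 hN] := bounded_plane_box (@bounded_tri_set R (Th M)).
  have [B B0 hB] := continuous_bounded_box N (cg M).
  exists B; split=> // x; rewrite patchE; case: ifPn => [|_]; last by rewrite normr0.
  by rewrite inE => /hN[x1 x2]; exact: hB.
split; [exact: mpw | exact: measurable_cst |].
have ipw : (leb2 R).-integrable Omega (EFin \o (fun x => pw g x ^+ 2)).
  apply: measurable_bounded_integrable; first exact: measurable_omega.
  - exact: leb2_bounded_lty measurable_omega bounded_omega.
  - by apply: measurable_funTS; exact: measurable_funX.
  exists ((\sum_M B M) ^+ 2); split=> [|b hb x Ox]; first exact: num_real.
  apply: le_trans (ltW hb); rewrite normrX ler_sqr ?nnegrE ?normr_ge0 ?sumr_ge0 //.
    by apply: le_trans (ler_norm_sum _ _ _) _; apply: ler_sum => M _; exact: (hB M).2.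
  by move=> M _; exact: (hB M).1.
case/integrableP: ipw => _; apply: le_lt_trans; rewrite le_eqVlt; apply/orP; left; apply/eqP.
apply: eq_integral => x _ /=; rewrite /sqmod /= expr0n addr0 ger0_norm //; exact: sqr_ge0.
Qed.

Variable c : 'I_n -> 'I_3 -> R.

(** First component of the Raviart-Thomas field on [M] with total outward flux [c M i] through edge
    [i]. *)
Definition rt_x M x : R := \sum_i c M i / `|tri_det (Th M)| * (x.1 - (Th M i).1).
Definition rt_y M x : R := \sum_i c M i / `|tri_det (Th M)| * (x.2 - (Th M i).2).
Definition rt_div M (_ : R * R) : R := \sum_i c M i / `|tri_det (Th M)| * 2.

Lemma continuous_sum3 (f : 'I_3 -> R * R -> R) : (forall i, continuous (f i)) ->
  continuous (fun x => \sum_i f i x).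
Proof.
move=> cf x; under eq_fun do rewrite sum_ord3.
by apply: cvgD; [apply: cvgD|]; exact: cf.
Qed.

Lemma continuous_rt_x M : continuous (rt_x M).
Proof.
apply: continuous_sum3 => i x; apply: cvgM; first exact: cvg_cst.
by apply: cvgB; [exact: cvg_fst | exact: cvg_cst].
Qed.

Lemma continuous_rt_y M : continuous (rt_y M).
Proof.
apply: continuous_sum3 => i x; apply: cvgM; first exact: cvg_cst.
by apply: cvgB; [exact: cvg_snd | exact: cvg_cst].
Qed.

Lemma continuous_rt_div M : continuous (rt_div M).
Proof. by move=> x; exact: cvg_cst. Qed.

Lemma smooth_continuous phi : smooth phi -> continuous phi.
Proof. by move=> s x; exact: differentiable_continuous (s [::] x). Qed.

Lemma smooth_pd_continuous phi v : smooth phi -> continuous (pd v phi).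
Proof. by move=> s x; exact: differentiable_continuous (s [:: v] x). Qed.

Lemma continuous_mul (f g : R * R -> R) : continuous f -> continuous g ->
  continuous (fun x => f x * g x).
Proof. by move=> cf cg x; apply: cvgM; [exact: cf | exact: cg]. Qed.

Lemma green_rt M phi : smooth phi ->
  Rintegral (leb2 R) (tri_set (Th M)) (fun x => rt_x M x * pd (1, 0) phi x +
     rt_y M x * pd (0, 1) phi x + rt_div M x * phi x) =
  \sum_i c M i * edge_mean (Th M) i phi.
Proof.
move=> sp; have d0 : `|tri_det (Th M)| != 0 by rewrite normr_eq0; exact: nd.
pose h i x := (x.1 - (Th M i).1) * pd (1, 0) phi x +
     (x.2 - (Th M i).2) * pd (0, 1) phi x + 2 * phi x.
have ch i : continuous (h i).
  move=> x; apply: cvgD; last by apply: cvgM; [exact: cvg_cst | exact: smooth_continuous].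
  apply: cvgD.
    by apply: cvgM; [apply: cvgB; [exact: cvg_fst | exact: cvg_cst] | exact: smooth_pd_continuous].
  by apply: cvgM; [apply: cvgB; [exact: cvg_snd | exact: cvg_cst] | exact: smooth_pd_continuous].
have bT := @bounded_tri_set R (Th M).
rewrite (_ : (fun x => _) = fun x => \sum_i c M i / `|tri_det (Th M)| * h i x); last first.
  apply/funext => x; rewrite /rt_x /rt_y /rt_div !mulr_suml -!big_split /=.
  by apply: eq_bigr => i _; rewrite /h; ring.
transitivity (\sum_i Rintegral (leb2 R) (tri_set (Th M))
    (fun x => c M i / `|tri_det (Th M)| * h i x)).
  apply: Rintegral_sum => // i; apply: continuous_integrable_plane => // x.
  by apply: cvgM; [exact: cvg_cst | exact: ch].
apply: eq_bigr => i _; rewrite RintegralZl //; last exact: continuous_integrable_plane.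
rewrite green_vertex; first by rewrite mulrA divfK.
- exact: nd.
- by move=> x; exact: (sp [::] x).
- exact: smooth_pd_continuous.
- exact: smooth_pd_continuous.
Qed.

Definition rt_field x : R[i] * R[i] := ((pw rt_x x)%:C, (pw rt_y x)%:C).
Definition rt_field_div x : R[i] := (pw rt_div x)%:C.

Lemma pw_mulr g phi x : pw g x * phi x = pw (fun M x => g M x * phi x) x.
Proof.
rewrite /pw mulr_suml; apply: eq_bigr => M _; rewrite !patchE.
by case: ifP; rewrite ?mul0r.
Qed.

Lemma pw_add g h x : pw g x + pw h x = pw (fun M x => g M x + h M x) x.
Proof.
rewrite /pw -big_split /=; apply: eq_bigr => M _; rewrite !patchE.
by case: ifP; rewrite ?addr0.
Qed.

Lemma rt_normal_trace K : normal_trace (Th K) rt_field rt_field_div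
  (fun i => (c K i / edge_length (Th K) i)%:C).
Proof.
move=> phi sp.
rewrite (_ : (fun x => (rt_field x).1 * _ + _ + _) = fun x => (pw (fun M x => rt_x M x * pd (1, 0) phi x +
    rt_y M x * pd (0, 1) phi x + rt_div M x * phi x) x)%:C); last first.
  by apply/funext => x; rewrite /rt_field /rt_field_div /= !realCM !realCD !pw_mulr !pw_add.
rewrite area_int_real Rintegral_pw_tri; last first.
  move=> M x; apply: cvgD; [apply: cvgD|]; apply: continuous_mul.
  - exact: continuous_rt_x.
  - exact: smooth_pd_continuous.
  - exact: continuous_rt_y.
  - exact: smooth_pd_continuous.
  - exact: continuous_rt_div.
  - exact: smooth_continuous.
rewrite green_rt // rmorph_sum /=; apply: eq_bigr => i _.
rewrite (_ : (fun x => _) = fun x => (c K i / edge_length (Th K) i * phi x)%:C); last first.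
  by apply/funext => x; rewrite realCM.
rewrite edge_int_real edge_meanZ; last exact: smooth_continuous.
rewrite mulrA mulrCA mulfV ?mulr1 //.
by apply: edge_length_neq0; exact: nd.
Qed.

Lemma test_pd_out phi v x : test_function Omega phi -> ~ Omega x -> pd v phi x = 0.
Proof.
move=> [_ _ sub] nO.
have nx : \forall y \near x, phi y = 0.
  have : nbhs x (~` closure [set x | phi x != 0]).
    apply: open_nbhs_nbhs; split; first exact/closed_openC/closed_closure.
    by move=> /sub.
  apply: filterS => y ny; apply/eqP/negPn/negP => p0; apply: ny; exact: subset_closure.
by rewrite /pd (near_eq_derive v (g := cst 0) nx) derive_cst.
Qed.

Lemma test_out phi x : test_function Omega phi -> ~ Omega x -> phi x = 0.
Proof.
move=> [_ _ sub] nO; apply/eqP/negPn/negP => p0; apply: nO; apply: sub.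
exact: subset_closure.
Qed.

Hypothesis balance : forall phi, test_function Omega phi ->
  \sum_M \sum_i c M i * edge_mean (Th M) i phi = 0.

(** Summing Green's formula over the triangles leaves only the edge terms, which [balance] makes
    cancel; the elementwise divergence is therefore the weak divergence. *)
Lemma rt_in_P0_skel :
  in_P0_skel Omega Th (fun M i => (c M i / edge_length (Th M) i)%:C).
Proof.
exists rt_field, rt_field_div; split; last exact: rt_normal_trace.
split; [exact/pw_in_L2/continuous_rt_x | exact/pw_in_L2/continuous_rt_y |
  exact/pw_in_L2/continuous_rt_div |].
move=> phi tphi; have [sphi _ _] := tphi.
pose g1 M x := rt_x M x * pd (1, 0) phi x + rt_y M x * pd (0, 1) phi x.
pose g2 M x := rt_div M x * phi x.
have cg1 M : continuous (g1 M).
  move=> x; apply: cvgD; apply: continuous_mul.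
  - exact: continuous_rt_x.
  - exact: smooth_pd_continuous.
  - exact: continuous_rt_y.
  - exact: smooth_pd_continuous.
have cg2 M : continuous (g2 M).
  by apply: continuous_mul; [exact: continuous_rt_div | exact: smooth_continuous].
rewrite [X in area_int _ X = _](_ : _ = fun x => (pw g1 x)%:C); last first.
  by apply/funext => x; rewrite /rt_field /= !realCM !realCD !pw_mulr !pw_add.
rewrite [X in _ = - area_int _ X](_ : _ = fun x => (pw g2 x)%:C); last first.
  by apply/funext => x; rewrite /rt_field_div /= !realCM !pw_mulr.
rewrite !area_int_real -rmorphN; congr (_%:C).
have mO := measurable_omega.
rewrite !Rintegral_pw //; apply/eqP; rewrite -addr_eq0 -big_split /=; apply/eqP.
rewrite -[RHS](balance tphi); apply: eq_bigr => M _.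
have out (g : R * R -> R) : (forall x, ~ Omega x -> g x = 0) ->
    Rintegral (leb2 R) (Omega `&` tri_set (Th M)) g = Rintegral (leb2 R) (tri_set (Th M)) g.
  move=> g0; rewrite Rintegral_mkcondl; congr Rintegral; apply/funext => x.
  by rewrite patchE; case: ifPn => //; rewrite notin_setE => /g0.
have bT := @bounded_tri_set R (Th M).
rewrite !out; last 2 first.
- by move=> x nO; rewrite /g2 (test_out tphi nO) mulr0.
- by move=> x nO; rewrite /g1 !(test_pd_out _ tphi nO) !mulr0 addr0.
rewrite -(green_rt M sphi).
by rewrite -(RintegralD (mtri M) (continuous_integrable_plane (mtri M) bT (cg1 M))
  (continuous_integrable_plane (mtri M) bT (cg2 M))).
Qed.

End RaviartThomas.

(** * Conforming interpolants and piecewise affine data *)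

Section ConformingInterpolant.
Variables (R : realType) (Omega : set (R * R)) (n : nat) (Th : mesh R n).
Hypothesis hOmega : bounded_polygonal_domain Omega.
Hypothesis hTh : conforming_triangulation Omega Th.
Implicit Types (K L M : 'I_n) (i j : 'I_3) (x y p : R * R).
Local Notation nd := (mesh_nondegenerate hTh).

Lemma continuous_aff (f : R * (R * R)) : continuous (aff f).
Proof.
have -> : aff f = fun x => f.1 + f.2.1 * x.1 + f.2.2 * x.2.
  by apply/funext => x; rewrite /aff /dot addrA.
exact: continuous_affine_plane.
Qed.

Variable z : R * R -> R.
Hypothesis z_bdry : forall x, bdry Omega x -> z x = 0.

Definition mesh_interp K := interp (Th K) (fun i => z (Th K i)).

Lemma mesh_interp_vertex K i : aff (mesh_interp K) (Th K i) = z (Th K i).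
Proof. by rewrite aff_interp_vertex //; exact: nd. Qed.

Lemma mesh_interp_agree K L x : tri_set (Th K) x -> tri_set (Th L) x ->
  aff (mesh_interp K) x = aff (mesh_interp L) x.
Proof.
move=> Kx Lx; have [->//|KL] := eqVneq K L.
case: hTh => _ _ /(_ _ _ KL)[E|[i [j [Eij E]]]|[i [j [Eij E]]]].
- by have : set0 x by rewrite -E.
- have -> : x = Th K i by have : [set Th K i] x by rewrite -E.
  by rewrite mesh_interp_vertex Eij mesh_interp_vertex.
have [t _ <-] : edge (Th K) i x by rewrite -E.
rewrite !aff_convex !mesh_interp_vertex.
by case: (edge_endpoints Eij) => -[-> ->]; rewrite !mesh_interp_vertex.
Qed.

Definition glued x : R :=
  if [pick K | `[< tri_set (Th K) x >]] is Some K then aff (mesh_interp K) x else 0.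

Lemma gluedE K x : tri_set (Th K) x -> glued x = aff (mesh_interp K) x.
Proof.
move=> Kx; rewrite /glued; case: pickP => [L /asboolP Lx|/(_ K)/asboolP //].
exact: mesh_interp_agree.
Qed.

(** A function continuous on each of finitely many closed sets is continuous on their union, by
    induction on the list of triangles. *)
Lemma glued_continuous : {within closure Omega, continuous glued}.
Proof.
have -> : closure Omega = [set x | exists2 K, K \in enum 'I_n & tri_set (Th K) x].
  apply/seteqP; split=> x; first by move=> /(mesh_cover hTh)[K Kx]; exists K => //; rewrite mem_enum.
  by case=> K _ Kx; apply/(mesh_cover hTh); exists K.
suff h (s : seq 'I_n) : closed [set x | exists2 K, K \in s & tri_set (Th K) x] /\
    {within [set x | exists2 K, K \in s & tri_set (Th K) x], continuous glued}.
  by case: (h (enum 'I_n)).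
elim: s => [|K s [cls IH]].
  have -> : [set x | exists2 K, K \in [::] & tri_set (Th K) x] = set0.
    by apply/seteqP; split=> x // -[].
  by split; [exact: closed0 | exact: continuous_subspace0].
have -> : [set x | exists2 M, M \in K :: s & tri_set (Th M) x] =
    tri_set (Th K) `|` [set x | exists2 M, M \in s & tri_set (Th M) x].
  apply/seteqP; split=> x.
    by case=> M; rewrite inE => /predU1P[->|Ms] Mx; [left | right; exists M].
  by case=> [Kx|[M Ms Mx]]; [exists K; rewrite ?mem_head | exists M; rewrite // inE Ms orbT].
have clK : closed (tri_set (Th K)) by exact: closed_tri_set (nd K).
split; first exact: closedU.
apply: withinU_continuous => //.
apply: (@subspace_eq_continuous _ _ _ (aff (mesh_interp K))).
  by move=> x /set_mem Kx; exact/esym/gluedE.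
by apply: continuous_subspaceT; exact: continuous_aff.
Qed.

(** A boundary point lies on an edge of its triangle, and every vertex with nonzero weight there
    turns out to be a boundary point. *)
Lemma glued_bdry x : bdry Omega x -> glued x = 0.
Proof.
move=> bx; have nO := bdry_not_omega hOmega bx.
have [K Kx] := proj1 (mesh_cover hTh x) bx.1.
have Kx0 := proj1 (tri_setP (nd K) x) Kx.
rewrite (gluedE Kx) aff_interp big1 // => k _.
have [->|kx] := eqVneq (bary (Th K) k x) 0; first by rewrite mulr0.
suff -> : z (Th K k) = 0 by rewrite mul0r.
have [i ix] : exists i, bary (Th K) i x = 0.
  apply: contrapT => /forallNP h; apply: nO; apply: (tri_interior_omega hOmega hTh (M := K)) => i.
  by rewrite lt_neqAle Kx0 andbT eq_sym; apply/eqP; exact: h.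
have ki : k != i by apply: contraNneq kx => ->; exact/eqP.
(* With a second vanishing coordinate [x] is the vertex [k] itself. Otherwise [x] is strictly inside
   edge [i], where a neighbour would place it in the open domain. *)
have [[j [ji jk jx]]|nj] := pselect (exists j, [/\ j != i, j != k & bary (Th K) j x = 0]).
  suff -> : Th K k = x by exact: z_bdry.
  apply/esym; apply: (only_vertex hTh (M := K)); first by apply/existsP; exists k.
  move=> l lk; have {}lk : l != k by apply: contraNneq lk => ->.
  have [->//|li] := eqVneq l i; have [->//|lj] := eqVneq l j.
  suff : false by [].
  move: ki ji jk lk li lj; clear; move: i j k l; by do 4!(apply: ord3_ind).
have pos k' : k' != i -> 0 < bary (Th K) k' x.
  move=> k'i; rewrite lt_neqAle Kx0 andbT eq_sym; apply/eqP => k'0.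
  have [k'k|k'k] := eqVneq k' k; first by rewrite -k'k k'0 eqxx in kx.
  by apply: nj; exists k'.
case EN : (neighbour Th K i) => [L|].
  have [KL [j E]] := neighbour_some EN.
  by case: nO; exact: (edge_interior_omega hOmega hTh KL E ix pos).
apply: z_bdry; apply: (edge_boundary hOmega hTh EN).
by apply: edge_vertex => //; exact: nd.
Qed.

Lemma interp_in_S10 : in_S10 Omega Th (fun K x => (aff (mesh_interp K) x)%:C).
Proof.
split.
  move=> K; exists (mesh_interp K).1%:C, (mesh_interp K).2.1%:C, (mesh_interp K).2.2%:C => x.
  by rewrite !realCM !realCD /aff /dot addrA.
exists (fun x => (glued x)%:C); split => /=.
- exact: glued_continuous.
- by apply: continuous_subspaceT => x; exact: cvg_cst.
- by move=> K x Kx; rewrite (gluedE Kx).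
- by move=> x bx; rewrite glued_bdry.
Qed.

End ConformingInterpolant.

(** * The forms and norms evaluated on piecewise affine functions *)

Section AffineValues.
Variable R : realType.
Implicit Types (f g : R * (R * R)) (T : tri R).

Lemma pd_aff f v x : pd v (aff f) x = dot f.2 v.
Proof.
rewrite /pd /derive.
have -> : (fun h : R => h^-1 *: ((aff f \o shift x) (h *: v) - aff f x)) =
    (fun h => h^-1 * h * dot f.2 v).
  by apply/funext => h /=; rewrite aff_sub addrK /dot !planeE /GRing.scale /=; ring.
apply/cvg_lim => //; apply: cvg_near_cst; near=> h.
by rewrite mulVf ?mul1r //; near: h; exact: nbhs_dnbhs_neq.
Unshelve. all: by end_near. Qed.

(** The midpoint rule is exact for affine functions; this is why midpoint values stand for edge
    means throughout. *)
Lemma edge_mean_aff T i f : edge_mean T i (aff f) = aff f (edge_mid T i).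
Proof.
rewrite /edge_mean /edge_point /edge_mid.
have -> : (fun t : R => aff f ((1 - t) *: T (i + 1) + t *: T (i + 2%:R))) =
    (fun t => aff f (T (i + 1)) + t * (aff f (T (i + 2%:R)) - aff f (T (i + 1)))).
  by apply/funext => t; rewrite aff_convex; ring.
set a := aff f _; set b := _ - a.
have dF (t : R) : is_derive t 1 (fun t : R => a * t + b / 2 * t ^+ 2) (a + t * b).
  by apply: is_derive_eq; rewrite /GRing.scale /=; field.
have cF : continuous (fun t : R => a * t + b / 2 * t ^+ 2).
  by move=> t; apply: differentiable_continuous; apply/derivable1_diffP; case: (dF t).
rewrite /Rintegral (@continuous_FTC2 _ _ (fun t : R => a * t + b / 2 * t ^+ 2)) ?ltr01 //=.
- by rewrite aff_convex /b /a; field.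
- apply: continuous_subspaceT => t; apply: cvgD; first exact: cvg_cst.
  by apply: cvgM; [exact: cvg_id | exact: cvg_cst].
- split=> [t _||]; first by case: (dF t).
    by apply: cvg_at_right_filter; exact: cF.
  by apply: cvg_at_left_filter; exact: cF.
- by move=> t _; rewrite derive1E; case: (dF t).
Qed.

Lemma complex_sum (I : finType) (a b : I -> R) :
  \sum_k (a k +i* b k) = (\sum_k a k) +i* (\sum_k b k) :> R[i].
Proof. by elim/big_rec3: _ => // k u v w _ ->. Qed.

Lemma affine_parts (v : R * R -> R[i]) : affine v ->
  exists fr fi : R * (R * R), v = fun x => aff fr x +i* aff fi x.
Proof.
move=> [[ar ai] [[br bi] [[cr ci] vE]]].
exists (ar, (br, cr)), (ai, (bi, ci)); apply/funext => x; rewrite vE /aff /dot /=.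
by congr Complex; ring.
Qed.

Lemma cgrad_aff (fr fi : R * (R * R)) (x : R * R) : cgrad (fun x => aff fr x +i* aff fi x) x =
  (fr.2.1 +i* fi.2.1, fr.2.2 +i* fi.2.2).
Proof.
rewrite /cgrad /cpd /=; congr pair; congr Complex;
  by rewrite (pd_aff _ _ x) /dot /=; ring.
Qed.

Lemma area_int_cst T (a b : R) : Defs.nondegenerate T ->
  area_int (tri_set T) (fun=> a +i* b) = (area T * a) +i* (area T * b).
Proof.
move=> nT; rewrite /area_int /cintegral /= !(Rintegral_cst _ (measurable_tri_set nT)).
by rewrite /area !(mulrC _ (fine _)).
Qed.

Lemma edge_int_complex T i (p q : R * R -> R) : edge_int T i (fun x => p x +i* q x) =
  (edge_length T i * edge_mean T i p) +i* (edge_length T i * edge_mean T i q).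
Proof.
by rewrite /edge_int /cintegral /=; congr Complex; rewrite mul0r ?subr0 ?addr0.
Qed.

Section Broken.
Variables (Omega : set (R * R)) (n : nat) (Th : mesh R n).
Hypothesis hTh : conforming_triangulation Omega Th.
Variables (er ei : 'I_n -> R * (R * R)).
Local Notation nd := (mesh_nondegenerate hTh).

Definition cbroken : broken R n := fun K x => aff (er K) x +i* aff (ei K) x.

(** Against a real function the form separates into the real and, by conjugation with a minus sign,
    the imaginary part of the second argument. *)
Lemma ip_grad_real (f : 'I_n -> R * (R * R)) :
  ip_grad Th (fun K x => (aff (f K) x)%:C) cbroken =
  (\sum_K area (Th K) * dot (f K).2 (er K).2) +i*
  (- \sum_K area (Th K) * dot (f K).2 (ei K).2).
Proof.
rewrite -sumrN -complex_sum; apply: eq_bigr => K _.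
have z0 x : aff (0, (0, 0)) x = 0 :> R by rewrite /aff /dot /= !mul0r !addr0.
rewrite (_ : (fun x => (aff (f K) x)%:C) = fun x => aff (f K) x +i* aff (0, (0, 0)) x); last first.
  by apply/funext => x; rewrite z0.
rewrite (_ : (fun x => _) = fun=> dot (f K).2 (er K).2 +i* - dot (f K).2 (ei K).2); last first.
  apply/funext => x; rewrite /cbroken !cgrad_aff /cdot /dot /=.
  by congr Complex; ring.
by rewrite area_int_cst ?mulrN //; exact: nd.
Qed.

Lemma dual_skel_real (c : 'I_n -> 'I_3 -> R) :
  dual_skel Th (fun M i => (c M i / edge_length (Th M) i)%:C) cbroken =
  (\sum_M \sum_i c M i * midvalue Th er M i) +i*
  (- \sum_M \sum_i c M i * midvalue Th ei M i).
Proof.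
rewrite -sumrN -complex_sum; apply: eq_bigr => M _.
rewrite -sumrN -complex_sum; apply: eq_bigr => i _.
set k := c M i / edge_length (Th M) i.
rewrite (_ : (fun x => _) = fun x => (k * aff (er M) x) +i* ((- k) * aff (ei M) x)); last first.
  by apply/funext => x; rewrite /cbroken /=; congr Complex; ring.
rewrite edge_int_complex !edge_meanZ; try exact: continuous_aff.
rewrite !edge_mean_aff /midvalue /k.
have l0 := edge_length_neq0 i (nd M).
by congr Complex; field.
Qed.

Lemma sqnorm_jump_real K i : sqnorm_jump Th cbroken K i =
  edge_length (Th K) i * (sqn (grad_jump Th er K i) + sqn (grad_jump Th ei K i)).
Proof.
rewrite /sqnorm_jump; congr (_ * _).
rewrite (_ : (fun t => _) = fun=> sqn (grad_jump Th er K i) + sqn (grad_jump Th ei K i)); last first.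
  apply/funext => t; rewrite /jump_grad /grad_jump; case: neighbour => [L|];
    rewrite /cbroken !cgrad_aff /sqmod2 /sqmod /sqn /dot /=; ring.
rewrite Rintegral_cst // (_ : fine (lebesgue_measure _) = 1) ?mulr1 //.
by rewrite (@lebesgue_measure_itv R `[0, 1]) /= lte_fin ltr01 /= ?sube0 ?oppr0 ?adde0 ?addr0 ?subr0.
Qed.

Lemma grad_norm_real K :
  Rintegral (leb2 R) (tri_set (Th K)) (fun x => sqmod2 (cgrad (cbroken K) x)) =
  area (Th K) * (sqn (er K).2 + sqn (ei K).2).
Proof.
rewrite (_ : (fun x => _) = fun=> sqn (er K).2 + sqn (ei K).2); last first.
  by apply/funext => x; rewrite /cbroken cgrad_aff /sqmod2 /sqmod /sqn /dot /=; ring.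
by rewrite (Rintegral_cst _ (measurable_tri_set (nd K))) mulrC.
Qed.

Lemma sq_norm_le K (b : R) :
  (forall x, tri_set (Th K) x -> aff (er K) x ^+ 2 + aff (ei K) x ^+ 2 <= b) ->
  Rintegral (leb2 R) (tri_set (Th K)) (fun x => sqmod (cbroken K x)) <= area (Th K) * b.
Proof.
move=> hb; have mT := measurable_tri_set (nd K); have bT := @bounded_tri_set R (Th K).
have cc : continuous (fun x => sqmod (cbroken K x)).
  by move=> x; apply: cvgD; apply: continuous_mul; exact: continuous_aff.
have := @le_Rintegral _ _ R (leb2 R) (tri_set (Th K)) (fun x => sqmod (cbroken K x)) (fun=> b) mT
  (continuous_integrable_plane mT bT cc).
rewrite (Rintegral_cst _ mT) (mulrC b); apply => //.
by apply: continuous_integrable_plane => // x; exact: cvg_cst.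
Qed.

End Broken.

End AffineValues.

(** * The equivalence *)

Section SecondEquation.
Variables (R : realType) (Omega : set (R * R)) (n : nat) (Th : mesh R n).
Hypothesis hOmega : bounded_polygonal_domain Omega.
Hypothesis hTh : conforming_triangulation Omega Th.
Implicit Types (K L M : 'I_n) (i j : 'I_3) (x y p : R * R).
Local Notation nd := (mesh_nondegenerate hTh).

(** The two triangles may run through the edge in opposite directions; the mean is invariant under
    [t] to [1 - t]. *)
Lemma edge_mean_eq K i L j (phi : R * R -> R) : continuous phi ->
  edge (Th L) j = edge (Th K) i -> edge_mean (Th L) j phi = edge_mean (Th K) i phi.
Proof.
move=> cphi E; rewrite /edge_mean; case: (edge_endpoints E) => -[E1 E2].
  by congr Rintegral; apply/funext => t; rewrite /edge_point E1 E2.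
transitivity (Rintegral (@lebesgue_measure R) `[(1 - 1)%R, 1%R]%classic
    (fun t => phi (edge_point (Th K) i (1 - t)))); last first.
  apply/esym/(Rintegration_by_substitution_onem (G := fun t => phi (edge_point (Th K) i t))).
    by rewrite lexx ler01.
  apply: continuous_subspaceT => t; apply: continuous_comp; last exact: cphi.
  exact: continuous_edge_point.
rewrite subrr; congr Rintegral; apply/funext => t.
by rewrite /edge_point E1 E2 subKr addrC.
Qed.

Lemma edge_mean_boundary K i phi : test_function Omega phi -> neighbour Th K i = None ->
  edge_mean (Th K) i phi = 0.
Proof.
move=> tphi EN; rewrite /edge_mean /Rintegral integral0_eq // => t t01; congr (_%:E).
apply: (test_out tphi); apply: (bdry_not_omega hOmega).
by apply: (edge_boundary hOmega hTh EN); exists t.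
Qed.

Lemma sum_delta (F : 'I_n -> 'I_3 -> R) K i :
  \sum_M \sum_m ((M, m) == (K, i))%:R * F M m = F K i.
Proof.
rewrite pair_big /= (bigD1 (K, i)) //= eqxx mul1r big1 ?addr0 // => -[M m] /=.
by move=> /negbTE ->; rewrite mul0r.
Qed.

Variables er ei : 'I_n -> R * (R * R).
Hypothesis second_eq : forall z t, in_S10 Omega Th z -> in_P0_skel Omega Th t ->
  ip_grad Th z (cbroken er ei) - dual_skel Th t (cbroken er ei) = 0.

Lemma grad_orthogonal (z : R * R -> R) : (forall x, bdry Omega x -> z x = 0) ->
  \sum_K area (Th K) * dot (mesh_interp Th z K).2 (er K).2 = 0 /\
  \sum_K area (Th K) * dot (mesh_interp Th z K).2 (ei K).2 = 0.
Proof.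
have s0 (F : 'I_n -> 'I_3 -> R) : \sum_M \sum_i 0 * F M i = 0.
  by rewrite big1 // => M _; rewrite big1 // => i _; rewrite mul0r.
(* The zero skeleton function, obtained from zero fluxes, isolates the gradient term. *)
move=> z0; have t0 := rt_in_P0_skel hOmega hTh (c := fun _ _ => 0) (fun phi _ => s0 _).
have := second_eq (interp_in_S10 hOmega hTh z0) t0.
rewrite (ip_grad_real hTh) (dual_skel_real hTh) !s0 oppr0 subr0.
by move=> /eqP; rewrite eq_complex /= oppr_eq0 => /andP[/eqP ? /eqP ?].
Qed.

Lemma mid_orthogonal (c : 'I_n -> 'I_3 -> R) :
  (forall phi, test_function Omega phi -> \sum_M \sum_i c M i * edge_mean (Th M) i phi = 0) ->
  \sum_M \sum_i c M i * midvalue Th er M i = 0 /\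
  \sum_M \sum_i c M i * midvalue Th ei M i = 0.
Proof.
move=> bal; have z0 : forall x, bdry Omega x -> (fun _ : R * R => 0 : R) x = 0 by [].
have := second_eq (interp_in_S10 hOmega hTh z0) (rt_in_P0_skel hOmega hTh bal).
rewrite (ip_grad_real hTh) (dual_skel_real hTh); have [-> ->] := grad_orthogonal z0.
rewrite oppr0 sub0r => /eqP; rewrite oppr_eq0 eq_complex /= oppr_eq0.
by move=> /andP[/eqP ? /eqP ?].
Qed.

Lemma mid_continuous K i L j : K != L -> edge (Th L) j = edge (Th K) i ->
  midvalue Th er L j = midvalue Th er K i /\ midvalue Th ei L j = midvalue Th ei K i.
Proof.
(* A unit flux through the common edge, out of [L] and into [K]; the two edge means of a test
   function cancel. *)
move=> KL E; pose c M m : R := ((M, m) == (L, j))%:R - ((M, m) == (K, i))%:R.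
have cE (F : 'I_n -> 'I_3 -> R) : \sum_M \sum_m c M m * F M m = F L j - F K i.
  under eq_bigr do (under eq_bigr do rewrite mulrBl; rewrite sumrB).
  by rewrite sumrB !sum_delta.
have [|] := mid_orthogonal (c := c).
  move=> phi [sphi _ _]; rewrite cE (edge_mean_eq _ E) ?subrr //.
  exact: smooth_continuous.
by rewrite !cE => /eqP; rewrite subr_eq0 => /eqP -> /eqP; rewrite subr_eq0 => /eqP ->.
Qed.

Lemma mid_boundary K i : neighbour Th K i = None ->
  midvalue Th er K i = 0 /\ midvalue Th ei K i = 0.
Proof.
move=> EN; have [|] := mid_orthogonal (c := fun M m => ((M, m) == (K, i))%:R).
  by move=> phi tphi; rewrite sum_delta; exact: edge_mean_boundary.
by rewrite !sum_delta.
Qed.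

End SecondEquation.

(** The box is chosen before the mesh. It is one unit larger than a box around the open domain,
    because the triangles lie in the closure. *)
Lemma tri_box (R : realType) (Omega : set (R * R)) : bounded_polygonal_domain Omega ->
  exists B : R, forall n (Th : mesh R n), conforming_triangulation Omega Th ->
  forall K x, tri_set (Th K) x -> `|x.1| <= B /\ `|x.2| <= B.
Proof.
move=> hO; have [M M0 hM] := bounded_plane_box (bounded_omega hO).
exists (M + 1) => n Th hTh K x Kx.
have cx : closure Omega x by apply/(mesh_cover hTh); exists K.
have [y [Oy [y1 y2]]] := cx _ (nbhsx_ballx x 1 ltr01).
have [h1 h2] := hM y Oy; split.
  rewrite -[x.1](subrK y.1) addrC; apply: le_trans (ler_normD _ _) _.
  by rewrite lerD // ltW.
rewrite -[x.2](subrK y.2) addrC; apply: le_trans (ler_normD _ _) _.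
by rewrite lerD // ltW.
Qed.

Lemma sqrt_le_scale (R : realType) (k a b : R) : 0 <= k -> 0 <= b -> a <= k * b ->
  Num.sqrt a <= Num.sqrt k * Num.sqrt b.
Proof. by move=> k0 b0 ab; rewrite -sqrtrM // ler_wsqrtr. Qed.

Theorem theorem14 (R : realType) (Omega : set (R * R)) (gamma : R)
  (hOmega : bounded_polygonal_domain Omega) :
  exists c C : R, 0 < c /\ 0 < C /\
    forall (n : nat) (Th : mesh R n),
      conforming_triangulation Omega Th -> shape_regular gamma Th ->
      forall (lambda : R[i]) (u : broken R n) (sigma : skel R n) (eps : broken R n),
        dpg_solution Omega Th lambda u sigma eps ->
        c * eta_bar Th eps <= eta Th eps /\ eta Th eps <= C * eta_bar Th eps.
Proof.
have [B hB] := tri_box hOmega.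
(* Nothing is known about the sign of [gamma] before a triangle is given, hence the absolute values
   below; the added 1 makes [kl] and [ku] positive. *)
pose kl := 192 * gamma ^+ 4 + 1.
pose kp := `|2 * poincare_cst gamma B + 8 * gamma ^+ 2 * B ^+ 2|.
pose kg := `|96 * gamma ^+ 3 * (valence gamma)%:R ^+ 3|.
pose ku := (1 + kp) * kg + 1.
have kl0 : 0 < kl.
  by rewrite ltr_wpDl // mulr_ge0 // (exprM gamma 2 2) sqr_ge0.
have kp0 : 0 <= kp by exact: normr_ge0.
have kg0 : 0 <= kg by exact: normr_ge0.
have ku0 : 0 < ku by rewrite ltr_wpDl // mulr_ge0 // addr_ge0.
exists (Num.sqrt kl)^-1, (Num.sqrt ku); rewrite invr_gt0 !sqrtr_gt0; split=> //; split=> //.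
move=> n Th hTh hreg lambda u sigma eps [_ _ eP1 _ eq2].
have /boolp.choice[zr hzr] : forall K, exists zr : (R * R) * R,
    regular_disc (Th K) gamma zr.1 zr.2.
  by move=> K; have [z [r h]] := shape_regular_disc K hreg; exists (z, r).
have /boolp.choice[f hf] : forall K, exists f : (R * (R * R)) * (R * (R * R)),
    eps K = fun x => aff f.1 x +i* aff f.2 x.
  by move=> K; have [fr [fi h]] := affine_parts (eP1 K); exists (fr, fi).
pose er K := (f K).1; pose ei K := (f K).2.
have epsE : eps = cbroken er ei by apply/funext => K; exact: hf.
rewrite {}epsE in eq2 *; move: eq2 => eq2 {eps eP1 hf}.
have disc K : regular_disc (Th K) gamma (zr K).1 (zr K).2 := hzr K.
have mc := mid_continuous hOmega hTh eq2.
have mb := mid_boundary hOmega hTh eq2.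
pose D (e : 'I_n -> R * (R * R)) := \sum_K area (Th K) * sqn (e K).2.
pose J (e : 'I_n -> R * (R * R)) := \sum_K Num.sqrt (area (Th K)) *
   \sum_i edge_length (Th K) i * sqn (grad_jump Th e K i).
have A0 K : 0 <= area (Th K) by exact/ltW/area_gt0/(mesh_nondegenerate hTh).
have D0 e : 0 <= D e by apply: sumr_ge0 => K _; rewrite mulr_ge0 ?sqn_ge0.
have J0 e : 0 <= J e.
  apply: sumr_ge0 => K _; rewrite mulr_ge0 ?sqrtr_ge0 // sumr_ge0 // => i _.
  by rewrite mulr_ge0 ?sqn_ge0 // len_ge0.
have gj e : (forall K i L j, K != L -> edge (Th L) j = edge (Th K) i ->
      midvalue Th e L j = midvalue Th e K i) ->
    (forall K i, neighbour Th K i = None -> midvalue Th e K i = 0) ->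
    \sum_K area (Th K) * dot (nodal_interp Omega Th e K).2 (e K).2 = 0 ->
    D e <= kg * J e.
  move=> h1 h2 h3; apply: le_trans (grad_le_jumps hOmega hTh disc h1 h2 h3) _.
  by apply: ler_wpM2r (J0 e) _ _ (ler_norm _).
have po e : (forall K i L j, K != L -> edge (Th L) j = edge (Th K) i ->
      midvalue Th e L j = midvalue Th e K i) ->
    (forall K i, neighbour Th K i = None -> midvalue Th e K i = 0) ->
    \sum_K area (Th K) * (2 * midvalue Th e K 0 ^+ 2 + 8 * gamma ^+ 2 * B ^+ 2 * sqn (e K).2)
      <= kp * D e.
  move=> h1 h2; have h3 := poincare_midpoints hTh disc h1 h2 (hB n Th hTh).
  apply: le_trans (ler_wpM2r (D0 e) (ler_norm _)).
  have -> : \sum_K area (Th K) * (2 * midvalue Th e K 0 ^+ 2 + 8 * gamma ^+ 2 * B ^+ 2 * sqn (e K).2) =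
      2 * \sum_K area (Th K) * midvalue Th e K 0 ^+ 2 + 8 * gamma ^+ 2 * B ^+ 2 * D e.
    by rewrite /D !mulr_sumr -big_split /=; apply: eq_bigr => K _; ring.
  by rewrite [leRHS]mulrDl lerD2r -[leRHS]mulrA ler_wpM2l.
have or (e : 'I_n -> R * (R * R)) : forall x, bdry Omega x -> nodal Omega Th e x = 0.
  by move=> x; exact: nodal_bdry.
have gr := gj er (fun K i L j KL E => (mc K i L j KL E).1) (fun K i EN => (mb K i EN).1)
  (grad_orthogonal hOmega hTh eq2 (or er)).1.
have gi := gj ei (fun K i L j KL E => (mc K i L j KL E).2) (fun K i EN => (mb K i EN).2)
  (grad_orthogonal hOmega hTh eq2 (or ei)).2.
have pr := po er (fun K i L j KL E => (mc K i L j KL E).1) (fun K i EN => (mb K i EN).1).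
have pi := po ei (fun K i L j KL E => (mc K i L j KL E).2) (fun K i EN => (mb K i EN).2).
pose S := \sum_K Rintegral (leb2 R) (tri_set (Th K)) (fun x => sqmod (cbroken er ei K x)).
have S0 : 0 <= S.
  apply: sumr_ge0 => K _; apply: Rintegral_ge0 => x _.
  by rewrite addr_ge0 // sqr_ge0.
have SD : S <= kp * (D er + D ei).
  (* On each triangle the square of the function is bounded pointwise by its first edge mean and its
     gradient, and the Poincare inequality bounds the sum of the edge means. *)
  rewrite mulrDr; apply: le_trans (lerD pr pi); rewrite -big_split /=.
  apply: ler_sum => K _; rewrite -mulrDr; apply: (sq_norm_le hTh) => x Kx.
  by apply: lerD; exact: (sup_aff_le hTh disc _ (hB n Th hTh)).
have etaE : eta Th (cbroken er ei) = Num.sqrt (S + (D er + D ei)).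
  rewrite /eta /normV; congr (Num.sqrt (_ + _)); rewrite -big_split /=.
  by apply: eq_bigr => K _; rewrite (grad_norm_real hTh) mulrDr.
have barE : eta_bar Th (cbroken er ei) = Num.sqrt (J er + J ei).
  rewrite /eta_bar; congr (Num.sqrt _); rewrite -big_split /=.
  apply: eq_bigr => K _; rewrite -mulrDr -big_split /=; congr (_ * _).
  by apply: eq_bigr => i _; rewrite sqnorm_jump_real mulrDr.
have JD e : J e <= kl * D e.
  apply: le_trans (jumps_le_grad hTh disc e) _.
  by rewrite -/(D e) /kl [leRHS]mulrDl mul1r lerDl.
rewrite etaE barE; split.
  rewrite ler_pdivrMl ?sqrtr_gt0 //; apply: sqrt_le_scale; first exact: ltW.
    by rewrite !addr_ge0.
  apply: le_trans (lerD (JD er) (JD ei)) _.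
  by rewrite -mulrDr ler_wpM2l ?(ltW kl0) // lerDr.
apply: sqrt_le_scale; [exact: ltW | exact: addr_ge0 |].
have h1 : S + (D er + D ei) <= (1 + kp) * (D er + D ei) by rewrite mulrDl mul1r addrC lerD2l.
apply: le_trans h1 _.
have kp1 : 0 <= 1 + kp by rewrite addr_ge0.
apply: le_trans (ler_wpM2l kp1 (lerD gr gi)) _.
by rewrite -mulrDr mulrA /ku [leRHS]mulrDl mul1r lerDl addr_ge0.
Qed.
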